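(* Let $D$ be a discriminant form of the special shape described in the context, with level $N=|D|>1$, even signature $r$, character $\chi_D$ and sign vector $\epsilon$, and let $k$ be an integer with $k\equiv\frac r2\pmod 2$. Let $f\in A^\epsilon(N,k,\chi_D)$. (1) If $f$ is holomorphic (respectively, vanishes) at $\infty$, then $f\in M^\epsilon(N,k,\chi_D)$ (respectively, $f\in S^\epsilon(N,k,\chi_D)$). (2) If $f=q^{-d}+O(1)$ with $d$ a positive integer coprime to $N$, then $f$ is holomorphic at all cusps other than $\infty$. (3) If $k\le0$ and $f,g\in A^\epsilon(N,k,\chi_D)$ have the same principal part at $\infty$, then $f=g$.
   Context: Discriminant forms: a discriminant form is a finite abelian group $D$ with a quadratic form $q:D\to\mathbb Q/\mathbb Z$ with nondegenerate associated bilinear form; its level is the smallest positive $N$ with $Nq=0$ on $D$; its signature in $\mathbb Z/8\mathbb Z$ is the signature mod 8 of any even lattice $L$ with $L'/L\cong D$. Shape of $D$: $D=\bigoplus_p D_p$ (orthogonal sum over primes). For odd $p$, $D_p$ is trivial or $D_p=p^{\delta_p}$, $\delta_p\in\{\pm1\}$: cyclic of order $p$ with a generator $\gamma$ with $q(\gamma)=a/p$, $\delta_p=\left(\frac{2a}{p}\right)$. For $p=2$, $D_2$ is one of: trivial; $2_t^{+2}$ with $t\in\{\pm2\}$, i.e. the orthogonal sum of two cyclic groups of order 2 whose generators both have $q$-value $\frac{t/2}{4}$; or $2_{t_1}^{+1}\oplus4_{t_2}^{\delta_2}$ with $t_1\in\{\pm1\}$, $t_2\in\{\pm1,\pm3\}$,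 $\delta_2=\left(\frac{2}{t_2}\right)$, i.e. the orthogonal sum of a cyclic group of order 2 with generator of $q$-value $t_1/4$ and a cyclic group of order 4 with generator of $q$-value $t_2/8$. Then the level is $N=|D|$ and the signature $r$ is even. Character: $\chi_D=\prod_{p\mid N}\chi_p$; $\chi_p=\left(\frac{\cdot}{p}\right)$ for odd $p\mid N$; $\chi_2$ is trivial if $D_2$ is trivial, $\left(\frac{-4}{\cdot}\right)$ if $D_2=2_t^{+2}$, and $\left(\frac{-2a}{\cdot}\right)$ with $a=\left(\frac{-1}{t_1t_2}\right)$ if $D_2=2_{t_1}^{+1}\oplus4_{t_2}^{\delta_2}$. Sign vector: $\epsilon=(\epsilon_p)_{p\mid N}$ with $\epsilon_p=\chi_p(2N/p)\delta_p$ for odd $p$; $\epsilon_2=\chi_2(Nt/8)$ if $D_2=2_t^{+2}$; $\epsilon_2=\chi_2(t_2N/8)$ if $D_2=2_{t_1}^{+1}\oplus 4_{t_2}^{\delta_2}$. Forms: $A(N,k,\chi_D)$, $M(N,k,\chi_D)$, $S(N,k,\chi_D)$ are the spaces of weakly holomorphic modular forms (holomorphic on the upper half plane, meromorphic at all cusps), holomorphic modular forms, and cusp forms of weight $k$, level $\Gamma_0(N)$ and character $\chi_D$; here $q=e^{2\pi i\tau}$. $A^\epsilon(N,k,\chi_D)$ is the subspace of $f=\sum_na(n)q^n\in A(N,k,\chi_D)$ with $a(n)=0$ whenever $\chi_p(n)=-\epsilon_p$ for some prime $p\mid N$; $M^\epsilon=M\cap A^\epsilon$, $S^\epsilon=S\cap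 A^\epsilon$. The principal part of $f=\sum a(n)q^n$ at $\infty$ is $\sum_{n<0}a(n)q^n$ (no constant term). *)

(* Defs.v *)
From HB Require Import structures.
From mathcomp Require Import all_boot all_order all_algebra.
From mathcomp Require Import fingroup gproduct pgroup.
From mathcomp Require Import complex.
From mathcomp Require Import boolp classical_sets reals topology normedtype.
From mathcomp Require Import sequences derive exp trigo.

Set Implicit Arguments.
Unset Strict Implicit.
Unset Printing Implicit Defensive.

Import Order.TTheory GRing.Theory Num.Theory.
Import numFieldNormedType.Exports.

Local Open Scope ring_scope.
Local Open Scope classical_set_scope.
Local Open Scope complex_scope.

Definition legendre (a : int) (p : nat) : int :=
  if (p%:Z %| a)%Z then 0
  else if [exists x : 'I_p, (x%:Z ^+ 2 == a %[mod p%:Z])%Z] then 1 else -1.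

Definition kronecker_prime (a : int) (p : nat) : int :=
  if p == 2%N then
    if (2 %| a)%Z then 0 else if (a %% 8)%Z \in [:: 1; 7] then 1 else -1
  else legendre a p.

(* The Kronecker symbol (a / n) for all integers a and n, with
   (a / -1) = -1 exactly when a < 0, and (a / 0) = 1 exactly when a = 1, -1. *)
Definition kronecker (a n : int) : int :=
  if n == 0 then (`|a|%N == 1%N)%:Z
  else (if (a < 0) && (n < 0) then -1 else 1) *
       \prod_(p <- primes `|n|%N) kronecker_prime a p ^+ logn p `|n|%N.

(* Elements of Q/Z are represented by rational lifts compared modulo Z. *)
Definition eqQZ (x y : rat) : Prop := x - y \is a Num.int.

Definition polar (D : zmodType) (q : D -> rat) (x y : D) : rat :=
  q (x + y) - q x - q y.

Record discForm := DiscForm {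
  disc_group :> finZmodType;
  disc_q : disc_group -> rat;
  disc_qZ : forall (m : int) (x : disc_group),
    eqQZ (disc_q (x *~ m)) (m%:~R ^+ 2 * disc_q x);
  disc_bD : forall x y z : disc_group,
    eqQZ (polar disc_q (x + y) z) (polar disc_q x z + polar disc_q y z);
  disc_nondeg : forall x : disc_group,
    (forall y, eqQZ (polar disc_q x y) 0) -> x = 0
}.

Definition is_level (D : discForm) (N : nat) : Prop :=
  let kills M := forall x : D, eqQZ (M%:R * disc_q x) 0 in
  [/\ (0 < N)%N, kills N & forall M : nat, (0 < M)%N -> kills M -> (N <= M)%N].

(* A lattice of rank n is Z^n, inside Q^n, with Gram matrix G. *)
Definition even_lattice (n : nat) (G : 'M[int]_n) : Prop :=
  [/\ G^T = G, forall i, (2 %| G i i)%Z & \det G != 0].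

Definition lattice_form (n : nat) (G : 'M[int]_n) (u v : 'rV[rat]_n) : rat :=
  (u *m map_mx intr G *m v^T) 0 0.

Definition integral_vec (n : nat) (v : 'rV[rat]_n) : Prop :=
  forall i, v 0 i \is a Num.int.

Definition dual_vec (n : nat) (G : 'M[int]_n) (v : 'rV[rat]_n) : Prop :=
  forall w, integral_vec w -> lattice_form G v w \is a Num.int.

(* phi induces an isometry from L'/L, with the form v |-> (v, v)/2 mod Z, onto D;
   its values outside L' are irrelevant. *)
Definition lattice_disc (n : nat) (G : 'M[int]_n) (D : discForm) : Prop :=
  exists phi : 'rV[rat]_n -> D,
    [/\ forall u v, dual_vec G u -> dual_vec G v -> phi (u + v) = phi u + phi v,
        forall v, dual_vec G v -> (phi v = 0 <-> integral_vec v),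
        forall x, exists2 v, dual_vec G v & phi v = x
      & forall v, dual_vec G v ->
          eqQZ (disc_q (phi v)) (lattice_form G v v / 2)].

Definition lattice_signature (n : nat) (G : 'M[int]_n) (s : int) : Prop :=
  exists (P : 'M[rat]_n) (d : 'rV[rat]_n),
    [/\ P \in unitmx, P *m map_mx intr G *m P^T = diag_mx d
      & s = #|[set i | 0 < d 0 i]%SET|%:Z - #|[set i | d 0 i < 0]%SET|%:Z].

(* r represents the signature of D in Z/8Z. *)
Definition disc_signature (D : discForm) (r : int) : Prop :=
  exists (n : nat) (G : 'M[int]_n) (s : int),
    [/\ even_lattice G, lattice_disc G D, lattice_signature G s
      & (r = s %[mod 8])%Z].

(* The 2-part: trivial, 2_t^{+2}, or 2_{t1}^{+1} + 4_{t2}^{delta_2}; in the last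
   case delta_2 = (2 / t2) is determined by t2. *)
Inductive two_shape : Type :=
  | Two_trivial
  | Two_22 of int
  | Two_24 of int & int.

(* odd_sign p is delta_p; it is only meaningful at odd primes with D_p <> 0. *)
Record disc_shape := DiscShape {
  odd_sign : nat -> int;
  two_part : two_shape
}.

(* Additive groups are viewed as groups below: <[x]> is the subgroup generated by
   x, #[x] the additive order of x, and \x the internal direct sum. *)
Definition ppart (D : discForm) (p : nat) : {set D} := pcore p [set: D]%SET.

Definition odd_component (D : discForm) (p : nat) (delta : int) : Prop :=
  exists (x : D) (a : int),
    [/\ ppart D p = <[x]>%g, #[x]%g = p, eqQZ (disc_q x) (a%:~R / p%:R),
        delta = legendre (2 * a) p & delta \in [:: 1; -1]].

Definition orthogonal_pair (D : discForm) (x y : D) : Prop :=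
  (<[x]> \x <[y]> = ppart D 2)%g /\ eqQZ (polar (@disc_q D) x y) 0.

Definition two_component (D : discForm) (s : two_shape) : Prop :=
  match s with
  | Two_trivial => ppart D 2 = 1%g
  | Two_22 t => t \in [:: 2; -2] /\
      exists x y : D,
        [/\ #[x]%g = 2%N, #[y]%g = 2%N, orthogonal_pair x y,
            eqQZ (disc_q x) (t%:~R / 2 / 4) & eqQZ (disc_q y) (t%:~R / 2 / 4)]
  | Two_24 t1 t2 => [/\ t1 \in [:: 1; -1], t2 \in [:: 1; -1; 3; -3] &
      exists x y : D,
        [/\ #[x]%g = 2%N, #[y]%g = 4%N, orthogonal_pair x y,
            eqQZ (disc_q x) (t1%:~R / 4) & eqQZ (disc_q y) (t2%:~R / 8)]]
  end.

Definition has_shape (D : discForm) (s : disc_shape) : Prop :=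
  (forall p : nat, prime p -> odd p ->
     ppart D p = 1%g \/ odd_component D p (odd_sign s p)) /\
  two_component D (two_part s).

Definition chi_prime (s : disc_shape) (p : nat) (n : int) : int :=
  if p == 2%N then
    match two_part s with
    | Two_trivial => 1
    | Two_22 _ => kronecker (-4) n
    | Two_24 t1 t2 => kronecker (-2 * kronecker (-1) (t1 * t2)) n
    end
  else legendre n p.

Definition chi_disc (N : nat) (s : disc_shape) (n : int) : int :=
  \prod_(p <- primes N) chi_prime s p n.

(* The integer divisions are exact when N is the level. *)
Definition sign_vector (N : nat) (s : disc_shape) (p : nat) : int :=
  if p == 2%N then
    match two_part s with
    | Two_trivial => 1
    | Two_22 t => chi_prime s 2 (N%:Z * t %/ 8)%Z
    | Two_24 _ t2 => chi_prime s 2 (t2 * N%:Z %/ 8)%Z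
    end
  else chi_prime s p (2 * N%:Z %/ p%:Z)%Z * odd_sign s p.

Definition upper (R : realType) (tau : R[i]) : Prop := 0 < complex.Im tau.

Definition cexp (R : realType) (z : R[i]) : R[i] :=
  (expR (complex.Re z))%:C *
    (cos (complex.Im z) +i* sin (complex.Im z)).

(* q^(n/h), where q = exp (2 pi i tau) *)
Definition qpow (R : realType) (h : nat) (n : int) (tau : R[i]) : R[i] :=
  cexp ((2 * trigo.pi)%:C * 'i * n%:~R * tau / h%:R).

Definition cocycle (R : realType) (M : 'M[int]_2) (tau : R[i]) : R[i] :=
  (M 1 0)%:~R * tau + (M 1 1)%:~R.

Definition moebius (R : realType) (M : 'M[int]_2) (tau : R[i]) : R[i] :=
  ((M 0 0)%:~R * tau + (M 0 1)%:~R) / cocycle M tau.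

Definition slash (R : realType) (k : int) (f : R[i] -> R[i]) (M : 'M[int]_2)
    (tau : R[i]) : R[i] :=
  cocycle M tau ^ (- k) * f (moebius M tau).

Definition SL2Z (M : 'M[int]_2) : Prop := \det M = 1.

Definition Gamma0 (N : nat) (M : 'M[int]_2) : Prop :=
  SL2Z M /\ (N%:Z %| (M 1 0)%R)%Z.

(* g tau = sum over the integers n of a n * q^(n/h) on the upper half-plane,
   where a n = 0 for n < - m with some m. *)
Definition qexp (R : realType) (h : nat) (g : R[i] -> R[i]) (a : int -> R[i]) :
    Prop :=
  (0 < h)%N /\
  exists m : nat,
    (forall n : int, n < - m%:Z -> a n = 0) /\
    (forall tau, upper tau ->
       series (fun j : nat => a (j%:Z - m%:Z) * qpow h (j%:Z - m%:Z) tau : R[i]^o)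
         @ \oo --> (g tau : R[i]^o)).

(* Behaviour of f at the cusp M oo, for M in SL2(Z). *)
Definition mero_at (R : realType) (k : int) (f : R[i] -> R[i]) (M : 'M[int]_2) :
    Prop :=
  exists h a, qexp h (slash k f M) a.

Definition holo_at (R : realType) (k : int) (f : R[i] -> R[i]) (M : 'M[int]_2) :
    Prop :=
  exists h a, qexp h (slash k f M) a /\ (forall n : int, n < 0 -> a n = 0).

Definition vanish_at (R : realType) (k : int) (f : R[i] -> R[i])
    (M : 'M[int]_2) : Prop :=
  exists h a, qexp h (slash k f M) a /\ (forall n : int, n <= 0 -> a n = 0).

(* Functions are defined on the whole complex plane, but only their values on
   the upper half-plane matter. *)
Definition weakly_holo_forms (R : realType) (N : nat) (k : int)
    (chi : int -> int) : set (R[i] -> R[i]) :=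
  [set f | [/\ forall tau, upper tau -> derivable (f : R[i]^o -> R[i]^o) tau 1,
               forall M, Gamma0 N M -> forall tau, upper tau ->
                 f (moebius M tau) =
                   (chi (M 1 1))%:~R * cocycle M tau ^ k * f tau
             & forall M, SL2Z M -> mero_at k f M]].

Definition modular_forms (R : realType) (N : nat) (k : int)
    (chi : int -> int) : set (R[i] -> R[i]) :=
  [set f | weakly_holo_forms N k chi f /\
           forall M, SL2Z M -> holo_at k f M].

Definition cusp_forms (R : realType) (N : nat) (k : int)
    (chi : int -> int) : set (R[i] -> R[i]) :=
  [set f | weakly_holo_forms N k chi f /\
           forall M, SL2Z M -> vanish_at k f M].

Definition Aeps (R : realType) (N : nat) (k : int) (s : disc_shape) :
    set (R[i] -> R[i]) :=
  [set f | weakly_holo_forms N k (chi_disc N s) f /\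
     exists a, qexp 1 f a /\
       forall (n : int) (p : nat), prime p -> (p %| N)%N ->
         chi_prime s p n = - sign_vector N s p -> a n = 0].

Definition Meps (R : realType) (N : nat) (k : int) (s : disc_shape) :
    set (R[i] -> R[i]) :=
  modular_forms N k (chi_disc N s) `&` Aeps N k s.

Definition Seps (R : realType) (N : nat) (k : int) (s : disc_shape) :
    set (R[i] -> R[i]) :=
  cusp_forms N k (chi_disc N s) `&` Aeps N k s.

(* f = q^(-d) + O(1) *)
Definition simple_principal_part (R : realType) (f : R[i] -> R[i]) (d : nat) :
    Prop :=
  exists a, [/\ qexp 1 f a, a (- d%:Z) = 1
              & forall n : int, n < 0 -> n != - d%:Z -> a n = 0].

Definition same_principal_part (R : realType) (f g : R[i] -> R[i]) : Prop :=
  exists a b, [/\ qexp 1 f a, qexp 1 g b & forall n : int, n < 0 -> a n = b n].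

(* The cusps M oo and oo are equivalent under Gamma0(N). *)
Definition cusp_infty (N : nat) (M : 'M[int]_2) : Prop :=
  exists2 g, Gamma0 N g & (g *m M) 1 0 = 0.

(* Main.v *)
(** For a prime p dividing N, with p-part q of N, the sign condition makes the
    coefficients a(n) of f vanish on a whole residue class n0 mod q prime to p, that
    is, sum_b e(-n0 b/q) f(tau + b/q) = 0. Apply this relation to M tau, where M in
    SL2(Z) has lower left entry c. If p is odd and does not divide c, the term b = 0 is
    a multiple of f|M, and every other term is of the form f|M'(tau/p^2 + x) with M' of
    lower left entry pc. If p = 2, the terms b = 0 and b = q/2 are left over; they are
    separated by their behaviour under translations, because chi_2(n) = -1 for
    n = 1 + q/2 mod q. Going through the primes, one gets the expansion of f at any cusp
    from its expansion at infinity, the exponents being divided by squares of integers,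
    which gives (1). In (2), a pole at a cusp with q not dividing c has an exponent
    -d/w^2 with too many factors p in w to be compatible with the period N/gcd(N,c) of
    f|M.

    In (3), f - g is holomorphic at all cusps by (1). A form of weight k <= 0 that is
    holomorphic at the cusps satisfies |f|^2 = O(y^(-k)) on the upper half-plane. If
    k < 0, all coefficients vanish on letting y tend to 0. If k = 0, f is constant by
    the maximum principle, and the character is nontrivial. *)

Require Import Defs.
From mathcomp Require Import all_boot all_order all_algebra.
From mathcomp Require Import fingroup gproduct pgroup nilpotent sylow cyclic.
From mathcomp Require Import finfield complex.
From mathcomp Require Import boolp classical_sets reals topology normedtype.
From mathcomp Require Import sequences derive exp trigo.
From mathcomp Require Import ring lra zify.

Set Implicit Arguments.
Unset Strict Implicit.
Unset Printing Implicit Defensive.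

Import Order.TTheory GRing.Theory Num.Theory.
Import numFieldNormedType.Exports.
Import ComplexField.Normc.

Local Open Scope ring_scope.
Local Open Scope classical_set_scope.
Local Open Scope complex_scope.

(** Expansions are followed through a predicate on the rational exponents that occur ([has_exp]).
    Such predicates pass through sums, translations and rescalings, and a period of the function is
    imposed on them by averaging over translates. The predicate [0 <= l] serves (1) and (3), [0 < l]
    the vanishing case, and in (2) the predicate records the exact shape -d/w^2 of the polar
    exponents.

    The squares in the denominators come from determinants: the shift by b/m is given by a matrix of
    determinant m^2, and an integral matrix of determinant n whose first column has gcd g multiplies
    exponents by g^2/n.

    The analysis in (3) is reduced to polynomials, where Parseval is an exact finite average over
    roots of unity; series are reached by uniform approximation on Im tau >= y0. The obstacle to the
    maximum principle is that the supremum of |f| may be approached only at a cusp. A Schwarz lemma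
    with explicit constants bounds every f|M away from the supremum there, and this bound is uniform
    because f|M depends only on M mod N. *)

Definition e2 (R : realType) (x : R[i]) : R[i] :=
  cexp ((2 * trigo.pi)%:C * 'i * x).

(** * The exponential e(x) = exp(2 pi i x) and sums of roots of unity *)

Section Exponential.
Variable R : realType.
Implicit Types (x y tau : R[i]) (n : int).

Lemma cexpD x y : cexp (x + y) = cexp x * cexp y.
Proof.
case: x => a b; case: y => c d; rewrite /cexp /= expRD cosD sinD.
by apply/eqP; rewrite eq_complex /=; apply/andP; split; apply/eqP; ring.
Qed.

Lemma e2D x y : e2 (x + y) = e2 x * e2 y.
Proof. by rewrite /e2 mulrDr cexpD. Qed.

Lemma e2_0 : e2 0 = 1 :> R[i].
Proof.
rewrite /e2 mulr0 /cexp /= expR0 cos0 sin0.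
by apply/eqP; rewrite eq_complex /=; apply/andP; split; apply/eqP; ring.
Qed.

Lemma e2_neq0 x : e2 x != 0.
Proof.
apply/eqP => h; have := e2D x (- x); rewrite h mul0r subrr e2_0.
by move/eqP; rewrite oner_eq0.
Qed.

Lemma e2N x : e2 (- x) = (e2 x)^-1.
Proof.
apply: (mulfI (e2_neq0 x)); rewrite -e2D subrr e2_0 divff //; exact: e2_neq0.
Qed.

Lemma e2Mn x (n : nat) : e2 (n%:R * x) = e2 x ^+ n.
Proof.
elim: n => [|n IH]; first by rewrite mul0r e2_0 expr0.
by rewrite -natr1 mulrDl mul1r e2D IH exprSr.
Qed.

Lemma e2_1 : e2 1 = 1 :> R[i].
Proof.
rewrite /e2 mulr1 /cexp /= !(mul0r, mulr0, mulr1, subr0, addr0) expR0.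
rewrite mulr_natl cos2pi sin2pi.
by apply/eqP; rewrite eq_complex /=; apply/andP; split; apply/eqP; ring.
Qed.

Lemma e2_int n : e2 (n%:~R) = 1 :> R[i].
Proof.
case: n => n; first by rewrite -[X in e2 X]mulr1 e2Mn e2_1 expr1n.
by rewrite NegzE rmorphN e2N /= -[X in e2 X]mulr1 e2Mn e2_1 expr1n invr1.
Qed.

Lemma e2_half : e2 2^-1 = -1 :> R[i].
Proof.
have /eqP : e2 2^-1 ^+ 2 = 1 :> R[i].
  by rewrite -e2Mn mulfV ?e2_1 // pnatr_eq0.
rewrite sqrf_eq1 => /orP[/eqP h|/eqP //].
move: h; rewrite /e2 /cexp.
have -> : (2 * trigo.pi)%:C * 'i * 2^-1 = 0 +i* trigo.pi :> R[i].
  apply/eqP; rewrite eq_complex /=; apply/andP; split; apply/eqP; field.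
    by [].
  by [].
rewrite /= expR0 cospi sinpi => /eqP; rewrite eq_complex /=.
by rewrite !(mul0r, mulr0, mul1r, subr0, addr0) => /andP[/eqP h _]; exfalso; lra.
Qed.

Lemma e2_odd_half n : odd `|n|%N -> e2 (n%:~R / 2%:R) = -1 :> R[i].
Proof.
move=> on; have C2 : (2%:R : R[i]) != 0 by rewrite pnatr_eq0.
have -> : (n%:~R : R[i]) / 2%:R = (n %/ 2)%Z%:~R + 2^-1.
  have -> : n = (n %/ 2)%Z * 2 + 1 by lia.
  have -> : (((n %/ 2)%Z * 2 + 1) %/ 2)%Z = (n %/ 2)%Z by lia.
  by rewrite rmorphD rmorphM /=; field.
by rewrite e2D e2_int e2_half mul1r.
Qed.

Lemma normc_cexp x : normc (cexp x) = expR (complex.Re x).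
Proof.
case: x => a b; rewrite /cexp /=; set E := expR _.
have -> : (E * cos b - 0 * sin b) ^+ 2 + (E * sin b + 0 * cos b) ^+ 2 = E ^+ 2.
  by rewrite !mul0r subr0 addr0 !exprMn -mulrDr cos2Dsin2 mulr1.
by rewrite sqrtr_sqr ger0_norm // expR_ge0.
Qed.

Lemma e2_normc x : normc (e2 x) = expR (- (2 * trigo.pi * complex.Im x)).
Proof.
rewrite /e2 normc_cexp; congr expR; case: x => a b /=; ring.
Qed.

(** Reduce to t = r/m with 0 < t < 1; then the real part of e(t) is 1 - 2 sin(pi t)^2 < 1. *)
Lemma e2_ratio_neq1 (m : nat) n : (0 < m)%N -> ~~ (m %| n)%Z ->
  e2 (n%:~R / m%:R) != 1 :> R[i].
Proof.
move=> m0 ndiv; apply/eqP.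
have hm : (m%:R : R[i]) != 0 by rewrite pnatr_eq0 -lt0n.
have hmZ : (m%:Z != 0) by rewrite eqz_nat -lt0n.
rewrite (divz_eq n m) rmorphD rmorphM /= mulrDl e2D.
rewrite mulfK // e2_int mul1r.
have := modz_ge0 n hmZ; have := ltz_pmod n (m0 : 0 < m%:Z).
have rn0 : (n %% m)%Z != 0 by apply: contra ndiv => /eqP h; apply/dvdz_mod0P.
move: rn0; case: (n %% m)%Z => [r|] //; rewrite eqz_nat ltz_nat => r0 rm _ h.
have rpos : (0 < r)%N by rewrite lt0n.
pose t : R := r%:R / m%:R.
have t0 : 0 < t by rewrite divr_gt0 // ltr0n.
have t1 : t < 1 by rewrite ltr_pdivrMr ?ltr0n // mul1r ltr_nat.
have hp := trigo.pi_gt0 R.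
have hs : 0 < sin (trigo.pi * t).
  apply: sin_gt0_pi; rewrite mulr_gt0 //=.
  by rewrite -[X in _ < X]mulr1 ltr_pM2l.
move: h; rewrite /e2 /cexp.
have -> : (2 * trigo.pi)%:C * 'i * (r%:R / m%:R) = 0 +i* ((trigo.pi * t) *+ 2) :> R[i].
  have -> : (r%:R / m%:R : R[i]) = t%:C.
    by rewrite /t rmorphM fmorphV !rmorph_nat.
  by apply/eqP; rewrite eq_complex /=; apply/andP; split; apply/eqP; ring.
rewrite /= expR0 => /eqP; rewrite eq_complex /= => /andP[/eqP h _].
move: h; rewrite mul0r subr0 mul1r cos_mulr2n cos2sin2 => h.
have : sin (trigo.pi * t) ^+ 2 > 0 by rewrite exprn_gt0.
by lra.
Qed.

(** Orthogonality of the characters of Z/m. It isolates residue classes of exponents, exploits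
    periods, and gives Parseval. *)
Lemma sum_e2 (m : nat) n : (0 < m)%N ->
  \sum_(b < m) e2 (n%:~R * b%:R / m%:R) =
    (if (m %| n)%Z then m%:R else 0) :> R[i].
Proof.
move=> m0; have hm : (m%:R : R[i]) != 0 by rewrite pnatr_eq0 -lt0n.
pose w : R[i] := e2 (n%:~R / m%:R).
have E (b : nat) : e2 (n%:~R * b%:R / m%:R) = w ^+ b.
  by rewrite -e2Mn; congr e2; field.
under eq_bigr => b _ do rewrite E.
case: ifPn => [/dvdzP[l ln]|ndiv].
  have -> : w = 1 by rewrite /w ln rmorphM /= mulfK // e2_int.
  under eq_bigr => b _ do rewrite expr1n.
  by rewrite sumr_const card_ord.
have w1 : w != 1 by exact: e2_ratio_neq1.
have : w ^+ m - 1 = 0.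
  rewrite -e2Mn mulrC mulfVK // e2_int subrr //.
rewrite subrX1 => /eqP; rewrite mulf_eq0 subr_eq0 (negPf w1) /= => /eqP //.
Qed.

Lemma qpowE h n tau : qpow h n tau = e2 (n%:~R * tau / h%:R).
Proof. by rewrite /qpow /e2; congr cexp; rewrite !mulrA. Qed.

End Exponential.

(** * Expansions in fractional powers of q *)

Section Expansions.
Variable R : realType.
Local Notation C := R[i].
Implicit Types (F G K : C -> C) (P Q : rat -> Prop) (tau : C).

(** Here [v j] belongs to the exponent (j - m)/h. Indexing by natural numbers turns a change of h or
    m into an operation on sequences, [dilate] or [shiftv]. *)
Definition hexp (h m : nat) (v : nat -> C) F : Prop :=
  (0 < h)%N /\ forall tau, upper tau ->
    series (fun j : nat => v j * qpow h (j%:Z - m%:Z) tau : C^o) @ \oo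
      --> (F tau : C^o).

(* F is a Laurent series in some q^(1/h), and P holds for every rational number l
   such that q^l occurs in it. *)
Definition has_exp F P : Prop :=
  exists h m v, hexp h m v F /\
    forall j : nat, v j != 0 -> P ((j%:Z - m%:Z)%:~R / h%:R).

Lemma hexp_ext h m v F G : (forall tau, upper tau -> F tau = G tau) ->
  hexp h m v F -> hexp h m v G.
Proof. by move=> FG [h0 H]; split => [//|tau ut]; rewrite -(FG tau ut); exact: H. Qed.

Lemma has_exp_ext F G P : (forall tau, upper tau -> F tau = G tau) ->
  has_exp F P -> has_exp G P.
Proof.
by move=> FG [h [m [v [H HP]]]]; exists h, m, v; split; [exact: hexp_ext H|exact: HP].
Qed.

Lemma has_expW F P Q : (forall l, P l -> Q l) -> has_exp F P -> has_exp F Q.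
Proof.
by move=> PQ [h [m [v [H HP]]]]; exists h, m, v; split=> [|j /HP /PQ //]; exact: H.
Qed.

Lemma qexp_hexp h F (a : int -> C) : qexp h F a ->
  exists m, hexp h m (fun j => a (j%:Z - m%:Z)) F.
Proof. by case=> h0 [m [_ H]]; exists m. Qed.

Lemma hexp_qexp h m v F : hexp h m v F ->
  exists a, qexp h F a /\
    forall n : int, a n != 0 -> exists2 j : nat, n = j%:Z - m%:Z & v j != 0.
Proof.
case=> h0 H.
exists (fun n : int => if (n + m%:Z)%R is Posz j then v j else 0); split.
  split; first exact: h0.
  exists m; split=> [n nm|tau ut].
    by case E : (n + m%:Z) => [j|] //; lia.
  apply: cvg_trans (H tau ut).
  have -> : (fun j : nat =>
      (if j%:Z - m%:Z + m%:Z is Posz j0 then v j0 else 0) *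
        qpow h (j%:Z - m%:Z) tau : C^o) =
     (fun j : nat => v j * qpow h (j%:Z - m%:Z) tau).
    by apply/funext => j; rewrite subrK.
  exact.
move=> n; case E : (n + m%:Z) => [j|]; last by rewrite eqxx.
by move=> vj; exists j => //; lia.
Qed.

Lemma qexp_has_exp h F (a : int -> C) P : qexp h F a ->
  (forall n : int, a n != 0 -> P (n%:~R / h%:R)) -> has_exp F P.
Proof.
move=> /qexp_hexp [m H] HP; exists h, m, (fun j => a (j%:Z - m%:Z)).
by split=> [|j /HP //]; exact: H.
Qed.

Lemma has_exp_qexp F P : has_exp F P ->
  exists h a, [/\ (0 < h)%N, qexp h F a
    & forall n : int, a n != 0 -> P (n%:~R / h%:R)].
Proof.
move=> [h [m [v [H HP]]]]; have [h0 _] := H.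
have [a [qa Ha]] := hexp_qexp H; exists h, a; split; [exact: h0|exact: qa|].
by move=> n /Ha [j -> /HP].
Qed.

Lemma qpow_dil h (g : nat) (n : int) tau : (0 < g)%N -> (0 < h)%N ->
  qpow (h * g) (n * g%:Z) tau = qpow h n tau.
Proof.
move=> g0 h0; rewrite !qpowE; congr e2.
have hg : (g%:R : C) != 0 by rewrite pnatr_eq0 -lt0n.
have hh : (h%:R : C) != 0 by rewrite pnatr_eq0 -lt0n.
by rewrite rmorphM natrM /= -[(Posz g)%:~R]/(g%:R); field; rewrite hg hh.
Qed.

Definition dilate (g : nat) (v : nat -> C) (j : nat) : C :=
  if (g %| j)%N then v (j %/ g)%N else 0.

(** Only multiples of g contribute, and exactly ceil(n/g) of them are below n. *)
Lemma series_dilate (g : nat) (v : nat -> C) n : (0 < g)%N ->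
  \sum_(0 <= j < n) dilate g v j =
  \sum_(0 <= i < (n + g.-1) %/ g) v i.
Proof.
move=> g0; elim: n => [|n IH].
  by rewrite divn_small ?add0n ?prednK // !big_nil //.
rewrite big_nat_recr //= IH /dilate; case: ifPn => [/dvdnP[i ->]|ndiv].
  rewrite mulnK // divnMDl // divn_small ?prednK // addn0.
  by rewrite addSn -addnS prednK // divnMDl // divnn g0 addn1 big_nat_recr.
rewrite addr0; congr (\sum_(0 <= i < _) _).
move: ndiv; rewrite (divn_eq n g); set q := (n %/ g)%N; set r := (n %% g)%N.
have rg : (r < g)%N by rewrite ltn_mod.
rewrite dvdn_addr ?dvdn_mull // => ndiv.
have r0 : (0 < r)%N by rewrite lt0n; apply: contra ndiv => /eqP ->.
have -> : ((q * g + r).+1 + g.-1 = (q.+1) * g + r)%N by lia.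
have -> : (q * g + r + g.-1 = (q.+1) * g + r.-1)%N by lia.
by rewrite !divnMDl // !divn_small // (leq_ltn_trans (leq_pred _)).
Qed.

Lemma cvg_ceil_div (g : nat) : (0 < g)%N ->
  (fun n => (n + g.-1) %/ g)%N @ \oo --> \oo.
Proof.
move=> g0; apply/cvgnyPge => A; near=> n.
have hn : (A * g <= n)%N by near: n; exact: nbhs_infty_ge.
by rewrite leq_divRL //; rewrite (leq_trans hn) // leq_addr.
Unshelve. all: by end_near. Qed.

Lemma hexp_dilate (g : nat) h m v F : (0 < g)%N ->
  hexp h m v F -> hexp (h * g) (m * g) (dilate g v) F.
Proof.
move=> g0 [h0 H]; split=> [|tau ut]; first by rewrite muln_gt0 h0.
have := H tau ut; set u := (fun j : nat => v j * _) => Hu.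
have -> : (fun j : nat =>
    dilate g v j * qpow (h * g) (j%:Z - (m * g)%N%:Z) tau : C^o) = dilate g u.
  apply/funext => j; rewrite /dilate /u; case: ifP => [/dvdnP[i ->]|]; last first.
    by rewrite mul0r.
  by rewrite mulnK // !PoszM -mulrBl qpow_dil.
have -> : series (dilate g u : nat -> C^o) =
    series (u : nat -> C^o) \o (fun n => (n + g.-1) %/ g)%N.
  by apply/funext => n; rewrite /series /=; apply: series_dilate.
exact: cvg_comp (cvg_ceil_div g0) Hu.
Qed.

Definition shiftv (d : nat) (v : nat -> C) (j : nat) : C :=
  if (d <= j)%N then v (j - d)%N else 0.

(** Raises the bound m on the pole order, so that two expansions can be brought to the same m before
    they are added. *)
Lemma hexp_shift (d : nat) h m v F :
  hexp h m v F -> hexp h (m + d) (shiftv d v) F.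
Proof.
move=> [h0 H]; split=> [//|tau ut].
have := H tau ut; set u := (fun j : nat => v j * _) => Hu.
have -> : (fun j : nat =>
    shiftv d v j * qpow h (j%:Z - (m + d)%N%:Z) tau : C^o) = shiftv d u.
  apply/funext => j; rewrite /shiftv /u; case: ifP => [dj|]; last by rewrite mul0r.
  by have -> : j%:Z - (m + d)%N%:Z = (j - d)%N%:Z - m%:Z by lia.
rewrite -(cvg_shiftn d).
suff -> : (fun n => series (shiftv d u : nat -> C^o) (n + d)%N) =
    series (u : nat -> C^o) by [].
apply/funext => n; rewrite /series /= (@big_cat_nat _ _ _ d) //=; last lia.
rewrite big1_seq ?add0r; last first.
  move=> j /andP[_]; rewrite mem_index_iota /shiftv => /andP[_ jd].
  by rewrite leqNgt jd.
rewrite -{1}[d]add0n big_addn addnK; apply: eq_bigr => j _.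
by rewrite /shiftv leq_addl addnK.
Qed.

Lemma hexpD h m v w F G : hexp h m v F -> hexp h m w G ->
  hexp h m (fun j => v j + w j) (fun tau => F tau + G tau).
Proof.
move=> [h0 H] [_ H']; split=> [//|tau ut].
have -> : (fun j : nat => (v j + w j) * qpow h (j%:Z - m%:Z) tau : C^o) =
   (fun j : nat => v j * qpow h (j%:Z - m%:Z) tau) \+
   (fun j : nat => w j * qpow h (j%:Z - m%:Z) tau).
  by apply/funext => j; rewrite /= mulrDl.
rewrite seriesD; exact: cvgD (H tau ut) (H' tau ut).
Qed.

Lemma hexpZ h m v F (c : C) : hexp h m v F ->
  hexp h m (fun j => c * v j) (fun tau => c * F tau).
Proof.
move=> [h0 H]; split=> [//|tau ut].
have -> : (fun j : nat => (c * v j) * qpow h (j%:Z - m%:Z) tau : C^o) =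
   (fun j : nat => c *: (v j * qpow h (j%:Z - m%:Z) tau : C^o)).
  by apply/funext => j; rewrite -mulrA.
have -> : series (fun j : nat => c *: (v j * qpow h (j%:Z - m%:Z) tau : C^o)) =
   (fun n => c *: series (fun j : nat => v j * qpow h (j%:Z - m%:Z) tau : C^o) n).
  by apply/funext => n; rewrite /series /= scaler_sumr.
exact: cvgZ (cvg_cst _) (H tau ut).
Qed.

Lemma has_exp0 P : has_exp (fun=> 0) P.
Proof.
exists 1%N, 0%N, (fun=> 0); split; last by move=> j; rewrite eqxx.
split=> [//|tau _].
have -> : series (fun j : nat => 0 * qpow 1 (j%:Z - 0%:Z) tau : C^o) = (fun=> 0).
  by apply/funext => n; rewrite /series /= big1 // => i _; rewrite mul0r.
exact: cvg_cst.
Qed.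

Lemma has_expZ (c : C) F P : has_exp F P -> has_exp (fun tau => c * F tau) P.
Proof.
move=> [h [m [v [H HP]]]]; exists h, m, (fun j => c * v j); split.
  exact: hexpZ.
by move=> j; rewrite mulf_eq0 negb_or => /andP[_ /HP].
Qed.

Lemma has_expD F G P : has_exp F P -> has_exp G P ->
  has_exp (fun tau => F tau + G tau) P.
Proof.
move=> [h [m [v [H HP]]]] [h' [m' [v' [H' HP']]]].
have [h0 _] := H; have [h'0 _] := H'.
exists (h * h')%N, (m * h' + m' * h)%N,
  (fun j => shiftv (m' * h) (dilate h' v) j + shiftv (m * h') (dilate h v') j).
split.
  apply: hexpD; first by apply: hexp_shift; apply: hexp_dilate.
  by rewrite addnC mulnC; apply: hexp_shift; apply: hexp_dilate.
move=> j hj.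
have hh : (h%:R : rat) != 0 by rewrite pnatr_eq0 -lt0n.
have hh' : (h'%:R : rat) != 0 by rewrite pnatr_eq0 -lt0n.
have [nz|nz] : shiftv (m' * h) (dilate h' v) j != 0 \/
   shiftv (m * h') (dilate h v') j != 0.
- by apply/orP; rewrite -negb_and; apply: contra hj => /andP[/eqP -> /eqP ->];
  rewrite addr0.
- move: nz; rewrite /shiftv /dilate; case: ifP => [lej|]; last by rewrite eqxx.
  case: ifP => [/dvdnP[i ei]|]; last by rewrite eqxx.
  rewrite ei mulnK // => /HP; congr P.
  have -> : j%:Z - (m * h' + m' * h)%N%:Z = (i%:Z - m%:Z) * h'%:Z by nia.
  by rewrite rmorphM natrM /= -[(Posz h')%:~R]/(h'%:R); field; rewrite hh hh'.
- move: nz; rewrite /shiftv /dilate; case: ifP => [lej|]; last by rewrite eqxx.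
  case: ifP => [/dvdnP[i ei]|]; last by rewrite eqxx.
  rewrite ei mulnK // => /HP'; congr P.
  have -> : j%:Z - (m * h' + m' * h)%N%:Z = (i%:Z - m'%:Z) * h%:Z by nia.
  by rewrite rmorphM natrM /= -[(Posz h)%:~R]/(h%:R); field; rewrite hh hh'.
Qed.

Lemma has_exp_sum (I : Type) (r : seq I) (p : pred I) (F : I -> C -> C) P :
  (forall i, p i -> has_exp (F i) P) ->
  has_exp (fun tau => \sum_(i <- r | p i) F i tau) P.
Proof.
move=> H; elim: r => [|i r IH].
  by apply: has_exp_ext (has_exp0 P) => tau _; rewrite big_nil.
have [pi|npi] := boolP (p i).
  apply: has_exp_ext (has_expD (H i pi) IH) => tau _ /=.
  by rewrite big_cons pi.
by apply: has_exp_ext IH => tau _; rewrite big_cons (negPf npi).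
Qed.

Lemma has_expB F G P : has_exp F P -> has_exp G P ->
  has_exp (fun tau => F tau - G tau) P.
Proof.
move=> HF /(has_expZ (-1)) /(has_expD HF); apply: has_exp_ext => tau _.
by rewrite mulN1r.
Qed.

Lemma im_affine (g e : nat) (x : int) tau :
  complex.Im ((g%:R * tau + x%:~R) / e%:R) = g%:R * complex.Im tau / e%:R.
Proof.
have im_rat (t : R) (z : C) : complex.Im (z * t%:C) = complex.Im z * t.
  by case: z => a b /=; ring.
have -> : (e%:R : C)^-1 = (e%:R^-1 : R)%:C by rewrite fmorphV rmorph_nat.
have -> : (x%:~R : C) = (x%:~R : R)%:C by rewrite rmorph_int.
have -> : (g%:R : C) = (g%:R : R)%:C by rewrite rmorph_nat.
by rewrite im_rat; case: tau => a b /=; ring.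
Qed.

Lemma upper_affine (g e : nat) (x : int) tau : (0 < g)%N -> (0 < e)%N ->
  upper tau -> upper ((g%:R * tau + x%:~R) / e%:R).
Proof.
rewrite /upper im_affine => g0 e0 ut.
by rewrite divr_gt0 ?mulr_gt0 ?ltr0n.
Qed.

(** Under the substitution q^l becomes e(l x/e) q^(g l/e); the root of unity is absorbed into the
    coefficient [w j]. *)
Lemma has_exp_affine (g e : nat) (x : int) F P Q : (0 < g)%N -> (0 < e)%N ->
  (forall l, P l -> Q (g%:R / e%:R * l)) -> has_exp F P ->
  has_exp (fun tau => F ((g%:R * tau + x%:~R) / e%:R)) Q.
Proof.
move=> g0 e0 PQ [h [m [v [H HP]]]]; have [h0 Hs] := H.
pose w (j : nat) : C := v j * e2 ((j%:Z - m%:Z)%:~R * x%:~R / (h%:R * e%:R)).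
exists (h * e)%N, (m * g)%N, (dilate g w).
have heC : (e%:R : C) != 0 by rewrite pnatr_eq0 -lt0n.
have hhC : (h%:R : C) != 0 by rewrite pnatr_eq0 -lt0n.
have he : (e%:R : rat) != 0 by rewrite pnatr_eq0 -lt0n.
have hh : (h%:R : rat) != 0 by rewrite pnatr_eq0 -lt0n.
split.
  split=> [|tau ut]; first by rewrite muln_gt0 h0.
  have := Hs _ (upper_affine x g0 e0 ut); set u := (fun j : nat => v j * _) => Hu.
  have -> : (fun j : nat => dilate g w j *
      qpow (h * e) (j%:Z - (m * g)%N%:Z) tau : C^o) = dilate g u.
    apply/funext => j; rewrite /dilate /u; case: ifP => [/dvdnP[i ->]|]; last first.
      by rewrite mul0r.
    rewrite mulnK // !PoszM -mulrBl /w -mulrA !qpowE -e2D; congr (_ * e2 _).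
    rewrite rmorphM natrM /= -[(Posz g)%:~R]/(g%:R); field.
    by rewrite heC hhC.
  have -> : series (dilate g u : nat -> C^o) =
      series (u : nat -> C^o) \o (fun n => (n + g.-1) %/ g)%N.
    by apply/funext => n; rewrite /series /=; apply: series_dilate.
  exact: cvg_comp (cvg_ceil_div g0) Hu.
move=> j; rewrite /dilate; case: ifP => [/dvdnP[i ->]|]; last by rewrite eqxx.
rewrite mulnK // /w mulf_eq0 negb_or => /andP[/HP /PQ + _]; congr Q.
rewrite !PoszM -mulrBl rmorphM natrM /= -[(Posz g)%:~R]/(g%:R); field.
by rewrite he hh.
Qed.

Lemma has_exp_translate (x : int) F P : has_exp F P ->
  has_exp (fun tau => F (tau + x%:~R)) P.
Proof.
move/(@has_exp_affine 1 1 x F P P (ltn0Sn _) (ltn0Sn _)) => H.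
apply: has_exp_ext (H _) => [tau _|l]; first by rewrite mul1r divr1.
by rewrite divr1 mul1r.
Qed.

Lemma upper_translate (x : int) tau : upper tau -> upper (tau + x%:~R).
Proof.
move=> ut; have := upper_affine x (ltn0Sn 0) (ltn0Sn 0) ut.
by rewrite mul1r divr1.
Qed.

Lemma periodic_iter (L : int) F :
  (forall tau, upper tau -> F (tau + L%:~R) = F tau) ->
  forall (j : nat) tau, upper tau -> F (tau + (L * j%:Z)%:~R) = F tau.
Proof.
move=> per; elim=> [|j IH] tau ut; first by rewrite mulr0 addr0.
have := per _ (upper_translate (L * j%:Z) ut); rewrite (IH tau ut) => <-.
congr F.
by rewrite -addn1 PoszD mulrDr mulr1 rmorphD addrA.
Qed.

Lemma cvg_scaleC (c : C) (u : nat -> C^o) (l : C^o) :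
  u @ \oo --> l -> (fun n => c *: u n) @ \oo --> c *: l.
Proof. by move=> Hu; exact: cvgZ (cvg_cst _) Hu. Qed.

Lemma cvg_sumC (I : Type) (r : seq I) (u : I -> nat -> C^o) (l : I -> C^o) :
  (forall i, u i @ \oo --> l i) ->
  (fun n => \sum_(i <- r) u i n) @ \oo --> \sum_(i <- r) l i.
Proof.
move=> H; elim: r => [|i r IH].
  rewrite big_nil; under eq_fun => n do rewrite big_nil.
  exact: cvg_cst.
rewrite big_cons; under eq_fun => n do rewrite big_cons.
exact: cvgD (H i) IH.
Qed.

(** F is the average of its translates by L b, b < h. In the averaged expansion the coefficient of
    q^(n/h) is multiplied by the mean of e(n L b/h), which is 0 unless h divides n L. *)
Lemma has_exp_periodic (L : int) F P :
  (forall tau, upper tau -> F (tau + L%:~R) = F tau) -> has_exp F P ->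
  has_exp F (fun l => P l /\ L%:~R * l \is a Num.int).
Proof.
move=> per [h [m [v [H HP]]]]; have [h0 Hs] := H.
have hhC : (h%:R : C) != 0 by rewrite pnatr_eq0 -lt0n.
have hh : (h%:R : rat) != 0 by rewrite pnatr_eq0 -lt0n.
pose w (j : nat) : C :=
  if (h %| (j%:Z - m%:Z) * L)%Z then v j else 0.
exists h, m, w; split.
  split=> [//|tau ut].
  have Hb (b : nat) : series (fun j : nat => v j *
       qpow h (j%:Z - m%:Z) (tau + (L * b%:Z)%:~R) : C^o) @ \oo --> (F tau : C^o).
    have := Hs _ (upper_translate (L * b%:Z) ut).
    by rewrite (periodic_iter per).
  have HS := @cvg_sumC _ (index_enum 'I_h) _ _ (fun b : 'I_h => Hb b).
  have := @cvg_scaleC h%:R^-1 _ _ HS.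
  rewrite sumr_const card_ord.
  have -> : h%:R^-1 *: (F tau *+ h : C^o) = F tau.
    have E : (h%:R^-1 : C) * (F tau *+ h) = F tau.
      by rewrite -(mulr_natr (F tau)) mulrCA mulVf // mulr1.
    exact: E.
  apply: cvg_trans; apply: near_eq_cvg; apply: nearW => n.
  rewrite /series /=.
  rewrite exchange_big /= scaler_sumr; apply: eq_bigr => j _.
  have -> : \sum_(i < h) v j * qpow h (j%:Z - m%:Z) (tau + (L * i%:Z)%:~R) =
     v j * qpow h (j%:Z - m%:Z) tau *
       \sum_(i < h) e2 (((j%:Z - m%:Z) * L)%:~R * i%:R / h%:R).
    rewrite mulr_sumr; apply: eq_bigr => i _; rewrite -mulrA !qpowE -e2D.
    by congr (_ * e2 _); rewrite !rmorphM /= -[(Posz i)%:~R]/(i%:R); field.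
  rewrite sum_e2 // /w; case: ifP => _; last by rewrite mulr0 mul0r scaler0.
  have E : (h%:R^-1 : C) * (v j * qpow h (j%:Z - m%:Z) tau * h%:R) =
      v j * qpow h (j%:Z - m%:Z) tau by rewrite mulrC mulfK.
  exact: E.
move=> j; rewrite /w; case: ifP => [/dvdzP[l el]|]; last by rewrite eqxx.
move=> /HP HPj; split=> //.
rewrite mulrA -rmorphM /= mulrC [L * _]mulrC el rmorphM /= mulrC mulfK //.
Qed.

End Expansions.

(** * Integer matrices acting on functions *)

Definition mx2 (a b c d : int) : 'M[int]_2 :=
  \matrix_(i, j) if i == 0 then (if j == 0 then a else b)
                 else (if j == 0 then c else d).

Section Matrices2.
Implicit Types (A B M : 'M[int]_2) (a b c d : int).

Lemma mx2_00 a b c d : mx2 a b c d 0 0 = a. Proof. by rewrite mxE. Qed.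
Lemma mx2_01 a b c d : mx2 a b c d 0 1 = b. Proof. by rewrite mxE. Qed.
Lemma mx2_10 a b c d : mx2 a b c d 1 0 = c. Proof. by rewrite mxE. Qed.
Lemma mx2_11 a b c d : mx2 a b c d 1 1 = d. Proof. by rewrite mxE. Qed.
Definition mx2E := (mx2_00, mx2_01, mx2_10, mx2_11).

Lemma mulmx2 A B i j : (A *m B) i j = A i 0 * B 0 j + A i 1 * B 1 j.
Proof.
rewrite mxE !big_ord_recl big_ord0 addr0.
by have -> : lift ord0 ord0 = 1 :> 'I_2 by apply/val_inj.
Qed.

Lemma mx2P A B : A 0 0 = B 0 0 -> A 0 1 = B 0 1 -> A 1 0 = B 1 0 ->
  A 1 1 = B 1 1 -> A = B.
Proof.
move=> h00 h01 h10 h11; apply/matrixP => i j.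
have I2 (x : 'I_2) : x = 0 \/ x = 1.
  by case: x => [[|[|//]] H]; [left|right]; apply/val_inj.
by case: (I2 i) => ->; case: (I2 j) => ->.
Qed.

Lemma det_mx22 M : \det M = M 0 0 * M 1 1 - M 0 1 * M 1 0.
Proof.
rewrite (expand_det_row _ 0) !big_ord_recl big_ord0 addr0 /cofactor.
have -> : lift ord0 ord0 = 1 :> 'I_2 by apply/val_inj.
rewrite !det_mx11 !mxE /= expr0 expr1 mul1r mulN1r mulrN.
by congr (M _ _ * M _ _ - M _ _ * M _ _); apply/val_inj.
Qed.

Lemma mx2_factor A : 0 < \det A -> exists M (g e : nat) (x : int),
  [/\ SL2Z M, A = M *m mx2 g x 0 e,
      (g%:Z = gcdz (A 0 0) (A 1 0)) /\ M 1 0 * g%:Z = A 1 0,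
      (0 < g)%N /\ (0 < e)%N & g%:Z * e%:Z = \det A].
Proof.
move=> dA; have dE := det_mx22 A.
set g := gcdz (A 0 0) (A 1 0).
have g0 : 0 < g.
  rewrite lt_neqAle andbT eq_sym gcdz_eq0; apply/negP => /andP[/eqP a0 /eqP c0].
  by move: dA; rewrite dE a0 c0 mul0r mulr0 subrr ltxx.
have /dvdzP[a' ea] := dvdz_gcdl (A 0 0) (A 1 0).
have /dvdzP[c' ec] := dvdz_gcdr (A 0 0) (A 1 0).
rewrite -/g in ea ec.
have [u [v uv]] := Bezoutz (A 0 0) (A 1 0); rewrite -/g in uv.
have bez : a' * u + c' * v = 1.
  apply: (mulIf (lt0r_neq0 g0)); rewrite mul1r -[in RHS]uv ea ec; ring.
have eg : g = (`|g|%N)%:Z by rewrite gez0_abs // ltW.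
have gdet : (a' * A 1 1 - c' * A 0 1) * g = \det A by rewrite dE ea ec; ring.
set e' := a' * A 1 1 - c' * A 0 1 in gdet.
have e0 : 0 < e' by rewrite -(pmulr_lgt0 _ g0) gdet.
have ee : e' = (`|e'|%N)%:Z by rewrite gez0_abs // ltW.
exists (mx2 a' (- v) c' u), `|g|%N, `|e'|%N, (u * A 0 1 + v * A 1 1).
rewrite /SL2Z det_mx22 !mx2E -!eg -!ee; split=> //.
- by rewrite -bez; ring.
- apply: mx2P; rewrite mulmx2 !mx2E.
  + by rewrite ea; ring.
  + rewrite /e' -[LHS]mul1r -bez; ring.
  + by rewrite ec; ring.
  + rewrite /e' -[LHS]mul1r -bez; ring.
- by rewrite -!ltz_nat -eg -ee.
- by rewrite mulrC.
Qed.

End Matrices2.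

(** * The weight k action of integral matrices and its effect on exponents *)

Section Slash.
Variable R : realType.
Local Notation C := R[i].
Implicit Types (f F : C -> C) (k : int) (A B M : 'M[int]_2) (tau : C).

Lemma im_int_mulD (c d : int) tau :
  complex.Im (c%:~R * tau + d%:~R) = c%:~R * complex.Im tau.
Proof.
have -> : (c%:~R : C) = (c%:~R : R)%:C by rewrite rmorph_int.
have -> : (d%:~R : C) = (d%:~R : R)%:C by rewrite rmorph_int.
by case: tau => a b /=; ring.
Qed.

Lemma cocycle_neq0 M tau : \det M != 0 -> upper tau -> cocycle M tau != 0.
Proof.
move=> dM ut; apply: contra dM => /eqP h.
have := im_int_mulD (M 1 0) (M 1 1) tau; rewrite -/(cocycle M tau) h /=.
move=> /esym/eqP; rewrite mulf_eq0 (gt_eqF ut) orbF intr_eq0 => /eqP c0.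
move: h; rewrite /cocycle c0 mul0r add0r => /eqP; rewrite intr_eq0 => /eqP d0.
by rewrite det_mx22 c0 d0 !mulr0 subrr.
Qed.

Lemma cocycle_mul A B tau : \det B != 0 -> upper tau ->
  cocycle (A *m B) tau = cocycle A (moebius B tau) * cocycle B tau.
Proof.
move=> dB ut; have nz := cocycle_neq0 dB ut.
rewrite /moebius /cocycle !mulmx2 !(rmorphD, rmorphM) /=.
rewrite -/(cocycle B tau) [RHS]mulrDl [_ * (_ / _)]mulrA mulfVK //.
by rewrite /cocycle; ring.
Qed.

Lemma moebius_mul A B tau : \det B != 0 -> upper tau ->
  moebius (A *m B) tau = moebius A (moebius B tau).
Proof.
move=> dB ut; have nz := cocycle_neq0 dB ut.
rewrite {1 2}/moebius cocycle_mul // invfM mulrCA mulrC; congr (_ / _).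
rewrite !mulmx2 !(rmorphD, rmorphM) /=.
have -> : (A 0 0)%:~R * moebius B tau + (A 0 1)%:~R =
   ((A 0 0)%:~R * ((B 0 0)%:~R * tau + (B 0 1)%:~R) +
    (A 0 1)%:~R * cocycle B tau) / cocycle B tau.
  by rewrite [RHS]mulrDl -mulrA mulfK.
by congr (_ / _); rewrite /cocycle; ring.
Qed.

Lemma im_moebius M tau : \det M != 0 -> upper tau ->
  complex.Im (moebius M tau) =
    (\det M)%:~R * complex.Im tau / normc (cocycle M tau) ^+ 2.
Proof.
move=> dM ut; have nz := cocycle_neq0 dM ut.
have {nz} : normc (cocycle M tau) != 0.
  by apply: contra nz => /eqP/eq0_normc ->.
rewrite /moebius /cocycle det_mx22.
have rint (c : int) : (c%:~R : C) = (c%:~R : R)%:C by rewrite rmorph_int.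
rewrite !rint; move: (M 0 0) (M 0 1) (M 1 0) (M 1 1) => a b c d.
case: tau ut => x y _ /=.
rewrite !(mul0r, subr0, addr0) => nz.
rewrite sqr_sqrtr ?addr_ge0 ?sqr_ge0 // rmorphB !rmorphM /=.
have n2 : (c%:~R * x + d%:~R) ^+ 2 + (c%:~R * y) ^+ 2 != 0.
  by apply: contra nz => /eqP ->; rewrite sqrtr0.
by field.
Qed.

Lemma upper_moebius M tau : 0 < \det M -> upper tau -> upper (moebius M tau).
Proof.
move=> dM ut; rewrite /upper im_moebius ?lt0r_neq0 //.
have nz := cocycle_neq0 (lt0r_neq0 dM) ut.
apply: divr_gt0; first by rewrite mulr_gt0 ?ltr0z.
apply: exprn_gt0; rewrite lt_neqAle eq_sym.
apply/andP; split; first by apply: contra nz => /eqP/eq0_normc ->.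
by case: (cocycle M tau) => a b; apply: sqrtr_ge0.
Qed.

Lemma slash_mul k f A B tau : \det B != 0 -> upper tau ->
  slash k f (A *m B) tau = slash k (slash k f A) B tau.
Proof.
move=> dB ut; rewrite /slash cocycle_mul // moebius_mul //.
by rewrite expfzMl [_ ^ _ * _ ^ _ in LHS]mulrC mulrA.
Qed.

Lemma slash_upper k F (g e x : int) tau :
  slash k F (mx2 g x 0 e) tau =
    e%:~R ^ (- k) * F ((g%:~R * tau + x%:~R) / e%:~R).
Proof. by rewrite /slash /moebius /cocycle !mx2E mul0r add0r. Qed.

Lemma slash_scalar k f (z : int) M tau : z != 0 ->
  slash k f (z *: M) tau = z%:~R ^ (- k) * slash k f M tau.
Proof.
move=> z0; have zC : (z%:~R : C) != 0 by rewrite intr_eq0.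
rewrite /slash /moebius.
have -> : cocycle (z *: M) tau = z%:~R * cocycle M tau.
  by rewrite /cocycle !mxE !rmorphM /=; ring.
rewrite expfzMl -mulrA; congr (_ * (_ * f _)).
rewrite !mxE !rmorphM /= -!mulrA -mulrDr invfM mulrACA divff // mul1r //.
Qed.

Lemma slash1 k f tau : slash k f 1%:M tau = f tau.
Proof.
rewrite /slash /moebius /cocycle !mxE /= mul0r add0r exp1rz mul1r mul1r addr0.
by rewrite divr1.
Qed.

Lemma has_exp_slash_upper k f M (g e : nat) (x : int) (P Q : rat -> Prop) :
  (0 < g)%N -> (0 < e)%N -> (forall l, P l -> Q (g%:R / e%:R * l)) ->
  has_exp (slash k f M) P -> has_exp (slash k f (M *m mx2 g x 0 e)) Q.
Proof.
move=> g0 e0 PQ /(has_exp_affine x g0 e0 PQ) /(has_expZ (e%:R ^ (- k))).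
apply: has_exp_ext => tau ut; rewrite slash_mul //; last first.
  by rewrite det_mx22 !mx2E mulr0 subr0 mulf_neq0 // eqz_nat -lt0n.
by rewrite slash_upper.
Qed.

(** The triangular factor with diagonal g, e multiplies exponents by g/e, and g/e = g^2/det A since
    g e = det A. *)
Lemma has_exp_slash_factor k f A (P Q : rat -> Prop) : 0 < \det A ->
  (forall M, SL2Z M -> M 1 0 * gcdz (A 0 0) (A 1 0) = A 1 0 ->
     has_exp (slash k f M) P) ->
  (forall l, P l -> Q ((gcdz (A 0 0) (A 1 0))%:~R ^+ 2 / (\det A)%:~R * l)) ->
  has_exp (slash k f A) Q.
Proof.
move=> dA HM PQ; have [M [g [e [x [SM EA [Eg EM] [g0 e0] dge]]]]] := mx2_factor dA.
rewrite -Eg in HM PQ.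
have := HM M SM EM; rewrite EA; apply: has_exp_slash_upper => // l /PQ.
congr Q; rewrite -dge rmorphM /= -[(Posz g)%:~R]/(g%:R) -[(Posz e)%:~R]/(e%:R).
have ng : (g%:R : rat) != 0 by rewrite pnatr_eq0 -lt0n.
have ne : (e%:R : rat) != 0 by rewrite pnatr_eq0 -lt0n.
by field; rewrite ng ne.
Qed.

(* The left-hand side is m times the part of f with exponents congruent to n0. *)
Lemma class_relation f (a : int -> C) (m : nat) (n0 : int) tau :
  (0 < m)%N -> qexp 1 f a ->
  (forall n : int, (n = n0 %[mod m])%Z -> a n = 0) -> upper tau ->
  \sum_(b < m) e2 (- (n0%:~R * b%:R / m%:R)) * f (tau + b%:R / m%:R) = 0.
Proof.
move=> m0 /qexp_hexp [M [_ H]] an0 ut.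
have mC : (m%:R : C) != 0 by rewrite pnatr_eq0 -lt0n.
have ub (b : nat) : upper (tau + b%:R / m%:R).
  have := ut; rewrite /upper;
    suff -> : complex.Im (tau + b%:R / m%:R) = complex.Im tau by [].
  have -> : (b%:R / m%:R : C) = (b%:R / m%:R : R)%:C.
    by rewrite rmorphM fmorphV !rmorph_nat.
  by case: tau {ut} => x y /=; rewrite addr0.
have HS := @cvg_sumC R _ (index_enum 'I_m) _ _ (fun b : 'I_m =>
  @cvg_scaleC R (e2 (- (n0%:~R * b%:R / m%:R))) _ _ (H _ (ub b))).
(* Already every partial sum vanishes: orthogonality keeps only the exponents congruent to n0, whose
   coefficients are 0. *)
have Z : (fun n => \sum_(b < m) e2 (- (n0%:~R * b%:R / m%:R)) *:
    (series (fun j : nat => a (j%:Z - M%:Z) *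
       qpow 1 (j%:Z - M%:Z) (tau + b%:R / m%:R) : C^o) n : C^o)) = (fun=> 0).
  apply/funext => n; rewrite /series /=.
  under eq_bigr => b _ do rewrite scaler_sumr.
  rewrite exchange_big /= big1 // => j _.
  move: (j%:Z - M%:Z) (an0 (j%:Z - M%:Z)) => N aN.
  have -> : \sum_(b < m) e2 (- (n0%:~R * b%:R / m%:R)) *:
       (a N * qpow 1 N (tau + b%:R / m%:R) : C^o) =
     a N * qpow 1 N tau * \sum_(b < m) e2 ((N - n0)%:~R * b%:R / m%:R) :> C.
    rewrite mulr_sumr; apply: eq_bigr => b _.
    rewrite -[_ *: _]/(_ * _) !qpowE.
    rewrite mulrCA -[RHS]mulrA; congr (_ * _); rewrite -!e2D; congr e2.
    by rewrite rmorphB /=; field.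
  rewrite sum_e2 //; case: ifP => [dv|_]; last by rewrite mulr0.
  by rewrite aN ?mul0r //; apply/eqP; rewrite eqz_mod_dvd.
rewrite Z in HS.
exact: (norm_cvg_unique HS (cvg_cst _)).
Qed.

End Slash.

(** * The characters and the sign vector *)

Lemma legendre_mod (p : nat) (a b : int) : (a = b %[mod p])%Z ->
  legendre a p = legendre b p.
Proof.
move=> ab; rewrite /legendre.
have -> : (p%:Z %| a)%Z = (p%:Z %| b)%Z.
  by apply/dvdz_mod0P/dvdz_mod0P; rewrite ab.
by under eq_existsb => x do rewrite ab.
Qed.

Lemma legendre_vals (p : nat) (a : int) : ~~ (p%:Z %| a)%Z ->
  legendre a p \in [:: 1; -1].
Proof. by rewrite /legendre => /negPf ->; case: ifP. Qed.

Lemma legendre_square (p : nat) (a x : int) : (0 < p)%N -> ~~ (p%:Z %| a)%Z ->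
  (x ^+ 2 = a %[mod p])%Z -> legendre a p = 1.
Proof.
move=> p0 /negPf pa xa; rewrite /legendre pa; case: existsP => // -[].
have pZ : p%:Z != 0 by rewrite eqz_nat -lt0n.
have := modz_ge0 x pZ; have := ltz_pmod x (p0 : 0 < p%:Z).
case E : (x %% p)%Z => [r|//]; rewrite ltz_nat => rp _.
by exists (Ordinal rp); rewrite /= -E modzXm xa.
Qed.

Lemma legendre_one (p : nat) : (1 < p)%N -> legendre 1 p = 1.
Proof.
move=> p1; apply: (@legendre_square p 1 1); rewrite ?expr1n //; first lia.
by rewrite dvdz1 gtn_eqF.
Qed.

(** Squaring is not injective on F_p, since 1 and -1 are distinct with equal squares; on a finite
    set it is then not surjective. *)
Lemma exists_nonresidue (p : nat) : prime p -> odd p ->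
  exists n : int, ~~ (p%:Z %| n)%Z /\ legendre n p = -1.
Proof.
move=> pp op.
have p2 : (2 < p)%N by rewrite odd_prime_gt2.
have [inj|] := boolP (injectiveb (fun x : 'F_p => x ^+ 2)).
  have := injectiveP _ inj 1 (-1); rewrite sqrrN => /(_ erefl) /eqP.
  rewrite -subr_eq0 opprK -[1 + 1]/(2%:R) => /eqP h.
  have := Fp_nat_mod pp 2; rewrite h modn_small // => h2.
  have : (2%:R : 'F_p) != 0.
    by rewrite -(dvdn_pcharf (pchar_Fp pp)) gtnNdvd.
  by rewrite h eqxx.
move=> ninj.
have : ~~ [forall y : 'F_p, exists x : 'F_p, x ^+ 2 == y].
  apply: contra ninj => /forallP H; apply/injectiveP.
  have {}H y : exists x : 'F_p, x ^+ 2 = y.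
    by have /existsP[x /eqP] := H y; exists x.
  have [g gK] := choice H.
  have {}gK : cancel g (fun x : 'F_p => x ^+ 2) := gK.
  exact: bij_inj (bij_can_bij (injF_bij (can_inj gK)) gK).
rewrite negb_forall => /existsP[y]; rewrite negb_exists => /forallP ny.
have y0 : y != 0 by apply: contra (ny 0) => /eqP ->; rewrite expr0n.
exists (nat_of_ord y)%:Z.
have yE : y = (nat_of_ord y)%:R by rewrite natr_Zp.
have nd : ~~ (p %| nat_of_ord y)%N.
  by rewrite (dvdn_pcharf (pchar_Fp pp)) -yE.
split; first exact: nd.
rewrite /legendre ifF; last exact: negPf nd.
case: existsP => // -[x]; rewrite eqz_mod_dvd => dv.
have := ny (nat_of_ord x)%:R; rewrite yE.
have /dvdzP[q hq] := dv.
have hx : (x%:Z ^+ 2 = (nat_of_ord y)%:Z + q * p%:Z) by rewrite -hq; ring.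
have := congr1 (fun z : int => z%:~R : 'F_p) hx.
rewrite rmorphXn rmorphD rmorphM /= -[(Posz p)%:~R]/(p%:R) -[(Posz x)%:~R]/(x%:R).
rewrite (pcharf0 (pchar_Fp pp)) mulr0 addr0 => ->.
by rewrite eqxx.
Qed.

(** The unit group of the field with p^2 elements is cyclic and 8 divides p^2 - 1. An element of
    order 8 has a fourth power that squares to 1 without being 1. *)
Lemma exists_zeta8 (p : nat) : prime p -> odd p ->
  exists (F : finFieldType) (z : F), p \in [pchar F] /\ z ^+ 4 = -1.
Proof.
move=> pp op; have [F chF cF] := pPrimePowerField pp (isT : 0 < 2)%N.
have /cyclicP[x Gx] := field_unit_group_cyclic [set: {unit F}]%G.
have ox : #[x]%g = (p ^ 2).-1.
  by rewrite /order -Gx card_finField_unit cF.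
have d8 : (8 %| (p ^ 2).-1)%N.
  have -> : (p ^ 2).-1 = ((p./2.*2).+1 ^ 2).-1.
    by rewrite -[in LHS](odd_double_half p) op add1n.
  move: (p./2) => k; rewrite -muln2.
  have -> : (((k * 2).+1 ^ 2).-1 = 4 * (k * k.+1))%N by rewrite expnS expn1; lia.
  by rewrite (@dvdn_pmul2l 4 2) // dvdn2 oddM /=; case: (odd k).
pose u := (x ^+ ((p ^ 2).-1 %/ 8))%g.
have p21 : (0 < (p ^ 2).-1)%N.
  by have := prime_gt1 pp; rewrite expnS expn1; nia.
have ou : #[u]%g = 8%N.
  rewrite orderXdiv ox; last by apply: dvdn_div.
  by rewrite divnA // mulnC mulnK.
have u8 : (u ^+ 8 = 1)%g by rewrite -ou expg_order.
have u4 : (u ^+ 4 != 1)%g by rewrite -order_dvdn ou.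
exists F, (FinRing.uval u); split=> //.
have vX (w : {unit F}) n : FinRing.uval (w ^+ n)%g = FinRing.uval w ^+ n.
  by elim: n => [|n IH] //; rewrite expgS exprS -IH.
have : (FinRing.uval u ^+ 4) ^+ 2 = 1 by rewrite -exprM -vX u8.
move/eqP; rewrite sqrf_eq1 => /orP[/eqP h|/eqP //].
case/negP: u4; apply/eqP/val_inj; exact: etrans (vX u 4) h.
Qed.

Section LegendreFrobenius.
Variables (p : nat) (F : finFieldType).
Hypotheses (pp : prime p) (op : odd p) (chF : p \in [pchar F]).

(** The polynomial X^p - X has at most p roots, and the images of 0, ..., p - 1 are already p of
    them. *)
Lemma frobenius_fixed (y : F) : y ^+ p = y -> exists i : nat, y = i%:R.
Proof.
move=> yp; apply: contrapT => nex.
pose q : {poly F} := 'X^p - 'X.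
have p1 := prime_gt1 pp.
have sq : size q = p.+1.
  by rewrite size_polyDl size_polyXn // size_polyN size_polyX.
have q0 : q != 0 by rewrite -size_poly_eq0 sq.
pose s := y :: [seq (i%:R : F) | i <- iota 0 p].
have rs : all (root q) s.
  rewrite /= /root !hornerE ?hornerXn yp subrr eqxx /=.
  apply/allP => z /mapP[i _ ->]; rewrite /root !hornerE ?hornerXn subr_eq0.
  by rewrite -(pFrobenius_autE chF) pFrobenius_aut_nat.
have us : uniq s.
  rewrite /=; apply/andP; split.
    by apply/negP => /mapP[i _ yi]; apply: nex; exists i.
  rewrite map_inj_in_uniq ?iota_uniq // => i j; rewrite !mem_iota !add0n /=.
  wlog ij : i j / (i <= j)%N.
    move=> W ip jp h; have [|/ltnW] := leqP i j => le; first exact: W.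
    by apply/esym; apply: W.
  move=> ip jp /esym/eqP; rewrite -subr_eq0 -natrB // -(dvdn_pcharf chF) => dv.
  have : (j - i)%N = 0%N.
    by apply/eqP; apply: contraTT dv; rewrite -lt0n => h; rewrite gtnNdvd //; lia.
  by lia.
have := max_poly_roots q0 rs us; rewrite sq /= size_map size_iota.
by rewrite ltnn.
Qed.

Lemma pchar_intr_eq0 (n : int) : ((n%:~R : F) == 0) = (p%:Z %| n)%Z.
Proof.
case: n => n; first by rewrite -(dvdn_pcharf chF).
by rewrite NegzE mulrNz oppr_eq0 -pmulrn -(dvdn_pcharf chF).
Qed.

Lemma pchar_intr_eq (n m : int) : ((n%:~R : F) = m%:~R) <-> (n = m %[mod p])%Z.
Proof.
split=> [h|/eqP].
  by apply/eqP; rewrite eqz_mod_dvd -pchar_intr_eq0 rmorphB /= h subrr.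
by rewrite eqz_mod_dvd -pchar_intr_eq0 rmorphB subr_eq0 => /eqP.
Qed.

(** Euler's criterion in an extension field: a is a square mod p iff its root y lies in the prime
    field, that is, iff Frobenius fixes y rather than negating it. *)
Lemma legendre_frobenius (a : int) (y : F) (b : bool) : ~~ (p%:Z %| a)%Z ->
  y ^+ 2 = a%:~R -> y ^+ p = (-1) ^+ b * y -> legendre a p = (-1) ^+ b.
Proof.
move=> pa ya; have p2 : (2 < p)%N by rewrite odd_prime_gt2.
case: b; rewrite ?expr1 ?expr0 ?mulN1r ?mul1r => yp.
  rewrite /legendre (negPf pa); case: existsP => // -[x /eqP xa].
  have : (x%:R : F) ^+ 2 = y ^+ 2.
    by move/pchar_intr_eq: xa; rewrite ya rmorphXn.
  move/eqP; rewrite eqf_sqr => h.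
  have : y ^+ p = y.
    case/orP: h => /eqP h;
      first by rewrite -h -(pFrobenius_autE chF) pFrobenius_aut_nat.
    rewrite -[y]opprK -h -(pFrobenius_autE chF) pFrobenius_autN.
    by rewrite pFrobenius_aut_nat.
  rewrite yp => /eqP; rewrite -subr_eq0 -opprD oppr_eq0 -mulr2n -mulr_natl mulf_eq0.
  rewrite -(dvdn_pcharf chF) gtnNdvd //= => /eqP y0.
  by move: ya; rewrite y0 expr0n /= => /esym/eqP; rewrite pchar_intr_eq0 (negPf pa).
have [i yi] := frobenius_fixed yp.
apply: (@legendre_square p a i%:Z); rewrite ?prime_gt0 //.
by apply/pchar_intr_eq; rewrite rmorphXn /= -[(Posz i)%:~R]/(i%:R) -yi ya.
Qed.

End LegendreFrobenius.

(* If z is a primitive 8th root of unity in characteristic p, then 2 z^2, z - z^3 and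
   z + z^3 are square roots of -4, 2 and -2; each is in the prime field iff it is
   fixed by the Frobenius map. *)
Lemma legendre_supplements (p : nat) : prime p -> odd p ->
  [/\ legendre (-4) p = (-1) ^+ (p %% 4 == 3)%N,
      legendre 2 p = (-1) ^+ ((p %% 8 == 3) || (p %% 8 == 5))%N
    & legendre (-2) p = (-1) ^+ ((p %% 8 == 5) || (p %% 8 == 7))%N].
Proof.
move=> pp op; have [F [z [chF z4]]] := exists_zeta8 pp op.
have p2 : (2 < p)%N by rewrite odd_prime_gt2.
have nd2 : ~~ (p %| 2)%N by rewrite gtnNdvd.
have nd4 : ~~ (p %| 4)%N by rewrite (Euclid_dvdM 2 2 pp) negb_or nd2.
have z8 : z ^+ 8 = 1 by rewrite (exprM z 4 2) z4 sqrrN expr1n.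
have zp : z ^+ p = z ^+ (p %% 8).
  by rewrite {1}(divn_eq p 8) exprD mulnC exprM z8 expr1n mul1r.
have frD (x y : F) : (x + y) ^+ p = x ^+ p + y ^+ p.
  by rewrite -!(pFrobenius_autE chF) pFrobenius_autD_comm //; apply: mulrC.
have fr2 : (2%:R : F) ^+ p = 2%:R by rewrite -(pFrobenius_autE chF) pFrobenius_aut_nat.
have m4 : (p %% 4)%N = ((p %% 8) %% 4)%N by rewrite modn_dvdm.
have o8 : odd (p %% 8) by rewrite -[8%N]/(2 * 4)%N odd_mod.
have r8 : (p %% 8 < 8)%N by rewrite ltn_mod.
have z5 : z ^+ 5 = - z by rewrite (exprD z 4 1) z4 mulN1r.
have z6 : z ^+ 6 = - z ^+ 2 by rewrite (exprD z 4 2) z4 mulN1r.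
have z7 : z ^+ 7 = - z ^+ 3 by rewrite (exprD z 4 3) z4 mulN1r.
rewrite m4; split.
- apply: (@legendre_frobenius p F pp op chF (-4) (2%:R * z ^+ 2)) => //.
    by rewrite exprMn -exprM z4 mulrN1; congr (- _); rewrite -natrX.
  rewrite exprMn fr2 -exprM mulnC exprM zp -exprM.
  move: (p %% 8)%N o8 r8 => [|[|[|[|[|[|[|[|]]]]]]]] //= _ _.
  + by rewrite expr0 mul1r.
  + by rewrite z6 expr1; ring.
  + by rewrite expr0 mul1r (exprD z 8 2) z8 mul1r.
  + by rewrite (exprD z 8 6) z8 mul1r z6 expr1; ring.
- apply: (@legendre_frobenius p F pp op chF 2 (z - z ^+ 3)) => //.
    have -> : (z - z ^+ 3) ^+ 2 = z ^+ 2 - 2%:R * z ^+ 4 + z ^+ 4 * z ^+ 2 by ring.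
    rewrite z4; ring.
  have frB : (z - z ^+ 3) ^+ p = z ^+ (p %% 8) - z ^+ (p %% 8) ^+ 3.
    rewrite -!(pFrobenius_autE chF) pFrobenius_autB_comm; last exact: mulrC.
    by rewrite !pFrobenius_autE -[(z ^+ 3) ^+ p]exprM mulnC exprM zp.
  rewrite frB.
  move: (p %% 8)%N o8 r8 => [|[|[|[|[|[|[|[|]]]]]]]] //= _ _.
  + by rewrite expr0 expr1 mul1r.
  + by rewrite -exprM (exprD z 8 1) z8 mul1r expr1; ring.
  + by rewrite z5 expr1; ring.
  + have -> : (z ^+ 7) ^+ 3 = z ^+ 4 * z ^+ 4 * z ^+ 4 * z ^+ 4 * z ^+ 4 * z by ring.
    by rewrite z7 z4 expr0; ring.
- apply: (@legendre_frobenius p F pp op chF (-2) (z + z ^+ 3)) => //.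
    have -> : (z + z ^+ 3) ^+ 2 = z ^+ 2 + 2%:R * z ^+ 4 + z ^+ 4 * z ^+ 2 by ring.
    rewrite z4; ring.
  rewrite frD -exprM mulnC exprM zp.
  move: (p %% 8)%N o8 r8 => [|[|[|[|[|[|[|[|]]]]]]]] //= _ _.
  + by rewrite expr0 expr1 mul1r.
  + by rewrite -exprM (exprD z 8 1) z8 mul1r expr0; ring.
  + by rewrite z5 expr1; ring.
  + have -> : (z ^+ 7) ^+ 3 = z ^+ 4 * z ^+ 4 * z ^+ 4 * z ^+ 4 * z ^+ 4 * z by ring.
    by rewrite z7 z4 expr1; ring.
Qed.

(** Both sides are multiplicative on odd integers and agree at odd primes. The parameter [psi] will
    be the explicit character mod 4 or 8 for a = -4, 2, -2. *)
Lemma prod_legendre (a : int) (psi : nat -> int) :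
  (forall p, prime p -> odd p -> legendre a p = psi p) -> psi 1%N = 1 ->
  (forall x y, odd x -> odd y -> psi (x * y)%N = psi x * psi y) ->
  forall n, odd n ->
    \prod_(p <- primes n) kronecker_prime a p ^+ logn p n = psi n.
Proof.
move=> Hp psi1 psiM n on; have n0 : (0 < n)%N by case: n on.
have nE : n = (\prod_(p <- primes n) p ^ logn p n)%N.
  by rewrite {1}(prod_prime_decomp n0) prime_decompE big_map.
have psiX x e : odd x -> psi (x ^ e)%N = psi x ^+ e.
  move=> ox; elim: e => [|e IH]; first by rewrite expn0 expr0.
  by rewrite expnS exprS psiM ?IH // oddX ox orbT.
have hs p : p \in primes n -> prime p /\ odd p.
  rewrite mem_primes => /and3P[pp _ /dvdnP[q qe]]; split=> //.
  by move: on; rewrite qe oddM => /andP[].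
rewrite [in RHS]nE.
suff H (e : nat -> nat) (t : seq nat) : (forall p, p \in t -> prime p /\ odd p) ->
    odd (\prod_(p <- t) p ^ e p)%N /\
    \prod_(p <- t) kronecker_prime a p ^+ e p = psi (\prod_(p <- t) p ^ e p)%N.
  by have [_] := H (logn^~ n) _ hs.
elim: t => [|p t IH] {}hs; first by rewrite !big_nil psi1.
have [pp op] := hs p (mem_head p t).
have [|ot Et] := IH; first by move=> q qs; apply: hs; rewrite inE qs orbT.
rewrite !big_cons oddM oddX op orbT ot Et; split=> //.
rewrite psiM ?oddX ?op ?orbT // psiX // /kronecker_prime.
by case: eqP => [p2|_]; [move: op; rewrite p2|rewrite Hp].
Qed.

Lemma kronecker_odd (a : int) (psi : nat -> int) :
  (forall p, prime p -> odd p -> legendre a p = psi p) -> psi 1%N = 1 ->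
  (forall x y, odd x -> odd y -> psi (x * y)%N = psi x * psi y) ->
  forall n : int, odd `|n|%N ->
    kronecker a n = (if (a < 0) && (n < 0) then -1 else 1) * psi `|n|%N.
Proof.
move=> Hp psi1 psiM n on; rewrite /kronecker ifF; last first.
  by apply/eqP => n0; move: on; rewrite n0.
by rewrite (prod_legendre Hp).
Qed.

Lemma kronecker_m4 (n : int) : odd `|n|%N ->
  kronecker (-4) n = (-1) ^+ (n %% 4 == 3)%Z.
Proof.
move=> on; rewrite (@kronecker_odd _ (fun n => (-1) ^+ (n %% 4 == 3)%N)) //.
- case: n on => n on /=.
    by rewrite mul1r; congr ((-1) ^+ nat_of_bool _); apply/idP/idP => h; lia.
  (* For negative n the factor -1 of the Kronecker symbol matches the exchange of the classes 1 and
     3 mod 4 under n -> -n. *)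
  rewrite mulN1r -signrN.
  by congr ((-1) ^+ nat_of_bool _); apply/idP/idP => h; lia.
- by move=> p pp op; have [] := legendre_supplements pp op.
- move=> x y ox oy; rewrite -signr_addb; congr ((-1) ^+ nat_of_bool _).
  have := ltn_pmod x (isT : 0 < 4)%N; have := ltn_pmod y (isT : 0 < 4)%N.
  move: ox oy; rewrite -(@odd_mod x 4) // -(@odd_mod y 4) // -modnMm.
  by case: (x %% 4)%N => [|[|[|[|]]]] //; case: (y %% 4)%N => [|[|[|[|]]]].
Qed.

Lemma kronecker_2 (n : int) : odd `|n|%N ->
  kronecker 2 n = (-1) ^+ ((n %% 8 == 3)%Z || (n %% 8 == 5)%Z).
Proof.
move=> on.
rewrite (@kronecker_odd _ (fun n => (-1) ^+ ((n %% 8 == 3) || (n %% 8 == 5))%N)) //.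
- by case: n on => n on; rewrite /= ?mul1r;
    congr ((-1) ^+ nat_of_bool _); apply/idP/idP => h; lia.
- by move=> p pp op; have [] := legendre_supplements pp op.
- move=> x y ox oy; rewrite -signr_addb; congr ((-1) ^+ nat_of_bool _).
  have := ltn_pmod x (isT : 0 < 8)%N; have := ltn_pmod y (isT : 0 < 8)%N.
  move: ox oy; rewrite -(@odd_mod x 8) // -(@odd_mod y 8) // -modnMm.
  case: (x %% 8)%N => [|[|[|[|[|[|[|[|]]]]]]]] //;
  by case: (y %% 8)%N => [|[|[|[|[|[|[|[|]]]]]]]].
Qed.

Lemma kronecker_m2 (n : int) : odd `|n|%N ->
  kronecker (-2) n = (-1) ^+ ((n %% 8 == 5)%Z || (n %% 8 == 7)%Z).
Proof.
move=> on.
rewrite (@kronecker_odd _ (fun n => (-1) ^+ ((n %% 8 == 5) || (n %% 8 == 7))%N)) //.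
- case: n on => n on /=.
    by rewrite mul1r; congr ((-1) ^+ nat_of_bool _); apply/idP/idP => h; lia.
  rewrite mulN1r -signrN.
  by congr ((-1) ^+ nat_of_bool _); apply/idP/idP => h; lia.
- by move=> p pp op; have [] := legendre_supplements pp op.
- move=> x y ox oy; rewrite -signr_addb; congr ((-1) ^+ nat_of_bool _).
  have := ltn_pmod x (isT : 0 < 8)%N; have := ltn_pmod y (isT : 0 < 8)%N.
  move: ox oy; rewrite -(@odd_mod x 8) // -(@odd_mod y 8) // -modnMm.
  case: (x %% 8)%N => [|[|[|[|[|[|[|[|]]]]]]]] //;
  by case: (y %% 8)%N => [|[|[|[|[|[|[|[|]]]]]]]].
Qed.

Lemma kronecker_m1_vals (n : int) : odd `|n|%N -> kronecker (-1) n \in [:: 1; -1].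
Proof.
move=> on; rewrite /kronecker ifF; last first.
  by apply/eqP => n0; move: on; rewrite n0.
have sgnM (x y : int) : x \in [:: 1; -1] -> y \in [:: 1; -1] ->
    x * y \in [:: 1; -1].
  by rewrite !inE => /orP[]/eqP -> /orP[]/eqP ->;
    rewrite ?mulN1r ?opprK ?mul1r eqxx ?orbT.
apply: (sgnM _ _); first by case: ifP.
rewrite big_seq; elim/big_ind: _ => [//|x y|p]; first exact: sgnM.
rewrite mem_primes => /and3P[pp _ dv].
have op : odd p.
  by move: on; case/dvdnP: dv => q ->; rewrite oddM => /andP[].
have : kronecker_prime (-1) p \in [:: 1; -1].
  rewrite /kronecker_prime; case: eqP => [p2|_]; first by move: op; rewrite p2.
  by apply: legendre_vals; rewrite dvdzE /= dvdn1; case: eqP pp => // ->.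
move=> h; elim: (logn p _) => [|e IH] //; rewrite exprS; exact: sgnM.
Qed.

(** * Residue classes of exponents excluded by the sign vector *)

Section Shape.
Variables (D : discForm) (s : disc_shape) (N : nat).
Hypotheses (hshape : has_shape D s) (hcard : #|D| = N).

(** In an abelian, hence nilpotent, group the p-core is a Sylow p-subgroup. *)
Lemma ppart_card (p : nat) : #|ppart D p| = (N`_p)%N.
Proof.
rewrite /ppart -hcard -cardsT; apply: card_Hall.
apply: nilpotent_pcore_Hall; apply: abelian_nil; exact: FinRing.zmod_abelian.
Qed.

Let N_gt0 : (0 < N)%N.
Proof. by rewrite -hcard; apply/card_gt0P; exists 0. Qed.

Lemma odd_part (p : nat) : prime p -> odd p -> (p %| N)%N ->
  logn p N = 1%N /\ odd_sign s p \in [:: 1; -1].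
Proof.
move=> pp op pN; have [Hodd _] := hshape.
have := ppart_card p; have [->|[x [a [-> ox _ _ hs]]]] := Hodd p pp op.
  by rewrite cards1 => /esym/eqP; rewrite p_part_eq1 mem_primes pp N_gt0 pN.
rewrite -/(order x) ox p_part => /eqP; rewrite -{1}(expn1 p) eqn_exp2l ?prime_gt1 //.
by move=> /eqP <-.
Qed.

(** As p divides N exactly once, chi_p(2N/p) is nonzero and epsilon_p is 1 or -1. The class of 1 or
    the class of a nonresidue then takes the value -epsilon_p. *)
Lemma odd_bad_class (p : nat) : prime p -> odd p -> (p %| N)%N ->
  exists n0 : int, forall n : int, (n = n0 %[mod p])%Z ->
    chi_prime s p n = - sign_vector N s p.
Proof.
move=> pp op pN; have [lN hs] := odd_part pp op pN.
have p2 : p != 2%N by apply: contraTneq op => ->.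
have p0 := prime_gt0 pp; have p1 := prime_gt1 pp.
rewrite /chi_prime /sign_vector (negPf p2).
have nd : ~~ (p%:Z %| (2 * N%:Z %/ p%:Z)%Z)%Z.
  have /dvdnP[q Nq] := pN.
  have -> : (2 * N%:Z %/ p%:Z)%Z = (2 * q)%N%:Z.
    by rewrite Nq -PoszM mulnA PoszM mulzK // eqz_nat -lt0n.
  apply/negP; rewrite dvdzE /= Euclid_dvdM // => /orP[|/dvdnP[t qt]].
    by rewrite dvdn_prime2 // (negPf p2).
  have : (p ^ 2 %| N)%N by rewrite Nq qt -mulnA dvdn_mull.
  by rewrite pfactor_dvdn // lN.
have /legendre_vals := nd.
have [nr [_ hnr]] := exists_nonresidue pp op.
have Hone := legendre_one p1.
rewrite /chi_prime (negPf p2); move: hs; rewrite !inE.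
case/orP=> /eqP -> /orP[]/eqP ->.
- by exists nr => n /legendre_mod ->; rewrite hnr mulr1.
- by exists 1 => n /legendre_mod ->; rewrite Hone mulr1 opprK.
- by exists 1 => n /legendre_mod ->; rewrite Hone mul1r opprK.
- by exists nr => n /legendre_mod ->; rewrite hnr mulN1r opprK.
Qed.

(* The exponents in the odd classes n0 and n1 mod m do not occur in A^epsilon. *)
Record two_data (m N' : nat) : Prop := TwoData {
  two_N : N = (m * N')%N;
  two_odd : odd N';
  two_vals : forall n : int, odd `|n|%N -> chi_prime s 2 n \in [:: 1; -1];
  two_one : forall n : int, (n = 1 %[mod m])%Z -> chi_prime s 2 n = 1;
  two_half : forall n : int, (n = 1 + (m./2)%:Z %[mod m])%Z ->
    chi_prime s 2 n = -1;
  two_bad : exists n0 n1 : int, [/\ odd `|n0|%N,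
    m = 4%N /\ n1 = n0 \/ m = 8%N /\ (n1 = n0 + 2 %[mod 4])%Z &
    forall n : int, (n = n0 %[mod m])%Z \/ (n = n1 %[mod m])%Z ->
      chi_prime s 2 n = - sign_vector N s 2]
}.

Lemma two_data_modulus m N' : two_data m N' -> m = 4%N \/ m = 8%N.
Proof.
by move=> T; have [n0 [n1 [_ [[-> _]|[-> _]] _]]] := two_bad T; [left|right].
Qed.

Lemma two_data_even m N' : two_data m N' -> (2 %| N)%N.
Proof.
move=> T; rewrite (two_N T).
by have [->|->] := two_data_modulus T; rewrite dvdn_mulr.
Qed.

Lemma even_part : (2 %| N)%N -> exists m N' : nat, two_data m N'.
Proof.
move=> N2; have [_ Htwo] := hshape.
have := ppart_card 2.
have Npart : N = (N`_2 * N`_2^')%N by rewrite partnC.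
have oN' : odd (N`_2^')%N.
  by rewrite odd_2'nat part_pnat.
move: Htwo; rewrite /two_component /=.
case E2 : (two_part s) => [|t|t1 t2].
- move=> ->; rewrite cards1 => /esym/eqP; rewrite p_part_eq1 mem_primes N_gt0 N2 //.
- move=> [ht [x [y [ox oy [pr _] _ _]]]].
  rewrite -(dprod_card pr) -!/(order _) ox oy => Nc.
  exists 4%N, (N`_2^')%N; rewrite -Nc in Npart.
  (* Here N = 4 N' with N' odd, so N t/8 is N' or -N' and epsilon_2 is nonzero. *)
  have Nt : odd `|(N%:Z * t %/ 8)%Z|%N.
    by move: ht; rewrite {1}Npart !inE => /orP[]/eqP ->; lia.
  have cv (n : int) : odd `|n|%N -> chi_prime s 2 n = (-1) ^+ (n %% 4 == 3)%Z.
    by rewrite /chi_prime E2; exact: kronecker_m4.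
  split=> //.
  + by move=> n on; rewrite cv //; case: (_ == _).
  + move=> n hn; rewrite cv; last lia.
    by have -> : (n %% 4 == 3)%Z = false by lia.
  + move=> n /= hn; rewrite cv; last lia.
    by have -> : (n %% 4 == 3)%Z = true by lia.
  + rewrite /sign_vector eqxx E2 cv //.
    case: eqP => _.
      exists 1, 1; split=> [//||n hn]; first by left.
      rewrite cv; last lia.
      by have -> : (n %% 4 == 3)%Z = false by lia.
    exists 3, 3; split=> [//||n hn]; first by left.
    rewrite cv; last lia.
    by have -> : (n %% 4 == 3)%Z = true by lia.
- move=> [ht1 ht2 [x [y [ox oy [pr _] _ _]]]].
  rewrite -(dprod_card pr) -!/(order _) ox oy => Nc.
  exists 8%N, (N`_2^')%N; rewrite -Nc in Npart.
  have Nt : odd `|(t2 * N%:Z %/ 8)%Z|%N.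
    by move: ht2; rewrite {1}Npart !inE => /or4P[]/eqP ->; lia.
  have ot : odd `|(t1 * t2)%R|%N.
    by move: ht1 ht2; rewrite !inE => /orP[]/eqP -> /or4P[]/eqP ->.
  have := kronecker_m1_vals ot; rewrite !inE => kv.
  (* The sign of [kronecker (-1) (t1 * t2)] decides between the characters (2/n) and (-2/n), both
     tabulated mod 8. *)
  have [cv|cv] : (forall n : int, odd `|n|%N ->
      chi_prime s 2 n = (-1) ^+ ((n %% 8 == 3)%Z || (n %% 8 == 5)%Z)) \/
    (forall n : int, odd `|n|%N ->
      chi_prime s 2 n = (-1) ^+ ((n %% 8 == 5)%Z || (n %% 8 == 7)%Z)).
  + case/orP: kv => /eqP kv; [right|left] => n on; rewrite /chi_prime E2 eqxx kv.
      exact: kronecker_m2.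
    exact: kronecker_2.
  + split=> //.
    * by move=> n on; rewrite cv //; case: (_ || _).
    * move=> n hn; rewrite cv; last lia.
      by have -> : ((n %% 8 == 3)%Z || (n %% 8 == 5)%Z) = false by lia.
    * move=> n /= hn; rewrite cv; last lia.
      by have -> : ((n %% 8 == 3)%Z || (n %% 8 == 5)%Z) = true by lia.
    * rewrite /sign_vector eqxx E2 cv //; case: (_ || _).
        (* In each case n0 and n1 are the two odd classes mod 8 with the excluded value; they differ
           by 2 mod 4, which later cancels the terms b = 2, 6. *)
        exists 7, 1; split=> [//||n hn]; first by right.
        rewrite cv; last lia.
        by have -> : ((n %% 8 == 3)%Z || (n %% 8 == 5)%Z) = false by lia.
      exists 3, 5; split=> [//||n hn]; first by right.
      rewrite cv; last lia.
      by have -> : ((n %% 8 == 3)%Z || (n %% 8 == 5)%Z) = true by lia.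
  + split=> //.
    * by move=> n on; rewrite cv //; case: (_ || _).
    * move=> n hn; rewrite cv; last lia.
      by have -> : ((n %% 8 == 5)%Z || (n %% 8 == 7)%Z) = false by lia.
    * move=> n /= hn; rewrite cv; last lia.
      by have -> : ((n %% 8 == 5)%Z || (n %% 8 == 7)%Z) = true by lia.
    * rewrite /sign_vector eqxx E2 cv //; case: (_ || _).
        exists 1, 3; split=> [//||n hn]; first by right.
        rewrite cv; last lia.
        by have -> : ((n %% 8 == 5)%Z || (n %% 8 == 7)%Z) = false by lia.
      exists 5, 7; split=> [//||n hn]; first by right.
      rewrite cv; last lia.
      by have -> : ((n %% 8 == 5)%Z || (n %% 8 == 7)%Z) = true by lia.
Qed.

End Shape.

Lemma odd_double_add (a c : int) : odd `|c|%N -> odd `|(2 * a + c)%R|%N.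
Proof. lia. Qed.

Lemma odd_add_odd (a c : int) : odd `|a|%N -> odd `|c|%N ->
  exists t : int, a + c = 2 * t.
Proof. by exists ((a + c) %/ 2)%Z; lia. Qed.

(** With c = c1 and n = N', the leftmost matrix lies in Gamma0(8n), and [mx2 2 n 0 2] is translation
    by n/2. So f(. + 1/2)|M translated by n/2 is f|M up to a factor; w exists since a and n are odd.
    The scalar 4 balances the two determinants 4 on the right. *)
Lemma half_shift_conj (a b c d n w : int) : a * d - b * (4 * c) = 1 ->
  2 * w = a ^+ 2 * n + 1 ->
  mx2 (1 - 2 * a * c * n - 4 * c ^+ 2 * n) (w + a * c * n)
      (- (c ^+ 2 * (8 * n))) (1 + 2 * a * c * n) *m (4 *: mx2 a b (4 * c) d) =
  mx2 2 1 0 2 *m mx2 a b (4 * c) d *m mx2 2 n 0 2.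
Proof.
move=> dM hw; have scE (x : int) (A : 'M[int]_2) i j : (x *: A) i j = x * A i j.
  by rewrite mxE.
apply: mx2P; rewrite !mulmx2 !scE !mx2E.
- have -> : (1 - 2 * a * c * n - 4 * c ^+ 2 * n) * (4 * a) +
      (w + a * c * n) * (4 * (4 * c)) = 4 * a + 8 * c * (2 * w - a ^+ 2 * n) by ring.
  by rewrite hw; ring.
- have -> : (1 - 2 * a * c * n - 4 * c ^+ 2 * n) * (4 * b) +
      (w + a * c * n) * (4 * d) =
      4 * b + 2 * d * (2 * w - a ^+ 2 * n) +
      n * (2 * a + 4 * c) * (a * d - b * (4 * c)) by ring.
  by rewrite hw dM; ring.
- by ring.
- have -> : - (c ^+ 2 * (8 * n)) * (4 * b) + (1 + 2 * a * c * n) * (4 * d) =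
      4 * d + 8 * c * n * (a * d - b * (4 * c)) by ring.
  by rewrite dM; ring.
Qed.

(** * Moving a cusp towards infinity, one prime at a time *)

Section ChiDisc.
Variables (D : discForm) (s : disc_shape) (N : nat).
Hypotheses (hshape : has_shape D s) (hcard : #|D| = N).

Lemma chi_prime_one (p : nat) (n : int) : prime p -> (p %| N)%N ->
  (n = 1 %[mod N])%Z -> chi_prime s p n = 1.
Proof.
move=> pp pN n1; have [p2|op] := even_prime pp.
  have [m [N' T]] := even_part hshape hcard
    (etrans (congr1 (fun q => q %| N)%N (esym p2)) pN).
  rewrite p2; apply: (two_one T); move/eqP: n1; rewrite !eqz_mod_dvd => dv.
  by apply/eqP; rewrite eqz_mod_dvd; apply: dvdz_trans dv;
    rewrite (two_N T) PoszM dvdz_mulr.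
rewrite /chi_prime ifF; last by apply/eqP => p2; rewrite p2 in op.
rewrite -[RHS](legendre_one (prime_gt1 pp)); apply: legendre_mod.
apply/eqP; move/eqP: n1; rewrite !eqz_mod_dvd; apply: dvdz_trans.
by rewrite dvdzE.
Qed.

Lemma chi_disc_one (n : int) : (n = 1 %[mod N])%Z -> chi_disc N s n = 1.
Proof.
move=> n1; rewrite /chi_disc big_seq big1 // => p.
by rewrite mem_primes => /and3P[pp _ pN]; apply: chi_prime_one.
Qed.

Lemma chi_disc_two (N' : nat) (n : int) : (0 < N)%N -> (2 %| N)%N ->
  (forall p, prime p -> odd p -> (p %| N)%N -> (p %| N')%N) ->
  (n = 1 %[mod N'])%Z -> chi_disc N s n = chi_prime s 2 n.
Proof.
move=> N0 N2 hN' n1; rewrite /chi_disc (bigD1_seq 2%N) ?primes_uniq //=; last first.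
  by rewrite mem_primes N0 N2.
rewrite big_seq_cond big1 ?mulr1 // => p.
rewrite mem_primes => /andP[/and3P[pp _ pN] p2]; rewrite /chi_prime (negPf p2).
have op : odd p by case: (even_prime pp) => [pe|//]; rewrite pe in p2.
rewrite -[RHS](legendre_one (prime_gt1 pp)); apply: legendre_mod.
apply/eqP; move/eqP: n1; rewrite !eqz_mod_dvd; apply: dvdz_trans.
by rewrite dvdzE; apply: hN'.
Qed.

End ChiDisc.

Section Descent.
Variables (R : realType) (D : discForm) (s : disc_shape) (N : nat) (k : int).
Variable f : R[i] -> R[i].
Local Notation C := R[i].
Hypotheses (hshape : has_shape D s) (hcard : #|D| = N) (N_gt0 : (0 < N)%N).
Hypothesis hf : Aeps N k s f.
Implicit Types (M A : 'M[int]_2) (tau : C) (P Q : rat -> Prop).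
Local Notation chi := (chi_disc N s).

Lemma slash_Gamma0 M tau : Gamma0 N M -> upper tau ->
  slash k f M tau = (chi (M 1 1))%:~R * f tau.
Proof.
move=> GM ut; have [[_ H _] _] := hf; have [SM _] := GM.
have nz : cocycle M tau != 0 by apply: cocycle_neq0; rewrite ?SM.
rewrite /slash H // -[X in _ * X]mulrA mulrCA; congr (_ * _).
by rewrite mulrA -expfzDr // addNr expr0z mul1r.
Qed.

Lemma slash_Gamma0_mul M A tau : Gamma0 N M -> 0 < \det A -> upper tau ->
  slash k f (M *m A) tau = (chi (M 1 1))%:~R * slash k f A tau.
Proof.
move=> GM dA ut; rewrite slash_mul ?lt0r_neq0 // /slash.
rewrite -/(slash k f M _) slash_Gamma0 //; last exact: upper_moebius.
by rewrite mulrCA.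
Qed.

Lemma slash_commute M A (h : int) tau : Gamma0 N M -> 0 < \det A ->
  M *m A = A *m mx2 1 h 0 1 -> upper tau ->
  slash k f A (tau + h%:~R) = (chi (M 1 1))%:~R * slash k f A tau.
Proof.
move=> GM dA eMA ut; rewrite -slash_Gamma0_mul // eMA slash_mul //; last first.
  by rewrite det_mx22 !mx2E mulr1 mulr0 subr0.
by rewrite slash_upper exp1rz !mul1r divr1.
Qed.

(** The matrix [G] below is M T^h M^(-1) with T the translation by 1; its lower left entry is -c^2
    h, so the divisibility puts it in Gamma0(N). *)
Lemma slash_translate M (h : int) tau : SL2Z M ->
  (N%:Z %| (M 1 0)%R ^+ 2 * h)%Z -> upper tau ->
  slash k f M (tau + h%:~R) =
    (chi (1 + M 0 0 * M 1 0 * h))%:~R * slash k f M tau.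
Proof.
move=> SM Nc ut; have dM : \det M = 1 by [].
have SM' := dM; rewrite det_mx22 in SM'.
pose G := mx2 (1 - M 0 0 * M 1 0 * h) (M 0 0 ^+ 2 * h)
              (- (M 1 0 ^+ 2 * h)) (1 + M 0 0 * M 1 0 * h).
rewrite (@slash_commute G) ?dM ?mx2E //.
- split; last by rewrite mx2E rpredN.
  by rewrite /SL2Z det_mx22 !mx2E; ring.
- apply: mx2P; rewrite !mulmx2 !mx2E; try ring.
  + have -> : M 0 0 * h + M 0 1 * 1 =
        M 0 0 * h * (M 0 0 * M 1 1 - M 0 1 * M 1 0) + M 0 1.
      by rewrite SM'; ring.
    ring.
  + have -> : M 1 0 * h + M 1 1 * 1 =
        M 1 0 * h * (M 0 0 * M 1 1 - M 0 1 * M 1 0) + M 1 1.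
      by rewrite SM'; ring.
    ring.
Qed.

(** The factor m^k appears because [slash] carries no power of the determinant, so that
    [mx2 m b 0 m] contributes m^(-k). *)
Lemma slash_shift M (m b : nat) tau : SL2Z M -> (0 < m)%N -> upper tau ->
  cocycle M tau ^ (- k) * f (moebius M tau + b%:R / m%:R) =
    m%:R ^ k * slash k f (mx2 m b 0 m *m M) tau.
Proof.
move=> SM m0 ut; have mC : (m%:R : C) != 0 by rewrite pnatr_eq0 -lt0n.
rewrite slash_mul ?SM // {1}/slash slash_upper.
rewrite -[(Posz m)%:~R]/(m%:R) -[(Posz b)%:~R]/(b%:R) mulrDl mulrAC mulfV // mul1r.
rewrite [RHS]mulrCA; congr (_ * _).
by rewrite mulrA -expfzDr // subrr expr0z mul1r.
Qed.

Lemma sl2_coprime M : SL2Z M -> coprimez (M 0 0) (M 1 0).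
Proof.
rewrite /SL2Z det_mx22 => dM; apply/coprimezP.
by exists (M 1 1, - M 0 1) => /=; rewrite -dM; ring.
Qed.

Lemma coprimez_dvd (x m n : int) : (m %| n)%Z -> coprimez x n -> coprimez x m.
Proof. by rewrite !coprimezE dvdzE => mn; apply: coprime_dvdr. Qed.

(** A prime dividing u a + b c and m divides u, hence b c; one dividing u a + b c and c divides u a.
    Both contradict the coprimality assumptions. *)
Lemma coprimez_shift (u m a b c : int) (n : nat) :
  coprimez u (b * c) -> coprimez a c -> (m %| u ^+ n)%Z ->
  coprimez (u * a + b * c) (m * c).
Proof.
move=> ubc ac mu; rewrite coprimezMr; apply/andP; split.
  apply: (coprimez_dvd mu); apply: coprimezXr.
  by rewrite coprimez_sym /coprimez mulrC gcdzMDl.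
rewrite addrC coprimez_sym /coprimez gcdzMDl -/(coprimez _ _) coprimezMr.
rewrite (coprimez_sym c a) ac andbT coprimez_sym.
by move: ubc; rewrite coprimezMr => /andP[].
Qed.

Lemma det_shift_mul M (m b : int) : SL2Z M -> \det (mx2 m b 0 m *m M) = m ^+ 2.
Proof. by move=> SM; rewrite det_mulmx SM mulr1 det_mx22 !mx2E; ring. Qed.

Lemma descend_odd (p : nat) M P Q : prime p -> odd p -> (p %| N)%N -> SL2Z M ->
  ~~ (p%:Z %| (M 1 0)%R)%Z ->
  (forall M', SL2Z M' -> M' 1 0 = p%:Z * M 1 0 -> has_exp (slash k f M') P) ->
  (forall l, P l -> Q (l / p%:R ^+ 2)) -> has_exp (slash k f M) Q.
Proof.
move=> pp op pN SM pc HM PQ; have p0 := prime_gt0 pp.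
have [n0 bad] := odd_bad_class hshape hcard pp op pN.
have [_ [a [qa Ha]]] := hf.
have an0 (n : int) : (n = n0 %[mod p])%Z -> a n = 0.
  by move=> /bad; apply: Ha.
(* The class relation at M tau, solved for its term b = 0; the power of p undoes the scaling in
   [slash_shift]. *)
pose c (b : 'I_p) : C := - e2 (- (n0%:~R * b%:R / p%:R)) * p%:R ^ k.
apply: (@has_exp_ext _ (fun tau =>
    \sum_(b < p | (0 < b)%N) c b * slash k f (mx2 p b 0 p *m M) tau)).
  move=> tau ut; have um : upper (moebius M tau) by apply: upper_moebius; rewrite ?SM.
  have := class_relation p0 qa an0 um.
  move/(congr1 (fun z => cocycle M tau ^ (- k) * z)); rewrite mulr0 mulr_sumr.
  rewrite (bigD1 (Ordinal p0)) //= mulr0n mulr0 !mul0r oppr0 e2_0 mul1r addr0.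
  move=> /eqP; rewrite addr_eq0 => /eqP E.
  rewrite -[RHS]/(cocycle M tau ^ (- k) * f (moebius M tau)) E.
  rewrite -sumrN; apply: eq_big => b; first by rewrite lt0n.
  move=> b0; rewrite /c mulNr mulNr; congr (- _).
  by rewrite -mulrA -slash_shift // mulrCA.
apply: has_exp_sum => b b0; apply: has_expZ.
have dA := det_shift_mul p b SM.
(* The first column is (p a + b c, p c) with p prime to b c, so the gcd is 1: the new cusp has lower
   left entry p c and exponents are divided by p^2. *)
have cop : gcdz ((mx2 p b 0 p *m M) 0 0) ((mx2 p b 0 p *m M) 1 0) = 1.
  rewrite !mulmx2 !mx2E mul0r add0r; apply/eqP.
  rewrite -[_ == 1]/(coprimez _ _).
  apply: (@coprimez_shift p p _ b _ 1%N); rewrite ?expr1 ?sl2_coprime //.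
  rewrite coprimezMr !coprimezE !(prime_coprime _ pp).
  apply/andP; split; last exact: pc.
  by rewrite absz_nat gtnNdvd // ltn_ord.
apply: (has_exp_slash_factor (P := P)); rewrite ?dA ?cop.
- by rewrite exprn_gt0.
- move=> M' SM'; rewrite mulr1 mulmx2 !mx2E mul0r add0r; exact: HM.
- by move=> l /PQ; congr Q; rewrite expr1n div1r rmorphXn mulrC.
Qed.

(** For A = [mx2 2 1 0 2 *m M], with first column (2a + c, 2c) and determinant 4, the conjugate A
    T^h A^(-1) has rows (1 - y, x) and (-c^2 h, 1 + y). The two equations express that x and y are
    integral. *)
Lemma half_shift_commute M (h x y : int) tau : SL2Z M ->
  4 * x = (2 * M 0 0 + M 1 0) ^+ 2 * h ->
  2 * y = (2 * M 0 0 + M 1 0) * M 1 0 * h ->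
  (N%:Z %| (M 1 0)%R ^+ 2 * h)%Z -> upper tau ->
  slash k f (mx2 2 1 0 2 *m M) (tau + h%:~R) =
    (chi (1 + y))%:~R * slash k f (mx2 2 1 0 2 *m M) tau.
Proof.
clear hshape hcard N_gt0.
move=> SM hx hy Nc ut; have dM : \det M = 1 by [].
rewrite det_mx22 in dM.
pose G := mx2 (1 - y) x (- (M 1 0 ^+ 2 * h)) (1 + y).
have := @slash_commute G (mx2 2 1 0 2 *m M) h tau.
rewrite [G 1 1]mx2E; apply=> //; last 2 first.
- by rewrite det_mulmx SM det_mx22 !mx2E.
- apply: mx2P; rewrite !mulmx2 !mx2E;
  move: (M 0 0) (M 0 1) (M 1 0) (M 1 1) dM hx hy => a b c d dM hx hy.
  + have h1 := congr1 (fun z => z * c) hx;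
    have h2 := congr1 (fun z => z * (2 * a + c)) hy.
    rewrite /= in h1 h2; lia.
  + have h1 := congr1 (fun z => z * d) hx;
    have h2 := congr1 (fun z => z * (2 * b + d)) hy.
    have h3 := congr1 (fun z => z * ((2 * a + c) * h)) dM.
    rewrite /= in h1 h2 h3; lia.
  + have h2 := congr1 (fun z => z * c) hy; rewrite /= in h2; lia.
  + have h2 := congr1 (fun z => z * d) hy.
    have h3 := congr1 (fun z => z * (c * h)) dM.
    rewrite /= in h2 h3; lia.
split; last by rewrite mx2E rpredN.
rewrite /SL2Z det_mx22 !mx2E.
have h1 := congr1 (fun z => z * (M 1 0 ^+ 2 * h)) hx.
have h2 := congr1 (fun z => z ^+ 2) hy.
rewrite /= in h1 h2; lia.
Qed.

Section Two.
Variables (m N' : nat).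
Hypothesis T : two_data s N m N'.

Let m48 : m = 4%N \/ m = 8%N := two_data_modulus T.
Let N2 : (2 %| N)%N := two_data_even T.

Lemma chi_two (n : int) : (n = 1 %[mod N'])%Z -> chi n = chi_prime s 2 n.
Proof.
move=> n1; apply: (@chi_disc_two s N N' n N_gt0 N2 _ n1) => p pp op;
  rewrite (two_N T) Euclid_dvdM //.
case/orP => // pm; have : (p %| 2 ^ 3)%N.
  by apply: dvdn_trans pm _; case: m48 => ->.
by rewrite Euclid_dvdX // andbT dvdn_prime2 // => /eqP p2; rewrite p2 in op.
Qed.

(* For m = 8 the relations of [class_relation] for the two excluded odd classes are
   added: these classes differ mod 4, so the terms with b = 2, 6 cancel. *)
Lemma half_shift_relation : exists w : 'I_m -> C, forall tau, upper tau ->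
  f tau - f (tau + 1%:R / 2%:R) = \sum_(b < m | odd b) w b * f (tau + b%:R / m%:R).
Proof.
clear hshape hcard N_gt0.
have [_ [a [qa Ha]]] := hf.
have [n0 [n1 [on0 hm bad]]] := two_bad T.
have m0 : (0 < m)%N by case: m48 => ->.
have mC : (m%:R : C) != 0 by rewrite pnatr_eq0 -lt0n.
have rel n tau : n = n0 \/ n = n1 -> upper tau ->
   \sum_(b < m) e2 (- (n%:~R * b%:R / m%:R)) * f (tau + b%:R / m%:R) = 0.
  move=> hn ut; apply: (class_relation m0 qa _ ut) => i hi.
  apply: (Ha i 2%N) => //; apply: bad.
  by case: hn => <-; [left|right].
pose c (n : int) (b : nat) : C := e2 (- (n%:~R * b%:R / m%:R)).
(* Each of the two relations, which coincide for m = 4, contributes f(tau) - f(tau + 1/2) once;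
   hence the division by 2. *)
exists (fun b => - (c n0 b + c n1 b) / 2%:R) => tau ut.
have := rel n0 tau (or_introl erefl) ut; have := rel n1 tau (or_intror erefl) ut.
have C2 : (2%:R : C) != 0 by rewrite pnatr_eq0.
rewrite (bigID (fun b : 'I_m => odd b)) /= => /eqP; rewrite addr_eq0 => /eqP E1.
rewrite (bigID (fun b : 'I_m => odd b)) /= => /eqP; rewrite addr_eq0 => /eqP E0.
have -> : \sum_(b < m | odd b) - (c n0 b + c n1 b) / 2%:R * f (tau + b%:R / m%:R) =
    (\sum_(b < m | ~~ odd b) (c n0 b + c n1 b) * f (tau + b%:R / m%:R)) / 2%:R.
  under [X in _ = X / _]eq_bigr => b _ do rewrite mulrDl.
  rewrite big_split /= -[X in (X + _) / _]opprK -E0 -[X in (_ + X) / _]opprK -E1.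
  rewrite -opprD -big_split /= mulNr mulr_suml -sumrN; apply: eq_bigr => b _.
  by rewrite -mulrDl mulNr -/(c n0 b) -/(c n1 b); field.
have c0 n : c n 0%N = 1 by rewrite /c mulr0n mulr0 mul0r oppr0 e2_0.
have cE n (b : nat) (l : int) (x : C) :
    (m%:Z * l = - 2 * n * b%:Z) -> c n b = e2 (l%:~R / 2%:R).
  move=> h; congr e2; have := congr1 (fun z : int => z%:~R : C) h.
  rewrite !rmorphM rmorphN /= -[(Posz m)%:~R]/(m%:R) -[(Posz b)%:~R]/(b%:R) => h'.
  apply: (mulfI mC); rewrite [RHS]mulrA h'; field.
  by rewrite mC.
have on1 : odd `|n1|%N by case: hm => -[_ h]; [rewrite h|lia].
have cm (n : int) : odd `|n|%N -> c n m./2 = -1.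
  move=> on; rewrite (@cE _ _ (- n)) ?e2_odd_half ?abszN //.
  by case: m48 => ->; rewrite /=; lia.
have cs (b : nat) : m = 8%N -> (n1 = n0 + 2 %[mod 4])%Z -> b = 2%N \/ b = 6%N ->
    c n1 b = - c n0 b.
  move=> mE n1E hb.
  have [l lE ol] : exists2 l : int, - ((n1 - n0) * b%:Z) = l * 4 & odd `|l|%N.
    have /dvdzP[q hq] : (4 %| n1 - (n0 + 2))%Z by rewrite -eqz_mod_dvd n1E.
    have -> : n1 = n0 + 2 + q * 4 by lia.
    by case: hb => ->; [exists (- (1 + 2 * q))|exists (- 3 * (1 + 2 * q))]; lia.
  rewrite -mulN1r -(e2_odd_half R ol) -e2D; congr e2.
  have := congr1 (fun z : int => z%:~R : C) lE.
  rewrite rmorphN !rmorphM rmorphB /= -[(Posz b)%:~R]/(b%:R) => h'.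
  apply: (mulfI C2); apply: (mulfI C2); apply: (mulfI C2); rewrite mE.
  have -> : 2%:R * (2%:R * (2%:R * (- (n1%:~R * b%:R / 8%:R)))) =
      - (n1%:~R * b%:R) :> C.
    by field.
  have -> : 2%:R * (2%:R * (2%:R * (l%:~R / 2%:R + - (n0%:~R * b%:R / 8%:R)))) =
     l%:~R * 4%:R - n0%:~R * b%:R :> C by field.
  by rewrite -[4%:R]/(4%:~R) -h'; ring.
pose F (b : nat) := f (tau + b%:R / m%:R).
rewrite -[\sum_(b < m | _) _]/(\sum_(b < m | ~~ odd b) (c n0 b + c n1 b) * F b).
have -> : f tau = F 0%N by rewrite /F mulr0n mul0r addr0.
have -> : f (tau + 1%:R / 2%:R) = F m./2.
  congr (f (tau + _)); apply: (mulIf mC); rewrite mulfVK //.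
  by case: m48 => ->; rewrite /=; field.
have c2 : m = 8%N -> (n1 = n0 + 2 %[mod 4])%Z -> c n1 2%N = - c n0 2%N.
  by move=> mE h; apply: cs => //; left.
have c6 : m = 8%N -> (n1 = n0 + 2 %[mod 4])%Z -> c n1 6%N = - c n0 6%N.
  by move=> mE h; apply: cs => //; right.
case: hm => -[mE n1E]; [clear c2 c6|have {}c2 := c2 mE n1E; have {}c6 := c6 mE n1E];
  move: (cm _ on0) (cm _ on1); move: F; rewrite mE => F c'm c''m;
  rewrite big_mkcond !big_ord_recl big_ord0 /= /bump !leq0n !add1n !c0.
  by rewrite c'm c''m; field.
by rewrite c'm c''m c2 c6; field.
Qed.

(** For odd b the shift matrix times M has first column with gcd 2^i and determinant 2^(2i + 2j).
    Hence the lower left entry becomes m c/2^i = 2^j c, and exponents are divided by 2^(2j). *)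
Lemma half_difference_exp M (i j : nat) (c1 : int) P Q : SL2Z M ->
  M 1 0 = 2 ^+ i * c1 -> odd `|c1|%N -> m = (2 ^ (i + j))%N -> (0 < j)%N ->
  (forall M', SL2Z M' -> M' 1 0 = 2 ^+ j * M 1 0 -> has_exp (slash k f M') P) ->
  (forall l, P l -> Q (l / (2 ^+ j) ^+ 2)) ->
  has_exp (fun tau => slash k f M tau - 2%:R ^ k * slash k f (mx2 2 1 0 2 *m M) tau) Q.
Proof.
clear hshape hcard N_gt0.
move=> SM cE oc1 mE j0 HM PQ.
have [w rel] := half_shift_relation.
have m0 : (0 < m)%N by case: m48 => ->.
have mZ : m%:Z = 2 ^+ (i + j) by rewrite mE -natz natrX.
have ij3 : (i + j <= 3)%N.
  by rewrite -(@leq_exp2l 2) // -mE; case: m48 => ->.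
apply: (@has_exp_ext _ (fun tau =>
    \sum_(b < m | odd b) w b * m%:R ^ k * slash k f (mx2 m b 0 m *m M) tau)).
  move=> tau ut; have um : upper (moebius M tau) by apply: upper_moebius; rewrite ?SM.
  have := rel _ um => /(congr1 (fun z => cocycle M tau ^ (- k) * z)).
  rewrite mulrBr (slash_shift 1 SM (isT : 0 < 2)%N ut).
  rewrite -/(slash k f M tau) => ->.
  rewrite mulr_sumr; apply: eq_bigr => b _.
  by rewrite -mulrA -slash_shift // mulrCA.
apply: has_exp_sum => b ob; apply: has_expZ.
have dA := det_shift_mul m b SM.
have cop : gcdz ((mx2 m b 0 m *m M) 0 0) ((mx2 m b 0 m *m M) 1 0) = 2 ^+ i.
  rewrite !mulmx2 !mx2E mul0r add0r cE.
  have -> : m%:Z * M 0 0 + b%:Z * (2 ^+ i * c1) =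
      2 ^+ i * (2 ^+ j * M 0 0 + b%:Z * c1) by rewrite mZ exprD; ring.
  have /eqP h : coprimez (2 ^+ j * M 0 0 + b%:Z * c1) (m%:Z * c1).
    (* The exponent 3 works because m = 2^(i + j) and i + j <= 3 <= 3 j. *)
    apply: (@coprimez_shift (2 ^+ j) m _ b c1 3).
    - by apply: coprimezXl; rewrite coprimezE /= coprime2n abszM oddM ob.
    - by have := sl2_coprime SM; rewrite cE coprimezMr => /andP[].
    - by rewrite mZ -exprM dvdz_exp2l //; lia.
  by rewrite (mulrCA m%:Z) -mulz_gcdr h mulr1 gez0_abs // exprn_ge0.
apply: (has_exp_slash_factor (P := P)); rewrite ?dA ?cop.
- by rewrite exprn_gt0.
- move=> M' SM'; rewrite mulmx2 !mx2E mul0r add0r mZ => h; apply: HM => //.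
  apply: (mulIf (_ : (2 ^+ i : int) != 0)); first by rewrite expf_neq0.
  by rewrite h exprD; ring.
- move=> l /PQ; congr Q; rewrite mZ !rmorphXn /= exprD.
  have i0 : (2%:~R ^+ i : rat) != 0 by rewrite expf_neq0.
  have j0' : (2%:~R ^+ j : rat) != 0 by rewrite expf_neq0.
  by rewrite -[2]/(2%:~R); field; rewrite i0 j0'.
Qed.

(** Modulo N' the argument is 1, so only chi_2 matters; modulo m it is 1 + m/2, because N' x is
    odd. *)
Lemma chi_two_half (n x : int) : n = (m./2 * N')%N%:Z * x -> odd `|x|%N ->
  chi (1 + n) = -1.
Proof.
clear hshape hcard hf.
move=> nE ox; rewrite (chi_two); last first.
  by apply/eqP; rewrite eqz_mod_dvd nE PoszM; apply/dvdzP; exists (m./2%:Z * x); ring.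
apply: (two_half T); apply/eqP; rewrite eqz_mod_dvd nE.
have /dvdzP[q hq] : (2 %| N'%:Z * x - 1)%Z by move: (two_odd T) ox; lia.
apply/dvdzP; exists q; rewrite PoszM.
have -> : 1 + m./2%:Z * N'%:Z * x - (1 + m./2%:Z) = (N'%:Z * x - 1) * m./2%:Z by ring.
by rewrite hq; case: m48 => -> /=; ring.
Qed.

(* Write M 1 0 = 2^i c1 with c1 odd, F = f|M and G = f(. + 1/2)|M, so that F - G is
   known. For i = 0, 1 a translation fixes one of F, G and changes the sign of the
   other; for i = 2 translation by N'/2 maps G to F up to sign, while translation by
   N' maps F to - F. In each case F is a combination of translates of F - G. *)
Lemma descend_two M : SL2Z M -> ~~ (m%:Z %| (M 1 0)%R)%Z ->
  exists j : nat, [/\ (0 < j)%N, (m%:Z %| (2 ^+ j * M 1 0)%R)%Z,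
    (N%:Z %| (M 1 0)%R * ((2 ^ j)%N * N')%N%:Z)%Z &
   forall P Q,
    (forall M', SL2Z M' -> M' 1 0 = 2 ^+ j * M 1 0 -> has_exp (slash k f M') P) ->
    (forall l, P l -> Q (l / (2 ^+ j) ^+ 2)) -> has_exp (slash k f M) Q].
Proof.
move=> SM mc.
have NE : N%:Z = m%:Z * N'%:Z by rewrite (two_N T) PoszM.
have [e mE] : exists e, m = (2 ^ e)%N by case: m48 => ->; [exists 2%N|exists 3%N].
have e23 : e = 2%N \/ e = 3%N.
  case: m48 => me; [left|right]; apply/eqP;
  by rewrite -(@eqn_exp2l 2) // -mE me.
have mZ : m%:Z = 2 ^+ e by rewrite mE -natz natrX.
have [i [c1 [cE oc1 ie]]] : exists i c1,
    [/\ M 1 0 = 2 ^+ i * c1, odd `|c1|%N & (i < e)%N].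
  move: (M 1 0) mc => c mc.
  have mdiv (x : int) : c = m%:Z * x -> False.
    by move=> h; case/negP: mc; rewrite h dvdz_mulr.
  have even2 (x : int) : ~~ odd `|x|%N -> x = 2 * (x %/ 2)%Z by lia.
  have [oc|/even2 c2] := boolP (odd `|c|%N).
    by exists 0%N, (c); rewrite expr0 mul1r; split=> //; lia.
  have [oc|/even2 c4] := boolP (odd `|(c %/ 2)%Z|%N).
    by exists 1%N, (c %/ 2)%Z; rewrite expr1; split=> //; lia.
  case: e23 => eE.
    by case: (mdiv ((c %/ 2)%Z %/ 2)%Z); rewrite mZ eE {1}c2 {1}c4 mulrA.
  have [oc|/even2 c8] := boolP (odd `|((c %/ 2)%Z %/ 2)%Z|%N).
    exists 2%N, ((c %/ 2)%Z %/ 2)%Z; rewrite eE; split=> //.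
    by rewrite {1}c2 {1}c4 mulrA.
  case: (mdiv (((c %/ 2)%Z %/ 2)%Z %/ 2)%Z).
  by rewrite mZ eE {1}c2 {1}c4 {1}c8 !mulrA.
(* The power of 2 by which c = 2^i c1 falls short of m = 2^e. *)
exists (e - i)%N.
have eE : (e = i + (e - i))%N by rewrite subnKC // ltnW.
move: (e - i)%N eE => j eE; have j0 : (0 < j)%N by lia.
have hj : 2 ^+ j * M 1 0 = m%:Z * c1 by rewrite cE mZ eE exprD; ring.
split=> //.
- by rewrite hj dvdz_mulr.
- apply/dvdzP; exists c1; rewrite PoszM -[(2 ^ j)%N%:Z]natz natrX mulrA (mulrC (M 1 0)).
  by rewrite -[2%:R]/2 hj NE; ring.
move=> P Q HM PQ.
have me : m = (2 ^ (i + j))%N by rewrite -eE.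
have HK := half_difference_exp SM cE oc1 me j0 HM PQ.
set F := slash k f M; set G := fun tau => 2%:R ^ k * slash k f (mx2 2 1 0 2 *m M) tau.
have {}HK : has_exp (fun tau => F tau - G tau) Q by [].
have C2 : (2%:R : C) != 0 by rewrite pnatr_eq0.
have N1 : (N%:Z = 0 %[mod N])%Z by rewrite modzz mod0z.
have chiN (x : int) : chi (1 + N%:Z * x) = 1.
  apply: (chi_disc_one hshape hcard); apply/eqP.
  by rewrite eqz_mod_dvd addrAC subrr add0r dvdz_mulr.
have oa : (0 < i)%N -> odd `|(M 0 0)%R|%N.
  move=> i0; have := sl2_coprime SM; rewrite cE coprimezMr => /andP[+ _].
  by rewrite coprimez_pexpr // coprimezE /= coprimen2.
clear me hj; case: i => [|[|[|i]]] in cE ie eE oa *.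
- rewrite expr0 mul1r in cE; rewrite add0n in eE.
  have FN tau : upper tau -> F (tau + (N%:Z)%:~R) = F tau.
    move=> ut; rewrite /F (slash_translate SM) ?dvdz_mull //.
    by rewrite (mulrC _ N%:Z) chiN mul1r.
  have GN tau : upper tau -> G (tau + (N%:Z)%:~R) = - G tau.
    move=> ut; rewrite /G.
    (* The entries of the conjugate of translation by N; y is an odd multiple of (m/2) N', which
       gives the sign -1. *)
    pose x := (2 * M 0 0 + M 1 0) ^+ 2 * (m./2./2 * N')%N%:Z.
    pose y := (2 * M 0 0 + M 1 0) * M 1 0 * (m./2 * N')%N%:Z.
    rewrite (@half_shift_commute M N x y) ?dvdz_mull //.
    + rewrite (@chi_two_half _ ((2 * M 0 0 + M 1 0) * M 1 0)) ?mulN1r ?mulrN //.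
        by rewrite /y; ring.
      by rewrite abszM oddM cE oc1 andbT odd_double_add.
    + by rewrite /x NE PoszM; case: m48 => -> /=; ring.
    + by rewrite /y NE PoszM; case: m48 => -> /=; ring.
  have := has_expZ (2%:R^-1) (has_expD HK (has_exp_translate N%:Z HK)).
  apply: has_exp_ext => tau ut; rewrite FN // GN //.
  by field.
- rewrite expr1 in cE; have {}oa := oa isT.
  (* As c = 2 c1, already h = N/4 makes c^2 h a multiple of N. Now a c h is an odd multiple of N/2,
     while 2a + c is divisible by 4 as a + c1 is even: F changes sign and G is fixed. *)
  pose h : int := (m./2./2 * N')%N%:Z.
  have h4 : 4 * h = N%:Z by rewrite /h NE PoszM; case: m48 => -> /=; ring.
  have FN tau : upper tau -> F (tau + h%:~R) = - F tau.
    move=> ut; rewrite /F (slash_translate SM) //.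
      rewrite (@chi_two_half _ (M 0 0 * c1)) ?mulN1r //; last by rewrite abszM oddM oa.
      by rewrite cE /h !PoszM; case: m48 => -> /=; ring.
    by apply/dvdzP; exists (c1 ^+ 2); rewrite cE -h4; ring.
  have GN tau : upper tau -> G (tau + h%:~R) = G tau.
    move=> ut; rewrite /G; have [t ht] := odd_add_odd oa oc1.
    have t4 : 2 * M 0 0 + M 1 0 = 4 * t by rewrite cE -mulrDr ht mulrA.
    rewrite (@half_shift_commute M h (4 * t ^+ 2 * h) (N%:Z * (t * c1))) //.
    + by rewrite chiN mul1r.
    + by rewrite t4; ring.
    + by rewrite t4 cE -h4; ring.
    + by apply/dvdzP; exists (c1 ^+ 2); rewrite cE -h4; ring.
  have := has_expZ (2%:R^-1) (has_expB HK (has_exp_translate h HK)).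
  apply: has_exp_ext => tau ut; rewrite FN // GN //.
  by field.
- have {}oa := oa isT; have e3 : e = 3%N by case: e23 ie => // ->.
  have m8 : m = 8%N by rewrite mE e3.
  have {}cE : M 1 0 = 4 * c1 by rewrite cE.
  have N8 : N%:Z = 8 * N'%:Z by rewrite NE m8.
  have FN tau : upper tau -> F (tau + (N'%:Z)%:~R) = - F tau.
    move=> ut; rewrite /F (slash_translate SM) //.
      rewrite (@chi_two_half _ (M 0 0 * c1)) ?mulN1r //; last by rewrite abszM oddM oa.
      by rewrite cE m8 PoszM /=; ring.
    by apply/dvdzP; exists (2 * c1 ^+ 2); rewrite cE N8; ring.
  set sg := chi (1 + 2 * M 0 0 * c1 * N'%:Z).
  have sg2 : (sg%:~R : C) * sg%:~R = 1.
    rewrite -rmorphM /=; suff -> : sg * sg = 1 by [].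
    rewrite /sg (chi_two); last first.
      by apply/eqP; rewrite eqz_mod_dvd addrAC subrr add0r dvdz_mull.
    have := two_vals T (n := 1 + 2 * M 0 0 * c1 * N'%:Z).
    have -> : odd `|(1 + 2 * M 0 0 * c1 * N'%:Z)%R|%N.
      by rewrite addrC -!mulrA odd_double_add.
    by rewrite !inE => /(_ isT) /orP[]/eqP ->.
  pose sh (tau : C) := (2%:R * tau + (N'%:Z)%:~R) / 2%:R.
  have ush tau : upper tau -> upper (sh tau) by apply: upper_affine.
  have GS tau : upper tau -> G (sh tau) = sg%:~R * F tau.
    move=> ut; have dM : \det M = 1 by [].
    have [w hw] : exists w : int, 2 * w = M 0 0 ^+ 2 * N'%:Z + 1.
      have [|t ht] := @odd_add_odd (M 0 0 ^+ 2 * N'%:Z) 1 _ isT; last by exists t.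
      by rewrite abszM oddM abszX oddX oa (two_odd T).
    rewrite det_mx22 in dM.
    pose H := mx2 (1 - 2 * M 0 0 * c1 * N'%:Z - 4 * c1 ^+ 2 * N'%:Z)
      (w + M 0 0 * c1 * N'%:Z) (- (c1 ^+ 2 * N%:Z)) (1 + 2 * M 0 0 * c1 * N'%:Z).
    have GH : Gamma0 N H.
      split; last by rewrite mx2E rpredN dvdz_mull.
      rewrite /SL2Z det_mx22 !mx2E N8.
      have -> : forall x y z : int,
          (1 - 2 * x * y * z - 4 * y ^+ 2 * z) * (1 + 2 * x * y * z) -
          (w + x * y * z) * - (y ^+ 2 * (8 * z)) =
          1 + 4 * y ^+ 2 * z * (2 * w - (x ^+ 2 * z + 1)) by move=> x y z; ring.
      by rewrite hw subrr mulr0 addr0.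
    have HE : H *m (4 *: M) = mx2 2 1 0 2 *m M *m mx2 2 N'%:Z 0 2.
      have ME : M = mx2 (M 0 0) (M 0 1) (4 * c1) (M 1 1).
        by apply: mx2P; rewrite !mx2E.
      by rewrite ME /H N8; apply: half_shift_conj; rewrite ?mx2E // -cE.
    have d4 : 0 < \det (4 *: M) by rewrite detZ SM mulr1.
    have dB : \det (mx2 2 1 0 2 *m M) = 4 by rewrite det_shift_mul.
    have E1 := @slash_Gamma0_mul H (4 *: M) tau GH d4 ut.
    rewrite HE slash_mul ?slash_upper ?slash_scalar // in E1; last first.
      by rewrite det_mx22 !mx2E mulr0 subr0.
    rewrite mx2E -/sg -/(F tau) in E1.
    have -> : sg%:~R * F tau = 4%:~R ^ k * (sg%:~R * (4%:~R ^ (- k) * F tau)).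
      rewrite [RHS]mulrCA (mulrA (4%:~R ^ k)) -expfzDr ?intr_eq0 // subrr.
      by rewrite expr0z mul1r.
    rewrite -E1 /G -[4%:~R]/((2 * 2)%:~R) rmorphM expfzMl /=.
    rewrite -[2%:~R]/(2%:R) -mulrA (mulrA (2%:R ^ k) (2%:R ^ (- k))) -expfzDr //.
    by rewrite subrr expr0z mul1r.
  have HK' : has_exp (fun tau => F (sh tau) - G (sh tau)) Q.
    apply: (@has_exp_affine _ 2 2 N' _ Q Q isT isT _ HK) => l.
    by rewrite divff // mul1r.
  have := has_expZ (2%:R^-1) (has_expB HK (has_expZ sg%:~R HK')).
  apply: has_exp_ext => tau ut.
  (* With sig = tau - N'/2: G(tau) = sg F(sig), F(sh tau) = F(sig + N') = -F(sig) and G(sh tau) = sg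
     F(tau), so the terms in F(sig) cancel and 2 F(tau) remains. *)
  pose sig : C := (2%:R * tau + (- N'%:Z)%:~R) / 2%:R.
  have us : upper sig by apply: upper_affine.
  have e1 : sh sig = tau by rewrite /sh /sig rmorphN; field.
  have e2 : sh tau = sig + (N'%:Z)%:~R by rewrite /sh /sig rmorphN; field.
  rewrite (GS tau ut) -{2}e1 (GS sig us) e2 (FN sig us).
  have -> : F tau - sg%:~R * F sig - sg%:~R * (- F sig - sg%:~R * F tau) =
     F tau + (sg%:~R * sg%:~R) * F tau by ring.
  by rewrite sg2; field.
- by exfalso; clear -e23 ie; case: e23 ie => ->.
Qed.

End Two.
End Descent.

(** * Behaviour at the cusps *)

Section Cusps.
Variables (R : realType) (D : discForm) (s : disc_shape) (N : nat) (k : int).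
Variable f : R[i] -> R[i].
Local Notation C := R[i].
Hypotheses (hshape : has_shape D s) (hcard : #|D| = N) (N_gt0 : (0 < N)%N).
Hypothesis hf : Aeps N k s f.
Implicit Types (M : 'M[int]_2) (tau : C) (P Q : rat -> Prop).

(** Common form of the odd and the even step. By N | c L, translation by L fixes f|M; that p^(j+1)
    does not divide L is played off in [holo_other_cusps] against the division of exponents by
    p^(2j). *)
Lemma descend (p : nat) M : prime p -> (p %| N)%N -> SL2Z M ->
  ~~ ((N`_p)%N%:Z %| (M 1 0)%R)%Z ->
  exists j L : nat, [/\ ((N`_p)%N%:Z %| (p%:Z ^+ j * M 1 0)%R)%Z,
    (N%:Z %| (M 1 0)%R * L%:Z)%Z, (0 < j)%N, ~~ (p ^ j.+1 %| L)%N &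
   forall P Q,
    (forall M', SL2Z M' -> M' 1 0 = p%:Z ^+ j * M 1 0 ->
       has_exp (slash k f M') P) ->
    (forall l, P l -> Q (l / (p%:R ^+ j) ^+ 2)) -> has_exp (slash k f M) Q].
Proof.
move=> pp pN SM; have [p2|op] := even_prime pp.
  move: pN; rewrite p2 => /(even_part hshape hcard) [m [N' T]].
  have mE : (N`_2)%N = m.
    have [e mE] : exists e, m = (2 ^ e)%N.
      by have [n0 [n1 [_ [[-> _]|[-> _]] _]]] := two_bad T; [exists 2%N|exists 3%N].
    have m0 : (0 < m)%N by rewrite mE expn_gt0.
    have N'0 : (0 < N')%N by case: (N') (two_odd T).
    have oN' : (N'`_2 = 1)%N by apply: part_p'nat; rewrite -odd_2'nat (two_odd T).
    have mm : (m`_2 = m)%N.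
      by apply: part_pnat_id; rewrite mE pnatX pnat_id.
    by rewrite (two_N T) partnM // oN' mm muln1.
  rewrite mE => mc; have [j [j0 mj NL H]] := descend_two hshape hcard N_gt0 hf T SM mc.
  exists j, (2 ^ j * N')%N; split=> //.
  rewrite expnSr dvdn_pmul2l ?expn_gt0 // dvdn2.
  by rewrite (two_odd T).
have [lN _] := odd_part hshape hcard pp op pN.
rewrite p_part lN expn1 => pc; exists 1%N, N; rewrite expr1; split=> //.
- exact: dvdz_mulr.
- exact: dvdz_mull.
- by rewrite pfactor_dvdn // lN.
- move=> P Q HM PQ; exact: (descend_odd hshape hcard hf pp op pN SM pc HM PQ).
Qed.

Lemma exists_bad_prime (c : int) : ~~ (N%:Z %| c)%Z ->
  exists p : nat, [/\ prime p, (p %| N)%N & ~~ ((N`_p)%N%:Z %| c)%Z].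
Proof.
move=> Nc; apply: contrapT => H; case/negP: Nc; rewrite dvdzE /=.
apply/(dvdn_partP _ N_gt0) => p pN; apply: contrapT => /negP h; apply: H.
move: pN; rewrite -[p \in _]/(p \in primes N) mem_primes => /and3P[pp _ pN].
by exists p; split.
Qed.

(** Induction on N - gcd(N, c), since a descent enlarges gcd(N, c). As the p0-part of N divides c
    throughout, no descent at p0 occurs, and P has to be stable only for the other primes. *)
Lemma cusp_exp (p0 : nat) P : has_exp f P ->
  (forall (p j : nat) l, prime p -> p != p0 -> P l ->
     P (l / (p%:R ^+ j) ^+ 2)) ->
  forall M, SL2Z M -> ((N`_p0)%N%:Z %| (M 1 0)%R)%Z -> has_exp (slash k f M) P.
Proof.
move=> Hf HP M.
have [n] := ubnP (N - gcdn N `|(M 1 0)%R|%N)%N; elim: n M => [M|n IH M].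
  by move=> h; exfalso; move: h; rewrite ltn0.
rewrite ltnS => le SM Np0.
have [Nc|Nc] := boolP (N%:Z %| (M 1 0)%R)%Z.
  apply: has_exp_ext (has_expZ (chi_disc N s (M 1 1))%:~R Hf) => tau ut.
  by rewrite (slash_Gamma0 hf).
have [p [pp pN pc]] := exists_bad_prime Nc.
have pp0 : p != p0 by apply: contraNneq pc => ->.
have [j [L [pj NL j0 _ H]]] := descend pp pN SM pc.
apply: (H P P) => [M' SM' cM'|l]; last exact: HP.
apply: (IH M' _ SM'); last by rewrite cM' dvdz_mull.
apply: leq_trans le; apply: ltn_sub2l.
  have : (gcdn N `|(M 1 0)%R|%N %| N)%N by apply: dvdn_gcdl.
  move/(dvdn_leq N_gt0); rewrite leq_eqVlt => /orP[/eqP h|//].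
  by case/negP: Nc; rewrite dvdzE /= -[X in (X %| _)%N]h dvdn_gcdr.
have dv : (gcdn N `|(M 1 0)%R|%N %| gcdn N `|(M' 1 0)%R|%N)%N.
  by rewrite dvdn_gcd dvdn_gcdl cM' abszM dvdn_mull // dvdn_gcdr.
rewrite ltn_neqAle dvdn_leq ?gcdn_gt0 ?N_gt0 // andbT.
apply/negP => /eqP h; case/negP: pc; rewrite dvdzE /=.
apply: dvdn_trans (dvdn_gcdr N _); rewrite h dvdn_gcd dvdn_part /=.
by rewrite cM'; exact: pj.
Qed.

Lemma holo_at_exp M : holo_at k f M <-> has_exp (slash k f M) (fun l => 0 <= l).
Proof.
split=> [[h [a [qa an]]]|/has_exp_qexp [h [a [h0 qa Ha]]]].
  apply: (qexp_has_exp qa) => n an0; rewrite divr_ge0 // ?ler0z.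
  by rewrite leNgt; apply: contra an0 => /an ->.
exists h, a; split; first exact: qa.
move=> n n0; apply/eqP/negPn/negP => /Ha.
by rewrite pmulr_lge0 ?invr_gt0 ?ltr0n // ler0z leNgt n0.
Qed.

Lemma vanish_at_exp M : vanish_at k f M <-> has_exp (slash k f M) (fun l => 0 < l).
Proof.
split=> [[h [a [qa an]]]|/has_exp_qexp [h [a [h0 qa Ha]]]].
  have [h0 _] := qa.
  apply: (qexp_has_exp qa) => n an0; rewrite divr_gt0 ?ltr0n // ltr0z.
  by rewrite ltNge; apply: contra an0 => /an ->.
exists h, a; split; first exact: qa.
move=> n n0; apply/eqP/negPn/negP => /Ha.
by rewrite pmulr_lgt0 ?invr_gt0 ?ltr0n // ltr0z ltNge n0.
Qed.

Lemma exp_all_cusps P : has_exp (slash k f 1%:M) P ->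
  (forall (p j : nat) l, prime p -> P l -> P (l / (p%:R ^+ j) ^+ 2)) ->
  forall M, SL2Z M -> has_exp (slash k f M) P.
Proof.
move=> Hf HP M SM; apply: (@cusp_exp 0 P _ _ M SM).
- by apply: has_exp_ext Hf => tau _; rewrite slash1.
- by move=> p j l pp _; apply: HP.
(* [N`_0 = 1], so [p0 = 0] imposes no condition on [M]. *)
- by rewrite p_part lognE /= expn0 dvd1z.
Qed.

Lemma holo_all_cusps : holo_at k f 1%:M -> Meps N k s f.
Proof.
move=> /holo_at_exp H; have [Hw _] := hf; split;
  [split; [exact: Hw|move=> M SM]|exact: hf].
apply/holo_at_exp; apply: (exp_all_cusps H _ SM) => p j l pp l0.
by rewrite divr_ge0 // exprn_ge0 // exprn_ge0.
Qed.

Lemma vanish_all_cusps : vanish_at k f 1%:M -> Seps N k s f.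
Proof.
move=> /vanish_at_exp H; have [Hw _] := hf; split;
  [split; [exact: Hw|move=> M SM]|exact: hf].
apply/vanish_at_exp; apply: (exp_all_cusps H _ SM) => p j l pp l0.
by rewrite divr_gt0 // exprn_gt0 // exprn_gt0 // ltr0n prime_gt0.
Qed.

Lemma not_cusp_infty M : SL2Z M -> ~ cusp_infty N M -> ~~ (N%:Z %| (M 1 0)%R)%Z.
Proof.
move=> SM nc; apply/negP => Nc; apply: nc.
exists (mx2 (M 1 1) (- M 0 1) (- M 1 0) (M 0 0)).
  split; last by rewrite mx2E rpredN.
  by rewrite /SL2Z -SM !det_mx22 !mx2E; ring.
by rewrite mulmx2 !mx2E; ring.
Qed.

Lemma holo_other_cusps (d : nat) : (0 < d)%N -> coprime d N ->
  simple_principal_part f d ->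
  forall M, SL2Z M -> ~ cusp_infty N M -> holo_at k f M.
Proof.
move=> d0 cd [a [qa _ an]] M SM /(not_cusp_infty SM) Nc.
have [p [pp pN pc]] := exists_bad_prime Nc.
have [j [L [pj NL j0 pL H]]] := descend pp pN SM pc.
have pd : ~~ (p %| d)%N.
  apply/negP => pd; have : (p %| gcdn d N)%N by rewrite dvdn_gcd pd.
  by rewrite (eqP cd) dvdn1; case: eqP pp => // ->.
(* The number w collects the primes other than p met during the descent; the one step at p is
   recorded separately in [Q]. *)
pose P l := 0 <= l \/ exists w : nat, ~~ (p %| w)%N /\ l = - d%:R / w%:R ^+ 2 :> rat.
pose Q l := 0 <= l \/ exists w : nat, ~~ (p %| w)%N /\
  l = - d%:R / w%:R ^+ 2 / (p%:R ^+ j) ^+ 2 :> rat.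
have Hf : has_exp f P.
  apply: (qexp_has_exp qa) => n an0; rewrite divr1.
  have [n0|n0] := leP 0 n; first by left; rewrite ler0z.
  right; exists 1%N; rewrite dvdn1; split; first by case: eqP pp => // ->.
  have -> : n = - d%:Z by apply/eqP; apply: contraNT an0 => nd; rewrite an.
  by rewrite rmorphN /= expr1n divr1.
have HQ : has_exp (slash k f M) Q.
  apply: (H P Q) => [M' SM' cM'|l [l0|[w [pw ->]]]].
  - apply: (cusp_exp (p0 := p) Hf _ SM'); last by rewrite cM'.
    move=> p' j' l pp' p'p [l0|[w [pw ->]]].
      by left; rewrite divr_ge0 // exprn_ge0 // exprn_ge0.
    right; exists (w * p' ^ j')%N; split.
      rewrite Euclid_dvdM // negb_or pw /= Euclid_dvdX // negb_and.
      by rewrite dvdn_prime2 // eq_sym p'p.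
    by rewrite natrM natrX exprMn [in RHS]invfM mulrA.
  - by left; rewrite divr_ge0 // exprn_ge0 // exprn_ge0.
  - by right; exists w.
have per tau : upper tau -> slash k f M (tau + (L%:Z)%:~R) = slash k f M tau.
  move=> ut; rewrite (slash_translate hf SM) //; last by rewrite expr2 -mulrA dvdz_mull.
  rewrite (chi_disc_one hshape hcard) ?mul1r //; apply/eqP.
  by rewrite eqz_mod_dvd addrAC subrr add0r -mulrA dvdz_mull.
apply/holo_at_exp; apply: has_expW (has_exp_periodic per HQ) => l.
case=> -[//|[w [pw ->]]] /intrP [z hz]; exfalso.
have w0 : (w%:R : rat) != 0 by rewrite pnatr_eq0; apply: contraNneq pw => ->.
have pj0 : (p%:R ^+ j : rat) != 0 by rewrite expf_neq0 // pnatr_eq0 -lt0n prime_gt0.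
have : - (L%:Z * d%:Z) = z * (w ^ 2 * (p ^ j) ^ 2)%N%:Z.
  apply/eqP; rewrite -(eqr_int rat) rmorphN !rmorphM /= -hz.
  rewrite -!pmulrn.
  by rewrite natrX; apply/eqP; field; rewrite w0 pj0.
move/(congr1 absz); rewrite abszN !abszM !absz_nat => E.
case/negP: pL.
(* By [E], p^(2j) divides L d, and 2j >= j + 1. As p does not divide d, p^(j+1) would divide L. *)
have : (p ^ j.+1 %| L * d)%N.
  rewrite E; apply: dvdn_mull; apply: dvdn_mull.
  by rewrite -expnM dvdn_exp2l //; lia.
by rewrite Gauss_dvdl // coprimeXl // prime_coprime.
Qed.

End Cusps.

(** * Parseval and Schwarz for polynomials and their uniform limits *)

Section NormC.
Variable R : realType.
Local Notation C := R[i].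
Implicit Types (x y z : C).

Lemma normc_ge0 x : 0 <= normc x.
Proof. by case: x => a b; apply: sqrtr_ge0. Qed.

Lemma normc_add x y : normc (x + y) <= normc x + normc y.
Proof. exact: le_normcD. Qed.

Lemma normc_opp x : normc (- x) = normc x.
Proof. exact: normcN. Qed.

Lemma normc_sub x y : normc (x - y) <= normc x + normc y.
Proof. by rewrite -(normc_opp y); apply: normc_add. Qed.

Lemma normc_exp x n : normc (x ^+ n) = normc x ^+ n.
Proof. by elim: n => [|n IH]; rewrite ?normc1 // !exprS normcM IH. Qed.

Lemma normc_real (t : R) : normc t%:C = `|t|.
Proof. by rewrite /normc /= expr0n addr0 sqrtr_sqr. Qed.

Lemma normc_sum (I : Type) (r : seq I) (P : pred I) (F : I -> C) :
  normc (\sum_(i <- r | P i) F i) <= \sum_(i <- r | P i) normc (F i).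
Proof.
elim/big_ind2: _ => [|x a y b ha hb|//]; first by rewrite normc0.
by apply: le_trans (normc_add _ _) _; apply: lerD.
Qed.

Lemma normc_sqrE x : ((normc x) ^+ 2)%:C = x * conjc x.
Proof. by rewrite -sqr_normc rmorphXn. Qed.

Lemma conjc_e2_real (t : R) : conjc (e2 t%:C) = e2 (- t%:C).
Proof.
rewrite /e2 /cexp /=; apply/eqP; rewrite eq_complex /=.
rewrite !(mul0r, mulr0, subr0, addr0, oppr0, mulrN, cosN, sinN, add0r).
by rewrite !eqxx.
Qed.

(** Average |p|^2 over the m points rho e(b/m), where m is the size of p: the indices of two
    coefficients differ by less than m, so orthogonality removes all mixed terms exactly. *)
Lemma parseval (p : {poly C}) (rho K : R) : 0 <= rho ->
  (forall t : R, normc p.[rho%:C * e2 t%:C] <= K) ->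
  \sum_(i < size p) normc p`_i ^+ 2 * rho ^+ (2 * i) <= K ^+ 2.
Proof.
move=> r0 Hp; set m := size p.
have [->|p0] := eqVneq m 0%N; first by rewrite big_ord0 sqr_ge0.
have m0 : (0 < m)%N by rewrite lt0n.
have mR : (m%:R : R) != 0 by rewrite pnatr_eq0.
have K0 : 0 <= K by apply: le_trans (Hp 0); apply: normc_ge0.
pose z (b : nat) : C := rho%:C * e2 (b%:R / m%:R : R)%:C.
have E : (\sum_(b < m) (normc p.[z b] ^+ 2))%:C =
    m%:R * (\sum_(i < m) normc p`_i ^+ 2 * rho ^+ (2 * i))%:C :> C.
  rewrite [in LHS]rmorph_sum [in RHS]rmorph_sum /=.
  pose c (i : nat) : C := p`_i * rho%:C ^+ i.
  have pz b : p.[z b] = \sum_(i < m) c i * e2 (i%:R * (b%:R / m%:R)).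
    rewrite horner_coef; apply: eq_bigr => i _; rewrite /c /z exprMn -e2Mn -[RHS]mulrA.
    by congr (_ * (_ * e2 (_ * _))); rewrite rmorphM fmorphV !rmorph_nat.
  have cz b : conjc p.[z b] = \sum_(j < m) conjc (c j) * e2 (- (j%:R * (b%:R / m%:R))).
    rewrite pz rmorph_sum; apply: eq_bigr => j _; rewrite rmorphM; congr (_ * _).
    have -> : j%:R * (b%:R / m%:R) = (j%:R * (b%:R / m%:R) : R)%:C.
      by rewrite !rmorphM fmorphV !rmorph_nat.
    exact: conjc_e2_real.
  transitivity (\sum_(b < m) \sum_(i < m) \sum_(j < m)
     c i * conjc (c j) * e2 ((i%:Z - j%:Z)%:~R * b%:R / m%:R)).
    apply: eq_bigr => b _; rewrite normc_sqrE cz pz mulr_suml; apply: eq_bigr => i _.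
    rewrite mulr_sumr; apply: eq_bigr => j _; rewrite mulrACA -e2D; congr (_ * e2 _).
    by rewrite rmorphB /= -!pmulrn; ring.
  rewrite exchange_big mulr_sumr; apply: eq_bigr => i _; rewrite exchange_big /=.
  under eq_bigr => j _ do rewrite -mulr_sumr sum_e2 //.
  rewrite (bigD1 i) //= subrr dvdz0 big1 ?addr0; last first.
    move=> j ji; case: ifP; rewrite ?mulr0 // => /dvdzP[q hq]; exfalso.
    case/negP: ji; apply/eqP/val_inj => /=.
    have := ltn_ord i; have := ltn_ord j;
      move: (nat_of_ord i) (nat_of_ord j) hq => a b hq ba aa.
    have : q = 0 by nia.
    by move=> q0; move: hq; rewrite q0 mul0r; lia.
  rewrite -normc_sqrE mulrC; congr (_ * _%:C).
  rewrite /c normcM normc_exp normc_real ger0_norm // exprMn -exprM [(i * 2)%N]mulnC.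
  by [].
have : m%:R * (\sum_(i < m) normc p`_i ^+ 2 * rho ^+ (2 * i)) <= m%:R * K ^+ 2.
  have -> : m%:R * (\sum_(i < m) normc p`_i ^+ 2 * rho ^+ (2 * i)) =
     \sum_(b < m) (normc p.[z b] ^+ 2).
    by apply: complexI; rewrite E rmorphM rmorph_nat.
  rewrite mulr_natl -[X in _ *+ X]card_ord -sumr_const; apply: ler_sum => b _.
  by rewrite ler_pXn2r // ?nnegrE ?normc_ge0 //; exact: Hp.
by rewrite ler_pM2l // ltr0n.
Qed.

Lemma coef_bound (p : {poly C}) (rho K : R) n : 0 <= rho ->
  (forall t : R, normc p.[rho%:C * e2 t%:C] <= K) -> normc p`_n * rho ^+ n <= K.
Proof.
move=> r0 Hp; have K0 : 0 <= K by apply: le_trans (Hp 0); apply: normc_ge0.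
have [ps|ps] := leqP (size p) n; first by rewrite nth_default // normc0 mul0r.
have := parseval r0 Hp; rewrite (bigD1 (Ordinal ps)) //= => H.
rewrite -(@ler_pXn2r _ 2) // ?nnegrE ?mulr_ge0 ?normc_ge0 ?exprn_ge0 //.
rewrite exprMn -exprM [(n * 2)%N]mulnC; apply: le_trans H; rewrite lerDl.
by apply: sumr_ge0 => i _; rewrite mulr_ge0 ?sqr_ge0 // exprn_ge0.
Qed.

(** By Bernoulli's inequality the powers of a number above 1 are unbounded. *)
Lemma pow_bounded_le1 (x A : R) : 0 <= x -> (forall j : nat, x ^+ j <= A) -> x <= 1.
Proof.
move=> x0 H; rewrite leNgt; apply/negP => x1.
have B (j : nat) : 1 + j%:R * (x - 1) <= x ^+ j.
  elim: j => [|j IH]; first by rewrite mul0r addr0 expr0.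
  rewrite exprS -natr1; have : 0 <= x * (x ^+ j - (1 + j%:R * (x - 1))).
    by rewrite mulr_ge0 // subr_ge0.
  have : 0 <= j%:R * (x - 1) * (x - 1).
    by rewrite !mulr_ge0 // subr_ge0 ltW.
  by lra.
have A0 : 0 < A by apply: lt_le_trans (H 0%N); rewrite expr0.
have x10 : 0 < x - 1 by rewrite subr_gt0.
have := archi_boundP (divr_ge0 (ltW A0) (ltW x10)).
set j := Num.bound _ => hj.
have := le_trans (B j) (H j).
by move: hj; rewrite ltr_pdivrMr //; lra.
Qed.

Lemma pow_small (u e : R) : 0 <= u -> u < 1 -> 0 < e -> exists n : nat, u ^+ n < e.
Proof.
move=> u0 u1 e0; apply: contrapT => H.
have {}H n : e <= u ^+ n by rewrite leNgt; apply/negP => h; apply: H; exists n.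
have up : 0 < u by have := H 1%N; rewrite expr1; lra.
have : u^-1 <= 1.
  apply: (@pow_bounded_le1 _ e^-1); first by rewrite invr_ge0.
  by move=> j; rewrite exprVn lef_pV2 ?posrE ?exprn_gt0.
by rewrite invf_le1 //; lra.
Qed.

Lemma geometric_bound (u : R) m n : 0 <= u -> u < 1 ->
  \sum_(m <= j < n) u ^+ j <= u ^+ m / (1 - u).
Proof.
move=> u0 u1; have u1' : 0 < 1 - u by rewrite subr_gt0.
have [nm|mn] := leqP n m.
  by rewrite big_geq // divr_ge0 ?exprn_ge0 // ltW.
rewrite ler_pdivlMr // -(subnKC (ltnW mn)); elim: (n - m)%N => [|d IH].
  by rewrite addn0 big_geq // mul0r exprn_ge0.
suff : (\sum_(m <= j < m + d.+1) u ^+ j) * (1 - u) = u ^+ m - u ^+ (m + d.+1).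
  by move=> ->; rewrite gerBl exprn_ge0.
elim: d {IH} => [|d IH].
  by rewrite addn1 big_nat1 exprSr; ring.
by rewrite addnS big_nat_recr ?leq_addr //= mulrDl IH !exprSr; ring.
Qed.

(* [c0] is the common value at 0 of the approximating polynomials. *)
Definition approx (T : Type) (dom : T -> Prop) (z g : T -> C) (c0 : C) : Prop :=
  forall e : R, 0 < e -> exists p : {poly C}, p`_0 = c0 /\
    forall x : T, dom x -> normc (g x - p.[z x]) <= e.

End NormC.

Section Approx.
Variables (R : realType) (T : Type).
Local Notation C := R[i].
Variables (dom : T -> Prop) (z : T -> C).
Implicit Types (x : T) (g h : T -> C).

Lemma approx_mul g h c d (B : R) : (forall x, dom x -> normc (g x) <= B) ->
  (forall x, dom x -> normc (h x) <= B) ->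
  approx dom z g c -> approx dom z h d ->
  approx dom z (fun x => g x * h x) (c * d).
Proof.
move=> gB hB Hg Hh e e0.
pose B' := `|B| + 1; have B'0 : 0 < B' by rewrite /B'; have := normr_ge0 B; lra.
have BB : B <= B' by rewrite /B'; have := ler_norm B; lra.
(* As e1 <= 1, the second polynomial is bounded by B' + 1, and the total error is at most e1 (2 B' +
   1) <= 3 B' e1 <= e. *)
pose e1 := Num.min 1 (e / (3 * B')).
have e10 : 0 < e1 by rewrite lt_min ltr01 divr_gt0 // mulr_gt0.
have [p [p0 Hp]] := Hg e1 e10; have [q [q0 Hq]] := Hh e1 e10.
exists (p * q); split; first by rewrite coef0M p0 q0.
move=> x dx; rewrite hornerM.
have -> : g x * h x - p.[z x] * q.[z x] =
    g x * (h x - q.[z x]) + (g x - p.[z x]) * q.[z x] by ring.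
apply: le_trans (normc_add _ _) _; rewrite !normcM.
have hq : normc q.[z x] <= B' + 1.
  have -> : q.[z x] = h x - (h x - q.[z x]) by ring.
  apply: le_trans (normc_sub _ _) _; apply: lerD; first exact: le_trans (hB x dx) BB.
  by apply: le_trans (Hq x dx) _; rewrite ge_min lexx.
have e1e : e1 * (3 * B') <= e.
  by rewrite -ler_pdivlMr ?mulr_gt0 // ge_min lexx orbT.
have H1 : normc (g x) * normc (h x - q.[z x]) <= B' * e1.
  by apply: ler_pM; rewrite ?normc_ge0 ?Hq // (le_trans (gB x dx)).
have H2 : normc (g x - p.[z x]) * normc q.[z x] <= e1 * (B' + 1).
  by apply: ler_pM; rewrite ?normc_ge0 ?Hp.
have B1 : 1 <= B' by rewrite /B'; have := normr_ge0 B; lra.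
have : e1 * 1 <= e1 * B' by rewrite ler_pM2l.
by lra.
Qed.

Lemma approx_cst c : approx dom z (fun=> c) c.
Proof.
move=> e e0; exists c%:P; rewrite coefC eqxx; split=> // x _.
by rewrite hornerC subrr normc0 ltW.
Qed.

Lemma approx_exp g c (B : R) n : 1 <= B -> (forall x, dom x -> normc (g x) <= B) ->
  approx dom z g c -> approx dom z (fun x => g x ^+ n) (c ^+ n).
Proof.
move=> B1 gB Hg; elim: n => [|n IH]; first exact: approx_cst.
have -> : (fun x => g x ^+ n.+1) = (fun x => g x * g x ^+ n).
  by apply/funext => x; rewrite exprS.
rewrite exprS; apply: (@approx_mul _ _ _ _ (B ^+ n.+1)) => // x dx.
  by apply: le_trans (gB x dx) _; rewrite -[X in X <= _]expr1 ler_weXn2l.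
rewrite normc_exp; apply: (@le_trans _ _ (B ^+ n)); last by rewrite ler_weXn2l.
by rewrite lerXn2r ?nnegrE ?normc_ge0 ?gB // (le_trans ler01).
Qed.

Lemma approx_subc g c d : approx dom z g c -> approx dom z (fun x => g x - d) (c - d).
Proof.
move=> Hg e e0; have [p [p0 Hp]] := Hg e e0; exists (p - d%:P).
rewrite coefB coefC eqxx p0; split=> // x dx; rewrite hornerD hornerN hornerC.
have -> : g x - d - (p.[z x] - d) = g x - p.[z x] by ring.
exact: Hp.
Qed.

End Approx.

Section Schwarz.
Variable R : realType.
Local Notation C := R[i].

(* The coefficients of p^j vanish below j and are bounded by [coef_bound]; take j-th
   roots of the resulting bound for |p(z)|^j and let j tend to infinity. *)
Lemma poly_schwarz (p : {poly C}) (rho K : R) (z : C) : 0 < rho -> p`_0 = 0 ->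
  (forall t : R, normc p.[rho%:C * e2 t%:C] <= K) -> normc z < rho ->
  normc p.[z] <= K * (normc z / rho).
Proof.
move=> r0 p0 Hp zr; set u := normc z / rho.
have u0 : 0 <= u by rewrite divr_ge0 ?normc_ge0 // ltW.
have u1 : u < 1 by rewrite ltr_pdivrMr // mul1r.
have K0 : 0 <= K by apply: le_trans (Hp 0); apply: normc_ge0.
have [q pq] : exists q, p = 'X * q.
  have /factor_theorem[q ->] : root p 0 by rewrite /root horner_coef0 p0.
  by exists q; rewrite subr0 mulrC.
have powj (j : nat) : normc p.[z] ^+ j <= (K * u) ^+ j * (1 - u)^-1.
  have cj i : (i < j)%N -> (p ^+ j)`_i = 0 by move=> ij; rewrite pq exprMn coefXnM ij.
  rewrite -normc_exp -horner_exp horner_coef.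
  apply: le_trans (normc_sum _ _ _) _.
  apply: (@le_trans _ _ (\sum_(i < size (p ^+ j) | (j <= i)%N) K ^+ j * u ^+ i)).
    rewrite [X in _ <= X]big_mkcond /=; apply: ler_sum => i _.
    rewrite normcM normc_exp; case: leqP => [ji|ij]; last first.
      by rewrite cj // normc0 mul0r.
    have : normc (p ^+ j)`_i * rho ^+ i <= K ^+ j.
      apply: coef_bound (ltW r0) _ => t; rewrite horner_exp normc_exp.
      by rewrite lerXn2r ?nnegrE ?normc_ge0.
    move=> h; rewrite /u expr_div_n [normc z ^+ i / _]mulrC mulrA.
    by rewrite ler_wpM2r ?exprn_ge0 ?normc_ge0 // ler_pdivlMr // exprn_gt0.
  rewrite -mulr_sumr exprMn -mulrA ler_wpM2l ?exprn_ge0 //.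
  apply: le_trans (geometric_bound j (size (p ^+ j)) u0 u1).
  by rewrite big_geq_mkord.
have [Ku|Ku] := eqVneq (K * u) 0.
  have := powj 1%N; rewrite Ku !expr1 mul0r //.
have Ku0 : 0 < K * u by rewrite lt_neqAle eq_sym Ku mulr_ge0.
have : normc p.[z] / (K * u) <= 1.
  apply: (@pow_bounded_le1 _ _ (1 - u)^-1); first by rewrite divr_ge0 ?normc_ge0 // ltW.
  move=> j; rewrite expr_div_n ler_pdivrMr ?exprn_gt0 // mulrC; exact: powj.
by rewrite ler_pdivrMr // mul1r.
Qed.

Lemma approx_schwarz (T : Type) (dom : T -> Prop) (z g : T -> C) (rho K : R) (x : T) :
  0 < rho -> (forall y, dom y -> normc (g y) <= K) ->
  (forall t : R, exists2 y, dom y & z y = rho%:C * e2 t%:C) ->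
  approx dom z g 0 -> dom x -> normc (z x) < rho ->
  normc (g x) <= K * (normc (z x) / rho).
Proof.
move=> r0 gK circ Hg dx zx; apply/ler_addgt0Pl => e e0.
have e3 : 0 < e / 3 by rewrite divr_gt0.
have [p [p0 Hp]] := Hg _ e3.
set u := normc (z x) / rho.
have u1 : u < 1 by rewrite ltr_pdivrMr // mul1r.
have u0 : 0 <= u by rewrite divr_ge0 ?normc_ge0 // ltW.
have Hpc (t : R) : normc p.[rho%:C * e2 t%:C] <= K + e / 3.
  have [y dy <-] := circ t.
  have -> : p.[z y] = g y - (g y - p.[z y]) by ring.
  by apply: le_trans (normc_sub _ _) _; apply: lerD; [apply: gK|apply: Hp].
have := poly_schwarz r0 p0 Hpc zx; rewrite -/u => H.
have -> : g x = p.[z x] + (g x - p.[z x]) by ring.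
apply: le_trans (normc_add _ _) _.
have := Hp x dx; have : e / 3 * u <= e / 3 by rewrite ler_piMr // ltW.
by move: H; rewrite mulrDl; lra.
Qed.

(* Schwarz's lemma for g^j - c0^j, with j so large that eta^j is negligible. *)
Lemma strict_bound (eta u : R) : 0 <= eta -> eta < 1 -> 0 <= u -> u < 1 ->
  exists2 theta : R, 0 < theta < 1 &
  forall (T : Type) (dom : T -> Prop) (z g : T -> C) (c0 : C) (rho K : R) (x : T),
  0 < rho -> 0 < K -> (forall y, dom y -> normc (g y) <= K) ->
  (forall t : R, exists2 y, dom y & z y = rho%:C * e2 t%:C) ->
  approx dom z g c0 -> normc c0 <= eta * K -> dom x -> normc (z x) <= u * rho ->
  normc (g x) <= theta * K.
Proof.
move=> eta0 eta1 u0 u1.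
have [j0 hj0] : exists j, eta ^+ j < (1 - u) / 4.
  by apply: pow_small => //; rewrite divr_gt0 // subr_gt0.
pose j := j0.+1.
have hj : eta ^+ j < (1 - u) / 4.
  by apply: le_lt_trans hj0; rewrite /j exprS ler_piMl ?exprn_ge0 // ltW.
(* Bernoulli gives (1 - kap)^j >= 1 - (1 - u)/4, while the estimate of |g|^j/K^j below is at most u
   + 2 (1 - u)/4. The resulting constant depends on eta and u alone. *)
pose kap := (1 - u) / 4 / j%:R.
have jR : (0 : R) < j%:R by rewrite ltr0n.
have j1 : (1 : R) <= j%:R by rewrite ler1n.
have k0 : 0 < kap by rewrite !divr_gt0 // subr_gt0.
have kj : j%:R * kap = (1 - u) / 4 by rewrite mulrC divfK ?lt0r_neq0.
have k1 : kap <= (1 - u) / 4 by rewrite -kj ler_peMl // ltW.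
have bern (i : nat) : 1 - i%:R * kap <= (1 - kap) ^+ i.
  elim: i => [|i IH]; first by rewrite mul0r subr0 expr0.
  rewrite exprS -natr1; have : 0 <= (1 - kap) * ((1 - kap) ^+ i - (1 - i%:R * kap)).
    by rewrite mulr_ge0 ?subr_ge0 //; lra.
  have : 0 <= i%:R * kap * kap.
    by apply: mulr_ge0; [apply: mulr_ge0|]; rewrite ?ler0n ?(ltW k0).
  by lra.
exists (1 - kap); first by lra.
move=> T dom z g c0 rho K x r0 K0 gK circ Hg c0K dx zx.
have zr : normc (z x) < rho by apply: le_lt_trans zx _; rewrite gtr_pMl.
have gK' y : dom y -> normc (g y) <= K + 1 by move/gK; lra.
have K1 : 1 <= K + 1 by lra.
have Hj := approx_subc (c0 ^+ j) (approx_exp j K1 gK' Hg); rewrite subrr in Hj.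
have eK : eta * K <= K by rewrite ler_piMl // ltW.
have c0j : normc c0 ^+ j <= eta ^+ j * K ^+ j.
  by rewrite -exprMn lerXn2r ?nnegrE ?normc_ge0 // mulr_ge0 // ltW.
have Kj0 : 0 < K ^+ j by rewrite exprn_gt0.
have bd y : dom y -> normc (g y ^+ j - c0 ^+ j) <= K ^+ j + eta ^+ j * K ^+ j.
  move=> dy; apply: le_trans (normc_sub _ _) _; rewrite !normc_exp lerD //.
  by rewrite lerXn2r ?nnegrE ?normc_ge0 ?gK // ltW.
have := approx_schwarz r0 bd circ Hj dx zr.
set v := normc (z x) / rho => H.
have vu : v <= u by rewrite ler_pdivrMr.
have v0 : 0 <= v by rewrite divr_ge0 ?normc_ge0 // ltW.
have gx : normc (g x) ^+ j <= (1 - kap) ^+ j * K ^+ j.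
  have -> : normc (g x) ^+ j = normc ((g x ^+ j - c0 ^+ j) + c0 ^+ j).
    by rewrite subrK normc_exp.
  apply: le_trans (normc_add _ _) _; rewrite normc_exp.
  apply: le_trans (lerD H c0j) _.
  have -> : (K ^+ j + eta ^+ j * K ^+ j) * v + eta ^+ j * K ^+ j =
    ((1 + eta ^+ j) * v + eta ^+ j) * K ^+ j by ring.
  rewrite ler_wpM2r ?(ltW Kj0) //; apply: le_trans (bern j); rewrite kj.
  have : (1 + eta ^+ j) * v <= (1 + (1 - u) / 4) * u.
    apply: ler_pM => //; first by rewrite addr_ge0 // exprn_ge0.
    by rewrite lerD2l ltW.
  have : (1 - u) / 4 * u <= (1 - u) / 4 
    by rewrite ler_piMr ?(ltW u1) // divr_ge0 // subr_ge0 (ltW u1).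
  by lra.
rewrite -exprMn in gx.
rewrite -(@ler_pXn2r _ j) // ?nnegrE ?normc_ge0 //.
by rewrite mulr_ge0 ?ltW //; lra.
Qed.

(** Equality case of the maximum principle: Parseval gives |w_0|^2 + |w_n|^2 rho^(2n) <= K^2 up to
    an arbitrarily small error, and |w_0| >= K leaves no room for w_n. *)
Lemma max_constant (T : Type) (dom : T -> Prop) (z g : T -> C) (w : nat -> C)
    (rho K : R) n :
  0 < rho -> (forall y, dom y -> normc (g y) <= K) -> K <= normc (w 0%N) -> (0 < n)%N ->
  (forall t : R, exists2 y, dom y & z y = rho%:C * e2 t%:C) ->
  (forall e : R, 0 < e -> exists2 L, (n < L)%N &
     forall y, dom y -> normc (g y - (\poly_(i < L) w i).[z y]) <= e) ->
  w n = 0.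
Proof.
move=> r0 gK w0 n0 circ Hg; have K0 : 0 <= K.
  by have [y dy _] := circ 0; apply: le_trans (gK y dy); apply: normc_ge0.
apply/eq0_normc/eqP; rewrite eq_le normc_ge0 andbT.
have : normc (w n) ^+ 2 * rho ^+ (2 * n) <= 0; last first.
  by rewrite pmulr_lle0 ?exprn_gt0 // exprn_even_le0 //= => /eqP ->.
apply/ler_addgt0Pl => e e0; rewrite addr0.
(* Chosen so that (K + d)^2 - K^2 <= d (2K + 1) <= e. *)
pose d := Num.min 1 (e / (2 * K + 1)).
have KK : 0 < 2 * K + 1 by lra.
have d0 : 0 < d by rewrite lt_min ltr01 divr_gt0.
have [L nL HL] := Hg d d0; set p := \poly_(i < L) w i in HL.
have pn : p`_n = w n by rewrite coef_poly nL.
have p0 : p`_0 = w 0%N by rewrite coef_poly (leq_trans _ nL).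
have Hpc (t : R) : normc p.[rho%:C * e2 t%:C] <= K + d.
  have [y dy <-] := circ t.
  have -> : p.[z y] = g y - (g y - p.[z y]) by ring.
  by apply: le_trans (normc_sub _ _) _; apply: lerD; [apply: gK|apply: HL].
have := parseval (ltW r0) Hpc => H.
have [sn|sn] := leqP (size p) n.
  have -> : w n = 0 by rewrite -pn nth_default.
  by rewrite normc0 expr0n mul0r ltW.
have s0 : (0 < size p)%N by apply: leq_ltn_trans sn.
move: H; rewrite (bigD1 (Ordinal s0)) //= (bigD1 (Ordinal sn)) //=; last first.
  by apply/eqP => /(congr1 val) /= h; rewrite h in n0.
rewrite p0 pn muln0 expr0 mulr1.
set S := \sum_(_ < _ | _) _; have S0 : 0 <= S.
  by apply: sumr_ge0 => i _; rewrite mulr_ge0 ?sqr_ge0 // exprn_ge0 // ltW.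
have dd : d * d <= d by rewrite ler_piMl ?(ltW d0) // ge_min lexx.
have : d * (2 * K + 1) <= e by rewrite -ler_pdivlMr // ge_min lexx orbT.
set W := _ * rho ^+ _ => h1 h2.
have : W <= (K + d) ^+ 2 - K ^+ 2.
  have : K ^+ 2 <= normc (w 0%N) ^+ 2 by rewrite lerXn2r ?nnegrE ?normc_ge0.
  by lra.
by rewrite sqrrD mulr2n; move: h1 dd; rewrite -expr2; lra.
Qed.

End Schwarz.

(** * Power series in q^(1/h) *)

Section PowerSeries.
Variable R : realType.
Local Notation C := R[i].
Implicit Types (G : C -> C) (tau : C) (w : nat -> C).

Lemma hexp_nonneg G : has_exp G (fun l => 0 <= l) ->
  exists h w, hexp h 0 w G.
Proof.
move=> [h [m [v [[h0 H] Hv]]]]; exists h, (fun i => v (i + m)%N).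
split=> [//|tau ut].
have v0 j : (j < m)%N -> v j = 0.
  move=> jm; apply/eqP/negPn/negP => /Hv.
  by rewrite pmulr_lge0 ?invr_gt0 ?ltr0n // ler0z; lia.
have := H tau ut; set u := (fun j : nat => v j * _) => Hu.
have -> : (fun j : nat => v (j + m)%N * qpow h (j%:Z - 0%:Z) tau : C^o) =
    (fun j => u (j + m)%N).
  by apply/funext => j; rewrite /u PoszD addrK subr0.
suff -> : series (fun j => u (j + m)%N : C^o) =
    (fun n => series (u : nat -> C^o) (n + m)%N) by rewrite cvg_shiftn.
apply/funext => n; rewrite /series /= [RHS](@big_cat_nat _ _ _ m) //=; last lia.
rewrite [X in X + _]big1_seq ?add0r; last first.
  by move=> j /andP[_]; rewrite mem_index_iota /u => /andP[_ jm]; rewrite v0 // mul0r.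
by rewrite -[X in _ = \sum_(X <= _ < _) _]add0n big_addn addnK.
Qed.

Definition zq (h : nat) tau : C := qpow h 1 tau.

Lemma qpow_zq h (i : nat) tau : qpow h (i%:Z - 0%:Z) tau = zq h tau ^+ i.
Proof.
rewrite /zq !qpowE -e2Mn subr0; congr e2.
by rewrite -!pmulrn mul1r mulrA.
Qed.

Lemma normc_zq h tau :
  normc (zq h tau) = expR (- (2 * trigo.pi * (complex.Im tau / h%:R))).
Proof.
rewrite /zq qpowE e2_normc; congr (expR (- (_ * _))).
have -> : (h%:R : C)^-1 = (h%:R^-1 : R)%:C by rewrite fmorphV rmorph_nat.
by case: tau => a b /=; ring.
Qed.

(** Horizontal lines wrap around circles in q^(1/h); this supplies the circle on which the Schwarz
    and Parseval estimates are applied. *)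
Lemma zq_circle h (y t : R) : (0 < h)%N ->
  zq h ((h%:R * t) +i* y) =
    (expR (- (2 * trigo.pi * (y / h%:R))))%:C * e2 t%:C.
Proof.
move=> h0; have hR : (h%:R : R) != 0 by rewrite pnatr_eq0 -lt0n.
have -> : (expR (- (2 * trigo.pi * (y / h%:R))))%:C = e2 ((y / h%:R) *i) :> C.
  rewrite /e2 /cexp /=; apply/eqP; rewrite eq_complex /=.
  rewrite !(mul0r, mulr0, subr0, addr0, mulr1, sub0r, add0r, cos0, sin0).
  by rewrite oppr0 mul0r cos0 sin0 mulr1 mulr0 !eqxx.
rewrite /zq qpowE -e2D; congr e2.
have -> : (h%:R : C)^-1 = (h%:R^-1 : R)%:C by rewrite fmorphV rmorph_nat.
apply/eqP; rewrite eq_complex /=; apply/andP; split; apply/eqP; field; exact: hR.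
Qed.

Lemma cvg_normc (S : nat -> C^o) (l : C^o) : S @ \oo --> l ->
  forall e : R, 0 < e -> exists n0, forall n, (n0 <= n)%N -> normc (l - S n) < e.
Proof.
move=> H e e0; have e0C : (0 : C) < e%:C by rewrite ltcR.
have /cvgrPdist_lt /(_ e%:C e0C) [n0 _ Hn] := H.
exists n0 => n nn; have := Hn n nn; rewrite /= -ltcR; exact.
Qed.

Lemma hexp_partial h w G tau : hexp h 0 w G -> upper tau ->
  forall e : R, 0 < e -> exists n0, forall n, (n0 <= n)%N ->
    normc (G tau - (\poly_(i < n) w i).[zq h tau]) < e.
Proof.
move=> [h0 H] ut e e0; have [n0 Hn] := cvg_normc (H tau ut) e0.
exists n0 => n /Hn; rewrite /series /= horner_poly big_mkord.
by under eq_bigr => i _ do rewrite qpow_zq.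
Qed.

(** Convergence at the single point of height y0/2, where |q^(1/h)| = r, bounds |w_j| r^j by 2 for
    large j. At heights >= y0 one has |q^(1/h)| <= r^2, so the tail is dominated by the geometric
    series of 2 r^j. *)
Lemma hexp_uniform h w G (y0 e : R) : hexp h 0 w G -> 0 < y0 -> 0 < e ->
  exists L0, forall L, (L0 <= L)%N -> forall tau, y0 <= complex.Im tau ->
    normc (G tau - (\poly_(i < L) w i).[zq h tau]) <= e.
Proof.
move=> H y00 e0; have [h0 _] := H.
have hR : (0 : R) < h%:R by rewrite ltr0n.
have hR0 := lt0r_neq0 hR.
have pi0 := trigo.pi_gt0 R.
pose sig : C := 0 +i* (y0 / 2).
have us : upper sig by rewrite /upper /= divr_gt0.
pose r := normc (zq h sig).
have r0 : 0 < r by rewrite /r normc_zq expR_gt0.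
have r1 : r < 1.
  rewrite /r normc_zq expR_lt1 oppr_lt0.
  by apply: mulr_gt0; [apply: mulr_gt0|rewrite /= !divr_gt0].
have r1' : 0 < 1 - r by rewrite subr_gt0.
have [n0 Hn] := hexp_partial H us ltr01.
have wb j : (n0 <= j)%N -> normc (w j) * r ^+ j <= 2.
  move=> nj; rewrite /r -normc_exp -normcM.
  have -> : w j * zq h sig ^+ j = (G sig - (\poly_(i < j) w i).[zq h sig]) -
      (G sig - (\poly_(i < j.+1) w i).[zq h sig]).
    rewrite !horner_poly big_ord_recr /=; ring.
  apply: le_trans (normc_sub _ _) _.
  have := Hn _ nj; have := Hn _ (leqW nj); lra.
have [n1 Hn1] : exists n, r ^+ n < e * (1 - r) / 4.
  by apply: (pow_small (ltW r0) r1); rewrite divr_gt0 // mulr_gt0.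
exists (maxn n0 n1) => L; rewrite geq_max => /andP[n0L n1L] tau yt.
have ut : upper tau by apply: lt_le_trans yt.
have zr : normc (zq h tau) <= r * r.
  rewrite /r !normc_zq -expRD ler_expR /=.
  have -> : - (2 * trigo.pi * (y0 / 2 / h%:R)) + - (2 * trigo.pi * (y0 / 2 / h%:R)) =
     - (2 * trigo.pi * (y0 / h%:R)) by field.
  by rewrite lerN2 ler_pM2l ?mulr_gt0 // ler_pM2r ?invr_gt0.
have e2' : 0 < e / 2 by rewrite divr_gt0.
have [n2 Hn2] := hexp_partial H ut e2'.
pose n := maxn n2 L.
have Ln : (L <= n)%N by rewrite leq_maxr.
have -> : G tau - (\poly_(i < L) w i).[zq h tau] =
  (G tau - (\poly_(i < n) w i).[zq h tau]) +
  ((\poly_(i < n) w i).[zq h tau] - (\poly_(i < L) w i).[zq h tau]) by ring.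
apply: le_trans (normc_add _ _) _.
have := Hn2 n (leq_maxl _ _); set A := normc _ => A2.
suff : normc ((\poly_(i < n) w i).[zq h tau] -
    (\poly_(i < L) w i).[zq h tau]) <= e / 2 by lra.
have -> : (\poly_(i < n) w i).[zq h tau] - (\poly_(i < L) w i).[zq h tau] =
    \sum_(L <= j < n) w j * zq h tau ^+ j.
  rewrite !horner_poly -!(big_mkord xpredT (fun i => w i * zq h tau ^+ i)).
  by rewrite (@big_cat_nat _ _ _ L 0 n) //= addrAC subrr add0r.
apply: le_trans (normc_sum _ _ _) _.
apply: (@le_trans _ _ (\sum_(L <= j < n) 2 * r ^+ j)).
  rewrite big_nat [X in _ <= X]big_nat; apply: ler_sum => j /andP[Lj _].
  rewrite normcM normc_exp.
  apply: (@le_trans _ _ (normc (w j) * (r * r) ^+ j)).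
    by rewrite ler_wpM2l ?normc_ge0 // lerXn2r ?nnegrE ?normc_ge0 // mulr_ge0 // ltW.
  by rewrite exprMn mulrA ler_wpM2r ?exprn_ge0 ?(ltW r0) // wb // (leq_trans n0L).
rewrite -mulr_sumr; have := geometric_bound L n (ltW r0) r1.
have : r ^+ L / (1 - r) <= e / 4.
  rewrite ler_pdivrMr //; apply: (@le_trans _ _ (r ^+ n1)); last by lra.
  by rewrite ler_wiXn2l // ltW.
by lra.
Qed.

End PowerSeries.

(** * Reduction modulo SL2(Z) *)

Section Reduction.
Variable R : realType.
Local Notation C := R[i].
Implicit Types (tau : C) (M : 'M[int]_2).

(** Pigeonhole: the Q + 1 fractional parts of 0, x, ..., Q x fall into Q intervals of length 1/Q. *)
Lemma dirichlet (x : R) (Q : nat) : (0 < Q)%N -> exists (c : nat) (d : int),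
  [/\ (0 < c)%N, (c <= Q)%N & `|c%:R * x + d%:~R| * Q%:R <= 1].
Proof.
move=> Q0; have QR : (0 : R) < Q%:R by rewrite ltr0n.
pose fr (i : nat) : R := i%:R * x - (Num.floor (i%:R * x))%:~R.
have fr01 i : 0 <= fr i /\ fr i < 1.
  have /andP[h1 h2] := floor_itv (i%:R * x); rewrite /fr.
  by move: h2; rewrite rmorphD /=; split; lra.
have box i : (`|Num.floor (Q%:R * fr i)|%N < Q)%N.
  have [f0 f1] := fr01 i; have Qf : 0 <= Q%:R * fr i by rewrite mulr_ge0 // ltW.
  have fl0 : 0 <= Num.floor (Q%:R * fr i) by rewrite floor_ge0.
  rewrite -ltz_nat gez0_abs // -(ltr_int R); apply: le_lt_trans (floor_le _) _.
  by rewrite gtr_pMr.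
pose phi (i : 'I_Q.+1) : 'I_Q := Ordinal (box i).
have [/injectiveP inj|/injectivePn[i [j ij eij]]] := boolP (injectiveb phi).
  by have := leq_card phi inj; rewrite !card_ord ltnn.
wlog lij : i j ij eij / (i < j)%N.
  move=> W; have [|ji|h] := ltngtP i j; first exact: W.
    by apply: (W j i) => //; rewrite eq_sym.
  by case/negP: ij; apply/eqP/val_inj.
exists (j - i)%N, (Num.floor (i%:R * x) - Num.floor (j%:R * x)); split.
- by rewrite subn_gt0.
- by rewrite leq_subLR (leq_trans _ (leq_addl _ _)) // -ltnS.
have e1 : Num.floor (Q%:R * fr i) = Num.floor (Q%:R * fr j).
  have ge0 l : 0 <= Num.floor (Q%:R * fr l).
    by rewrite floor_ge0 mulr_ge0 ?(ltW QR) //; case: (fr01 l).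
  have := congr1 val eij => /= h; rewrite -[LHS]gez0_abs // -[RHS]gez0_abs //.
  by rewrite h.
have -> : (j - i)%N%:R * x + (Num.floor (i%:R * x) - Num.floor (j%:R * x))%:~R =
    fr j - fr i.
  by rewrite /fr natrB ?(ltnW lij) // rmorphB /=; ring.
rewrite -[X in _ * X](ger0_norm (ltW QR)) -normrM mulrBl ler_norml.
have /andP[a1 a2] := floor_itv (Q%:R * fr i).
have /andP[b1 b2] := floor_itv (Q%:R * fr j).
move: a1 a2 b1 b2; rewrite e1 rmorphD /=; set F := _%:~R => a1 a2 b1 b2.
by apply/andP; split; lra.
Qed.

(** Take Q least with Q^2 y >= 1; then Q <= 2 (Q - 1) gives Q^2 y <= 4. Dirichlet's approximation
    yields (c x + d)^2 <= 1/Q^2 <= y and (c y)^2 <= Q^2 y^2 <= 4 y, with sum at most 5 y. Dividing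
    by gcd(c, d) only decreases the norm. *)
Lemma cocycle_small tau : upper tau -> complex.Im tau < 1 ->
  exists c d : int, coprimez c d /\
    normc (c%:~R * tau + d%:~R) ^+ 2 <= 5 * complex.Im tau.
Proof.
case: tau => x y; rewrite /upper /= => y0 y1.
have exQ : exists Q : nat, 1 <= Q%:R ^+ 2 * y.
  have := archi_boundP (ltW (_ : 0 < y^-1)); rewrite invr_gt0 => /(_ y0).
  set Q := Num.bound _ => hQ; exists Q.
  have Q1 : 1 <= Q%:R * y by rewrite -ler_pdivrMr // div1r ltW.
  have Q1' : (1 : R) <= Q%:R.
    apply: le_trans Q1 _; rewrite ler_piMr ?(ltW y1) //.
  rewrite expr2 -mulrA; apply: le_trans Q1 _; rewrite ler_peMl // mulr_ge0 ?(ltW y0) //.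
have := ex_minnP exQ; case=> Q Q1 Qmin.
have Q0 : (0 < Q)%N.
  by rewrite lt0n; apply: contraTneq Q1 => ->; rewrite expr0n mul0r -ltNge ltr01.
have Q2 : (1 < Q)%N.
  rewrite ltnNge; apply/negP => Q1'; have QE : Q = 1%N by apply/eqP;
    rewrite eqn_leq Q1'.
  by move: Q1; rewrite QE expr1n mul1r; lra.
have QR : (0 : R) < Q%:R by rewrite ltr0n.
have Q4 : Q%:R ^+ 2 * y <= 4.
  have : (Q.-1)%:R ^+ 2 * y < 1.
    by rewrite ltNge; apply/negP => /Qmin; rewrite leqNgt prednK // leqnn.
  have : (Q%:R : R) <= 2 * (Q.-1)%:R by rewrite -natrM ler_nat; lia.
  move=> h h'; have : Q%:R ^+ 2 <= (2 * Q.-1%:R) ^+ 2 :> R.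
    by rewrite lerXn2r ?nnegrE // mulr_ge0.
  by move/(ler_wpM2r (ltW y0)); rewrite exprMn; lra.
have [c [d [c0 cQ hcd]]] := dirichlet x Q0.
pose g := gcdz c d.
have /dvdzP[c' ec] : (g %| c%:Z)%Z by apply: dvdz_gcdl.
have /dvdzP[d' ed] : (g %| d)%Z by apply: dvdz_gcdr.
have g0 : g != 0 by rewrite gcdz_eq0 negb_and eqz_nat -lt0n c0.
exists c', d'; split.
  rewrite /coprimez; apply/eqP; apply: (mulIf g0).
  by have := mulz_gcdl c' d' g; rewrite -ec -ed -/g gez0_abs // mul1r.
have g1 : (1 : R) <= g%:~R ^+ 2.
  rewrite -rmorphXn /= ler1z -gtz0_ge1 lt_neqAle eq_sym sqrf_eq0 g0 sqr_ge0 //.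
have nE (u v : int) : normc (u%:~R * (x +i* y) + v%:~R : C) ^+ 2 =
    (u%:~R * x + v%:~R) ^+ 2 + (u%:~R * y) ^+ 2.
  have -> : (u%:~R : C) = (u%:~R : R)%:C by rewrite rmorph_int.
  have -> : (v%:~R : C) = (v%:~R : R)%:C by rewrite rmorph_int.
  rewrite /normc /= sqr_sqrtr ?addr_ge0 ?sqr_ge0 //.
  by rewrite !(mul0r, addr0, subr0).
have big : normc (c%:~R * (x +i* y) + d%:~R : C) ^+ 2 <= 5 * y.
  rewrite nE -pmulrn.
  have H1 : (c%:R * x + d%:~R) ^+ 2 <= y.
    rewrite -[X in X <= _]ger0_norm ?sqr_ge0 // normrX.
    rewrite -(ler_pM2r (_ : 0 < Q%:R ^+ 2)) ?exprn_gt0 // -exprMn.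
    apply: (@le_trans _ _ 1); last by rewrite mulrC.
    by rewrite exprn_ile1 // mulr_ge0 // ltW.
  have H2 : (c%:R * y) ^+ 2 <= 4 * y.
    rewrite exprMn [y ^+ 2]expr2 mulrA ler_pM2r //; apply: le_trans Q4.
    rewrite ler_pM2r // lerXn2r ?nnegrE // ler_nat //.
  by lra.
apply: le_trans big; rewrite !nE ec ed !rmorphM /=.
have -> : (c'%:~R * g%:~R * x + d'%:~R * g%:~R) ^+ 2 + (c'%:~R * g%:~R * y) ^+ 2 =
   g%:~R ^+ 2 * ((c'%:~R * x + d'%:~R) ^+ 2 + (c'%:~R * y) ^+ 2) :> R by ring.
by rewrite ler_peMl // addr_ge0 // sqr_ge0.
Qed.

(** Coarse substitute for the fundamental domain: a matrix with lower row (c, d) from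
    [cocycle_small] maps tau to height y/|c tau + d|^2 >= 1/5. *)
Lemma reduction tau : upper tau -> exists M sig,
  [/\ SL2Z M, 1 / 5 <= complex.Im sig & tau = moebius M sig].
Proof.
move=> ut; have [y1|y1] := leP 1 (complex.Im tau).
  exists 1%:M, tau; split; [exact: det1|lra|].
  by rewrite /moebius /cocycle !mxE /= mul0r add0r mul1r addr0 divr1.
have [c [d [cd hcd]]] := cocycle_small ut y1.
have [u [v uv]] := Bezoutz c d; rewrite (eqP cd) in uv.
pose A := mx2 v (- u) c d.
have SA : \det A = 1 by rewrite det_mx22 !mx2E -uv; ring.
have dA : \det A != 0 by rewrite SA.
exists (mx2 d u (- c) v), (moebius A tau); split.
- by rewrite /SL2Z det_mx22 !mx2E -uv; ring.
- rewrite im_moebius // SA mul1r.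
  have nz := cocycle_neq0 dA ut.
  have n0 : 0 < normc (cocycle A tau) ^+ 2.
    rewrite exprn_gt0 // lt_neqAle eq_sym normc_ge0 andbT.
    by apply: contra nz => /eqP/eq0_normc ->.
  rewrite ler_pdivlMr // /cocycle !mx2E; lra.
- rewrite -moebius_mul //.
  have -> : mx2 d u (- c) v *m A = 1%:M.
    apply: mx2P; rewrite mulmx2 !mx2E ?mxE /=.
    + by rewrite -uv; ring.
    + by ring.
    + by ring.
    + by rewrite -uv; ring.
  by rewrite /moebius /cocycle !mxE /= mul0r add0r mul1r addr0 divr1.
Qed.

(** SL2(Z) has finitely many residue matrices mod N. Fix one representative of each and add up their
    bounds; monotonicity makes the sum valid for every representative. *)
Lemma finite_cusps (N : nat) (Pr : 'M[int]_2 -> R -> Prop) : (0 < N)%N ->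
  (forall M, SL2Z M -> exists2 b, 0 <= b & Pr M b) ->
  (forall M b b', b <= b' -> Pr M b -> Pr M b') ->
  exists2 b, 0 <= b & forall M, SL2Z M -> exists M',
    [/\ SL2Z M', forall i j, (M i j = M' i j %[mod N])%Z & Pr M' b].
Proof.
move=> N0 HPr mono.
have rbd (x : int) : (`|(x %% N)%Z|%N < N)%N.
  have NZ : N%:Z != 0 by rewrite eqz_nat -lt0n.
  by rewrite -ltz_nat gez0_abs ?modz_ge0 // ltz_pmod.
pose res (x : int) : 'I_N := Ordinal (rbd x).
have resE x y : res x = res y -> (x = y %[mod N])%Z.
  have NZ : N%:Z != 0 by rewrite eqz_nat -lt0n.
  by move/(congr1 val) => /= h;
    rewrite -[LHS]gez0_abs ?modz_ge0 // h gez0_abs ?modz_ge0.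
pose T := {ffun 'I_2 * 'I_2 -> 'I_N}.
pose rs M : T := [ffun ij => res (M ij.1 ij.2)].
have H (t : T) : exists b : R, 0 <= b /\
    ((exists M, SL2Z M /\ rs M = t) -> exists M, [/\ SL2Z M, rs M = t & Pr M b]).
  have [[M [SM Mt]]|no] := pselect (exists M, SL2Z M /\ rs M = t).
    by have [b b0 Pb] := HPr M SM; exists b; split=> // _; exists M.
  by exists 0; split=> // /no.
have [bb Hbb] := choice H.
exists (\sum_t bb t); first by apply: sumr_ge0 => t _; case: (Hbb t).
move=> M SM; have [_ /(_ (ex_intro _ M (conj SM erefl)))[M' [SM' e PM']]] := Hbb (rs M).
exists M'; split=> // [i j|].
  by apply/esym/resE; have := congr1 (fun g : T => g (i, j)) e; rewrite !ffunE.
apply: mono PM'; rewrite (bigD1 (rs M)) //= lerDl.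
by apply: sumr_ge0 => t _; case: (Hbb t).
Qed.

End Reduction.

(** * Nontriviality of the character *)

Section DirichletCharacter.
Variables (D : discForm) (s : disc_shape) (N : nat).
Hypotheses (hshape : has_shape D s) (hcard : #|D| = N) (hN : (1 < N)%N).

Lemma Gamma0_lower_right (d : int) : coprimez N%:Z d ->
  exists2 M, Gamma0 N M & M 1 1 = d.
Proof.
move=> cop; have [u [v uv]] := Bezoutz N%:Z d; rewrite (eqP cop) in uv.
exists (mx2 v (- u) N%:Z d); last by rewrite mx2E.
split; last by rewrite mx2E.
by rewrite /SL2Z det_mx22 !mx2E -uv; ring.
Qed.

(** For even N take d = 1 + (m/2) N'. For odd N choose a prime p | N and, by the Chinese remainder
    theorem, d a nonresidue mod p and 1 mod N/p; this works because p divides N exactly once. *)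
Lemma chi_disc_nontrivial : exists2 M, Gamma0 N M & chi_disc N s (M 1 1) = -1.
Proof.
have N0 : (0 < N)%N by apply: ltnW.
suff [d cop cd] : exists2 d : int, coprimez N%:Z d & chi_disc N s d = -1.
  by have [M GM Md] := Gamma0_lower_right cop; exists M; rewrite ?Md.
have [N2|oN] := boolP (2 %| N)%N.
  have [m [N' T]] := even_part hshape hcard N2.
  exists (1 + (m./2 * N')%N%:Z).
    rewrite (two_N T) !PoszM coprimezMl; apply/andP; split; last first.
      by rewrite addrC /coprimez gcdzMDl gcdz1.
    have oN' := two_odd T.
    have [n0 [n1 [_ hm _]]] := two_bad T.
    have c2 x : odd `|x|%N -> coprimez 2 x by rewrite coprimezE /= coprime2n.
    case: hm => -[-> _] /=.
      by rewrite -[4%:Z]/(2%:Z ^+ 2); apply: coprimezXl; apply: c2; lia.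
    by rewrite -[8%:Z]/(2%:Z ^+ 3); apply: coprimezXl; apply: c2; lia.
  by apply: (chi_two_half N0 T (x := 1)); rewrite ?mulr1.
have pN : (pdiv N %| N)%N := pdiv_dvd N.
have pp : prime (pdiv N) by apply: pdiv_prime.
move: (pdiv N) pN pp => p pN pp.
have op : odd p.
  by have [p2|] := even_prime pp => //; rewrite -p2 pN in oN.
have [lN _] := odd_part hshape hcard pp op pN.
have [q [pq NE]] := pfactor_coprime pp N0; rewrite lN expn1 in NE.
have [n [pn ln]] := exists_nonresidue pp op.
have cpq : coprimez p%:Z q%:Z by [].
pose d := zchinese p%:Z q%:Z n 1.
have d1 : (d = n %[mod p])%Z := zchinese_modl cpq n 1.
have d2 : (d = 1 %[mod q])%Z := zchinese_modr cpq n 1.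
exists d.
  rewrite NE PoszM coprimezMl; apply/andP; split.
    have /dvdzP[t ht] : (q%:Z %| d - 1)%Z by rewrite -eqz_mod_dvd d2.
    have -> : d = t * q%:Z + 1 by rewrite -ht subrK.
    by rewrite /coprimez gcdzMDl gcdz1.
  rewrite coprimezE prime_coprime //; apply: contra pn => pd.
  have pd' : (p%:Z %| d)%Z := pd.
  have : (p%:Z %| d - n)%Z by rewrite -eqz_mod_dvd d1.
  by move/(rpredB pd'); rewrite opprB addrC subrK.
rewrite /chi_disc (bigD1_seq p) ?primes_uniq ?mem_primes ?pp ?N0 ?pN //=.
rewrite big_seq_cond big1 ?mulr1.
  by rewrite /chi_prime ifF ?(legendre_mod d1) //; apply/eqP => p2; rewrite p2 in op.
move=> l; rewrite mem_primes => /andP[/and3P[pl _ lN'] lp].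
have ol : l != 2%N by apply: contraNneq oN => <-.
rewrite /chi_prime (negPf ol) -[RHS](legendre_one (prime_gt1 pl)).
apply: legendre_mod; apply/eqP; move/eqP: d2; rewrite !eqz_mod_dvd.
apply: dvdz_trans; rewrite dvdzE /=.
move: lN'; rewrite NE Euclid_dvdM // => /orP[//|].
by rewrite dvdn_prime2 // (negPf lp).
Qed.

End DirichletCharacter.

(** * Differences of forms *)

Section Difference.
Variables (R : realType) (N : nat) (k : int) (s : disc_shape).
Local Notation C := R[i].
Implicit Types (f g : C -> C).

(** Keeps the coefficients themselves, as needed for the sign condition on f - g and for comparing
    principal parts. *)
Lemma qexp_sub h f g (a b : int -> C) : qexp h f a -> qexp h g b ->
  qexp h (fun tau => f tau - g tau) (fun n => a n - b n).
Proof.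
move=> [h0 [m [am H]]] [_ [m' [bm H']]].
have Hf : hexp h m (fun j => a (j%:Z - m%:Z)) f by split.
have Hg : hexp h m' (fun j => b (j%:Z - m'%:Z)) g by split.
split; first exact: h0.
exists (m + m')%N; split.
  by move=> n nm; rewrite am ?bm ?subr0 //; lia.
have Hg' := hexpZ (-1) (hexp_shift m Hg); rewrite addnC in Hg'.
have [_ HS] := hexpD (hexp_shift m' Hf) Hg'; move=> tau ut.
have -> : f tau - g tau = f tau + -1 * g tau by rewrite mulN1r.
apply: cvg_trans (HS tau ut).
suff -> : (fun j : nat => (a (j%:Z - (m + m')%N%:Z) - b (j%:Z - (m + m')%N%:Z)) *
     qpow h (j%:Z - (m + m')%N%:Z) tau : C^o) =
   (fun j : nat => (shiftv m' (fun j => a (j%:Z - m%:Z)) j +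
      -1 * shiftv m (fun j => b (j%:Z - m'%:Z)) j) *
     qpow h (j%:Z - (m + m')%N%:Z) tau) by exact.
apply/funext => j; congr (_ * _); rewrite mulN1r /shiftv; congr (_ - _).
  case: leqP => h1; last by apply: am; lia.
  by have -> : j%:Z - (m + m')%N%:Z = (j - m')%N%:Z - m%:Z by lia.
case: leqP => h1; last by apply: bm; lia.
by have -> : j%:Z - (m + m')%N%:Z = (j - m)%N%:Z - m'%:Z by lia.
Qed.

Lemma slash_sub f g M tau :
  slash k (fun t => f t - g t) M tau = slash k f M tau - slash k g M tau.
Proof. by rewrite /slash mulrBr. Qed.

Lemma Aeps_sub f g : Aeps N k s f -> Aeps N k s g ->
  Aeps N k s (fun tau => f tau - g tau).
Proof.
move=> [[df tf mf] [a [qa Ha]]] [[dg tg mg] [b [qb Hb]]]; split.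
  split.
  - by move=> tau ut; apply: derivableB; [apply: df|apply: dg].
  - by move=> M GM tau ut; rewrite tf // tg // mulrBr.
  - move=> M SM; have [h [c hc]] := mf M SM; have [h' [c' hc']] := mg M SM.
    have E := @qexp_has_exp R h _ c (fun=> True) hc (fun _ _ => I).
    have E' := @qexp_has_exp R h' _ c' (fun=> True) hc' (fun _ _ => I).
    have [h2 [c2 [_ H2 _]]] := has_exp_qexp (has_expB E E').
    exists h2, c2; have [h20 [m [cm HH]]] := H2; split; first exact: h20.
    exists m; split; first exact: cm.
    by move=> tau ut; rewrite slash_sub; apply: HH.
exists (fun n => a n - b n); split; first exact: qexp_sub.
by move=> n p pp pN h; rewrite (Ha n p) // (Hb n p) // subr0.
Qed.

End Difference.

(** * Forms of nonpositive weight *)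

Section NonpositiveWeight.
Variables (R : realType) (D : discForm) (s : disc_shape) (N : nat) (k : int).
Variable f : R[i] -> R[i].
Local Notation C := R[i].
Hypotheses (hshape : has_shape D s) (hcard : #|D| = N) (hN : (1 < N)%N).
Hypothesis hf : Aeps N k s f.
Hypothesis holo : forall M, SL2Z M -> has_exp (slash k f M) (fun l => 0 <= l).
Implicit Types (M : 'M[int]_2) (tau : C).

Let N_gt0 : (0 < N)%N. Proof. exact: ltnW. Qed.

(** The matrix [G] is M M'^(-1), which is congruent to the identity mod N, so the character is 1 on
    its lower right entry. *)
Lemma slash_congr M M' tau : SL2Z M -> SL2Z M' ->
  (forall i j, (M i j = M' i j %[mod N])%Z) -> upper tau ->
  slash k f M tau = slash k f M' tau.
Proof.
move=> SM SM' cong ut.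
have d1 : \det M = 1 by []. have d2 : \det M' = 1 by [].
have dM' : 0 < \det M' by rewrite SM'.
rewrite det_mx22 in d1; rewrite det_mx22 in d2.
pose G := mx2 (M 0 0 * M' 1 1 - M 0 1 * M' 1 0) (- M 0 0 * M' 0 1 + M 0 1 * M' 0 0)
  (M 1 0 * M' 1 1 - M 1 1 * M' 1 0) (- M 1 0 * M' 0 1 + M 1 1 * M' 0 0).
have ex i j : exists t : int, M i j = M' i j + N%:Z * t.
  have /dvdzP[t ht] : (N%:Z %| M i j - M' i j)%Z by rewrite -eqz_mod_dvd cong.
  by exists t; rewrite mulrC -ht addrC subrK.
have [u eu] := ex 1 0; have [v ev] := ex 1 1.
have GM : Gamma0 N G.
  split.
    rewrite /SL2Z det_mx22 !mx2E -[RHS]mulr1 -{1}d1 -d2; ring.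
  rewrite mx2E eu ev; apply/dvdzP; exists (u * M' 1 1 - v * M' 1 0); ring.
have E : G *m M' = M.
  apply: mx2P; rewrite mulmx2 !mx2E.
  - by rewrite -[RHS]mulr1 -d2; ring.
  - by rewrite -[RHS]mulr1 -d2; ring.
  - by rewrite -[RHS]mulr1 -d2; ring.
  - by rewrite -[RHS]mulr1 -d2; ring.
rewrite -E (slash_Gamma0_mul hf GM dM' ut) (chi_disc_one hshape hcard) ?mul1r //.
apply/eqP; rewrite eqz_mod_dvd mx2E eu ev -d2; apply/dvdzP.
by exists (- u * M' 0 1 + v * M' 0 0); ring.
Qed.

(** On Im tau >= 1/5 each f|M is within 1 of a polynomial in a variable of absolute value at most 1;
    by [slash_congr] finitely many M suffice. *)
Lemma slash_bounded : exists2 b : R, 0 <= b &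
  forall M, SL2Z M -> forall tau, 1 / 5 <= complex.Im tau ->
    normc (slash k f M tau) <= b.
Proof.
pose Pr M (b : R) :=
  forall tau, 1 / 5 <= complex.Im tau -> normc (slash k f M tau) <= b.
have [|M b b' bb H tau ht|b b0 Hb] := @finite_cusps R N Pr N_gt0.
- move=> M SM; have [h [w H]] := hexp_nonneg (holo SM).
  have y0 : (0 : R) < 1 / 5 by rewrite divr_gt0.
  have [L HL] := hexp_uniform H y0 ltr01.
  exists (1 + \sum_(i < L) normc (w i)).
    by rewrite addr_ge0 // sumr_ge0 // => i _; apply: normc_ge0.
  move=> tau ht; have := HL L (leqnn L) tau ht.
  set p := (\poly_(i < L) w i).[_] => Hp.
  have -> : slash k f M tau = (slash k f M tau - p) + p by ring.
  apply: le_trans (normc_add _ _) _; apply: lerD => //.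
  rewrite /p horner_poly; apply: le_trans (normc_sum _ _ _) _.
  apply: ler_sum => i _; rewrite normcM normc_exp ler_piMr ?normc_ge0 //.
  rewrite exprn_ile1 ?normc_ge0 // normc_zq expR_le1 oppr_le0.
  by rewrite !mulr_ge0 ?invr_ge0 ?(ltW (trigo.pi_gt0 R)) //; lra.
- exact: le_trans (H tau ht) bb.
exists b => // M SM tau ht; have [M' [SM' cong HM']] := Hb M SM.
by rewrite (slash_congr SM SM' cong) ?HM' // /upper; lra.
Qed.

(** Write tau = M sig with Im sig >= 1/5 and let c be the norm of the cocycle. Then c^K |f(tau)| <=
    b, and 5 Im tau = 5 Im sig/c^2 >= 1/c^2. *)
Lemma growth (K : nat) : k = - K%:Z -> exists2 b : R, 0 <= b &
  forall tau, upper tau ->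
    normc (f tau) ^+ 2 <= b ^+ 2 * (5 * complex.Im tau) ^+ K.
Proof.
move=> kK; have [b b0 Hb] := slash_bounded; exists b => // tau ut.
have [M [sig [SM hs ->]]] := reduction ut.
have us : upper sig by rewrite /upper; lra.
have dM : \det M != 0 by rewrite SM.
have := Hb M SM sig hs; rewrite /slash kK opprK normcM.
have nz := cocycle_neq0 dM us.
rewrite im_moebius // SM mul1r -exprnP normc_exp.
set c := normc (cocycle M sig); set F := normc _ => H.
have c0 : 0 < c.
  by rewrite /c lt_neqAle eq_sym normc_ge0 andbT; apply: contra nz => /eqP/eq0_normc ->.
have F0 : 0 <= F by apply: normc_ge0.
have c20 : 0 < (c ^+ 2) ^+ K by rewrite !exprn_gt0.
rewrite -(ler_pM2r c20) -[X in _ <= X]mulrA -exprMn.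
apply: (@le_trans _ _ (b ^+ 2)).
  rewrite -exprM mulnC exprM -exprMn lerXn2r ?nnegrE ?mulr_ge0 ?exprn_ge0 ?(ltW c0) //.
  by rewrite mulrC.
rewrite -[5 * _ * _]mulrA divfK ?lt0r_neq0 ?exprn_gt0 // ler_peMr ?sqr_ge0 //.
by rewrite exprn_ege1 //; lra.
Qed.

Lemma circle_dom h (y t : R) : (0 < h)%N -> exists2 tau, y <= complex.Im tau &
  zq h tau = (expR (- (2 * trigo.pi * (y / h%:R))))%:C * e2 t%:C.
Proof. by move=> h0; exists ((h%:R * t) +i* y); [|exact: zq_circle]. Qed.

Lemma exp_f : exists h w, hexp h 0 w f.
Proof.
have [|h [w H]] := hexp_nonneg (holo (_ : SL2Z 1%:M)); first exact: det1.
by exists h, w; apply: hexp_ext H => tau _; rewrite slash1.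
Qed.

(* By [growth] and Parseval the n-th coefficient is bounded by a positive power of
   the height y, for every small y. *)
Lemma negative_weight_zero : k < 0 -> forall tau, upper tau -> f tau = 0.
Proof.
move=> k0; pose K := `|k|%N; have kK : k = - K%:Z by rewrite /K; lia.
have K0 : (0 < K)%N by rewrite /K; lia.
have [b b0 Hb] := growth kK; have [h [w H]] := exp_f; have [h0 _] := H.
have pi0 := trigo.pi_gt0 R.
have w0 n : w n = 0.
  apply/eq0_normc/eqP; rewrite eq_le normc_ge0 andbT.
  (* Bounds rho^n from below for all heights y <= 1/5, so the estimate of w_n is uniform as y tends
     to 0. *)
  pose c : R := expR (- (2 * trigo.pi * (1 / 5 / h%:R))) ^+ n.
  have c0 : 0 < c by rewrite exprn_gt0 // expR_gt0.
  have small (y : R) : 0 < y -> y <= 1 / 5 ->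
      (normc (w n) * c) ^+ 2 <= b ^+ 2 * (5 * y).
    move=> y0 y5; have yb : 0 <= b ^+ 2 * (5 * y) by rewrite mulr_ge0 ?sqr_ge0 //; lra.
    pose X := Num.sqrt (b ^+ 2 * (5 * y)).
    have X2 : X ^+ 2 = b ^+ 2 * (5 * y) by rewrite sqr_sqrtr.
    have X0 : 0 <= X by apply: sqrtr_ge0.
    rewrite -X2 lerXn2r ?nnegrE ?mulr_ge0 ?normc_ge0 ?(ltW c0) //.
    apply/ler_addgt0Pl => e e0.
    have [L HL] := hexp_uniform H y0 e0.
    pose p := \poly_(i < maxn L n.+1) w i.
    have pn : p`_n = w n by rewrite coef_poly leq_max ltnSn orbT.
    pose rho := expR (- (2 * trigo.pi * (y / h%:R))).
    have crho : c <= rho ^+ n.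
      rewrite /c lerXn2r ?nnegrE ?expR_ge0 // ler_expR lerN2 ler_pM2l ?mulr_gt0 //.
      by rewrite ler_pM2r ?invr_gt0 ?ltr0n.
    apply: (@le_trans _ _ (normc (w n) * rho ^+ n));
      first by rewrite ler_wpM2l ?normc_ge0.
    rewrite -pn addrC; apply: coef_bound; first exact: expR_ge0.
    move=> t; have uy : upper ((h%:R * t) +i* y) by [].
    rewrite -(zq_circle y t h0).
    have := HL _ (leq_maxl L n.+1) ((h%:R * t) +i* y) (lexx y); rewrite -/p => Hp.
    set q := p.[_] in Hp *.
    have -> : q = f ((h%:R * t) +i* y) - (f ((h%:R * t) +i* y) - q) by ring.
    apply: le_trans (normc_sub _ _) _; apply: lerD => //.
    rewrite -(@ler_pXn2r _ 2) ?nnegrE ?normc_ge0 // X2.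
    apply: le_trans (Hb _ uy) _; rewrite /= ler_wpM2l ?sqr_ge0 //.
    by rewrite -[X in _ <= X]expr1 ler_wiXn2l //; lra.
  rewrite leNgt; apply/negP => wn.
  have S0 : 0 < (normc (w n) * c) ^+ 2 by rewrite exprn_gt0 // mulr_gt0.
  have b1 : 0 < b ^+ 2 + 1 by have := sqr_ge0 b; lra.
  (* Makes 5 y b^2 at most half of the squared left-hand side in [small], a contradiction. *)
  pose y := Num.min (1 / 5) ((normc (w n) * c) ^+ 2 / (b ^+ 2 + 1) / 10).
  have y0 : 0 < y by rewrite lt_min !divr_gt0.
  have y5 : y <= 1 / 5 by rewrite ge_min lexx.
  have := small y y0 y5.
  have : y * 10 * (b ^+ 2 + 1) <= (normc (w n) * c) ^+ 2.
    by rewrite -!ler_pdivlMr // ge_min lexx orbT.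
  have := sqr_ge0 b; set S := (_ * c) ^+ 2 in S0 *; set B := b ^+ 2 => B0.
  have : 0 <= B * y by rewrite mulr_ge0 // ltW.
  by lra.
move=> tau ut; apply/eq0_normc/eqP; rewrite eq_le normc_ge0 andbT.
apply/ler_addgt0Pl => e e0; rewrite addr0.
have [n0 Hn] := hexp_partial H ut e0.
have := Hn n0 (leqnn n0); rewrite horner_poly big1; last first.
  by move=> i _; rewrite w0 mul0r.
by rewrite subr0 => /ltW.
Qed.

(* Let X be the supremum of |f|. If the constant term of every expansion were
   smaller than X in absolute value, [strict_bound] on {Im >= 1/5} would bound |f|
   by a smaller constant. So some expansion, and hence f, is constant; the constant
   is 0 as [chi_disc N s] is nontrivial. *)
Lemma zero_weight_zero : k = 0 -> forall tau, upper tau -> f tau = 0.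
Proof.
move=> k0; have [b b0 Hb] := slash_bounded.
have slash0 M tau : slash k f M tau = f (moebius M tau).
  by rewrite /slash k0 oppr0 expr0z mul1r.
have red tau : upper tau -> exists M sig,
    [/\ SL2Z M, 1 / 5 <= complex.Im sig & f tau = slash k f M sig].
  by move=> /reduction[M [sig [SM hs ->]]]; exists M, sig; rewrite slash0.
pose E : set R := [set x | exists2 tau, upper tau & x = normc (f tau)].
have Eub : has_ubound E.
  exists b => x [tau ut ->]; have [M [sig [SM hs ->]]] := red tau ut; exact: Hb.
have Ene : E !=set0.
  by exists (normc (f 'i)), 'i => //; rewrite /upper /= ltr01.
pose X := sup E.
have fX tau : upper tau -> normc (f tau) <= X.
  by move=> ut; apply: ub_le_sup => //; exists tau.
have X0 : 0 <= X by case: Ene => x [tau ut _]; apply: le_trans (fX tau ut);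
  apply: normc_ge0.
have [Xz|Xn] := eqVneq X 0.
  move=> tau ut; apply/eq0_normc/eqP; rewrite eq_le normc_ge0 andbT -Xz; exact: fX.
have {}X0 : 0 < X by rewrite lt_neqAle eq_sym Xn.
have pi0 := trigo.pi_gt0 R.
(* Half the height 1/5: the boundary circle has radius rho(h), and points of height >= 1/5 have
   |q^(1/h)| <= rho(h)^2, so [strict_bound] applies with u = rho(h) < 1. *)
pose dom tau : Prop := 1 / 10 <= complex.Im tau.
have udom tau : dom tau -> upper tau by rewrite /dom /upper; lra.
have sX M tau : SL2Z M -> upper tau -> normc (slash k f M tau) <= X.
  by move=> SM ut; rewrite slash0; apply: fX; apply: upper_moebius; rewrite ?SM.
pose rho (h : nat) := expR (- (2 * trigo.pi * (1 / 10 / h%:R))) : R.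
have rho0 h : 0 < rho h by apply: expR_gt0.
have y10 : (0 : R) < 1 / 10 by rewrite divr_gt0.
have [[M [h [w [SM H Xw]]]]|no] := pselect (exists M h w,
    [/\ SL2Z M, hexp h 0 w (slash k f M) & X <= normc (w 0%N)]).
  have [h0 _] := H.
  have w0 n : (0 < n)%N -> w n = 0.
    move=> n0; apply: (@max_constant R C dom (zq h) (slash k f M) w (rho h) X n) => //.
    - by move=> y dy; apply: sX => //; apply: udom.
    - by move=> t; apply: circle_dom.
    - move=> e e0; have [L HL] := hexp_uniform H y10 e0.
      exists (maxn L n.+1); first by rewrite leq_max ltnSn orbT.
      by move=> y dy; apply: HL => //; apply: leq_maxl.
  have sw tau : upper tau -> slash k f M tau = w 0%N.
    move=> ut; apply/eqP; rewrite -subr_eq0; apply/eqP/eq0_normc/eqP.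
    rewrite eq_le normc_ge0 andbT; apply/ler_addgt0Pl => e e0; rewrite addr0.
    have [n0 Hn] := hexp_partial H ut e0.
    have := Hn n0.+1 (leqnSn n0); rewrite horner_poly big_ord_recl /= expr0 mulr1.
    by rewrite big1 ?addr0 => [/ltW //|i _]; rewrite w0 ?mul0r.
  have fw tau : upper tau -> f tau = w 0%N.
    have dM : \det M = 1 by []. rewrite det_mx22 in dM.
    pose A := mx2 (M 1 1) (- M 0 1) (- M 1 0) (M 0 0).
    have dA : \det A = 1 by rewrite det_mx22 !mx2E -dM; ring.
    move=> ut; have ua : upper (moebius A tau) by apply: upper_moebius; rewrite ?dA.
    rewrite -(sw _ ua) slash0 -moebius_mul ?dA //.
    have -> : M *m A = 1%:M.
      apply: mx2P; rewrite mulmx2 !mx2E ?mxE /=; rewrite -?dM; ring.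
    by rewrite /moebius /cocycle !mxE /= mul0r add0r mul1r addr0 divr1.
  have [G GG chiG] := chi_disc_nontrivial hshape hcard hN.
  have ui : upper ('i : C) by rewrite /upper /= ltr01.
  have [SG _] := GG; have uG : upper (moebius G ('i : C)) by apply: upper_moebius;
    rewrite ?SG.
  have := slash_Gamma0 hf GG ui; rewrite slash0 !fw // chiG mulN1r => /eqP.
  rewrite -subr_eq0 opprK -mulr2n mulrn_eq0 /= => /eqP wz.
  by move=> tau ut; rewrite fw.
exfalso.
(* The contraction factor th is written 1 - 1/c with c = 1/(1 - th), so that the property is
   monotone in c as [finite_cusps] requires. *)
pose Pr M (c : R) := 1 <= c /\ forall tau, 1 / 5 <= complex.Im tau ->
  normc (slash k f M tau) <= (1 - c^-1) * X.
have [|M c c' cc [c1 HM]|c c0 Hc] := @finite_cusps R N Pr N_gt0.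
- move=> M SM; have [h [w H]] := hexp_nonneg (holo SM); have [h0 _] := H.
  have wX : normc (w 0%N) < X.
    by rewrite ltNge; apply/negP => h1; apply: no; exists M, h, w.
  have hR : (0 : R) < h%:R by rewrite ltr0n.
  have r1 : rho h < 1.
    by rewrite expR_lt1 oppr_lt0; apply: mulr_gt0; [apply: mulr_gt0|rewrite divr_gt0].
  have e0 : 0 <= normc (w 0%N) / X by rewrite divr_ge0 ?normc_ge0 // ltW.
  have e1 : normc (w 0%N) / X < 1 by rewrite ltr_pdivrMr // mul1r.
  have [th /andP[th0 th1] Hth] := strict_bound e0 e1 (ltW (rho0 h)) r1.
  have th1' : 0 < 1 - th by rewrite subr_gt0.
  exists ((1 - th)^-1); first by rewrite invr_ge0 ltW.
  split; first by rewrite invf_ge1 //; lra.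
  move=> tau ht; rewrite invrK subKr.
  apply: (Hth C dom (zq h) (slash k f M) (w 0%N) (rho h) X tau) => //.
  + by move=> y dy; apply: sX => //; apply: udom.
  + by move=> t; apply: circle_dom.
  + move=> e ee; have [L HL] := hexp_uniform H y10 ee.
    exists (\poly_(i < maxn L 1) w i); split; first by rewrite coef_poly leq_max orbT.
    by move=> y dy; apply: HL => //; apply: leq_maxl.
  + by rewrite divfK // lt0r_neq0.
  + by rewrite /dom; lra.
  + rewrite normc_zq /rho -expRD ler_expR -opprD lerN2 -mulrDr ler_pM2l ?mulr_gt0 //.
    by rewrite -mulrDl ler_pM2r ?invr_gt0 //; lra.
- split; first by lra.
  move=> tau /HM h; apply: le_trans h _; rewrite ler_pM2r // lerD2l lerN2.
  by rewrite lef_pV2 ?posrE //; lra.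
have fc tau : upper tau -> normc (f tau) <= (1 - c^-1) * X.
  move=> /red[M [sig [SM hs ->]]]; have [M' [SM' cong [_ HM']]] := Hc M SM.
  by rewrite (slash_congr SM SM' cong) ?HM' // /upper; lra.
have c1 : 1 <= c.
  have [M' [_ _ [h _]]] := Hc 1%:M (det1 _ _); exact: h.
have : X <= (1 - c^-1) * X.
  apply: ge_sup => // x [tau ut ->]; exact: fc.
have : 0 < c^-1 * X by rewrite mulr_gt0 // invr_gt0; lra.
by rewrite mulrBl mul1r; lra.
Qed.

Lemma nonpositive_weight_zero : k <= 0 -> forall tau, upper tau -> f tau = 0.
Proof.
by rewrite le_eqVlt => /orP[/eqP/zero_weight_zero|/negative_weight_zero].
Qed.

End NonpositiveWeight.

Theorem corollary3p6 (R : realType) (D : discForm) (s : disc_shape) (N : nat)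
    (r k : int) (f : R[i] -> R[i])
    (hshape : has_shape D s)
    (hlevel : is_level D N) (hcard : #|D| = N) (hN : (1 < N)%N)
    (hsign : disc_signature D r) (hr : (2 %| r)%Z)
    (hk : (k = (r %/ 2)%Z %[mod 2])%Z)
    (hf : Aeps N k s f) :
  [/\ (holo_at k f 1%:M -> Meps N k s f) /\
      (vanish_at k f 1%:M -> Seps N k s f),
      forall d : nat, (0 < d)%N -> coprime d N -> simple_principal_part f d ->
        forall M : 'M[int]_2, SL2Z M -> ~ cusp_infty N M -> holo_at k f M
    & k <= 0 -> forall g : R[i] -> R[i], Aeps N k s g ->
        same_principal_part f g ->
        forall tau : R[i], upper tau -> f tau = g tau].
Proof.
have N_gt0 : (0 < N)%N by apply: ltnW.
split; first by split; [apply: (holo_all_cusps hshape hcard N_gt0 hf)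
                       |apply: (vanish_all_cusps hshape hcard N_gt0 hf)].
  exact: (holo_other_cusps hshape hcard N_gt0 hf).
move=> k0 g hg [a [b [qa qb ab]]] tau ut; apply/eqP; rewrite -subr_eq0; apply/eqP.
have hfg := Aeps_sub hf hg.
apply: (nonpositive_weight_zero hshape hcard hN hfg _ k0 ut) => M SM.
(* Equal principal parts leave f - g with nonnegative exponents at infinity, a condition stable
   under division by squares. *)
apply: (exp_all_cusps hshape hcard N_gt0 hfg _ _ SM).
  apply: (@has_exp_ext R (fun t => f t - g t)) => [t _|]; first by rewrite slash1.
  apply: (qexp_has_exp (qexp_sub qa qb)) => n nz.
  rewrite divr_ge0 // ler0z leNgt; apply: contra nz => n0.
  by rewrite ab // subrr.
move=> p j l pp l0.
by rewrite divr_ge0 // exprn_ge0 // exprn_ge0.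
Qed.
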